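(* The problem $1\,||\,\sum w_jU_j$ can be solved in $\widetilde{O}(d_{\#}n+d_{\#}d_{\max}p_{\max})$ time; it can also be solved in $\widetilde{O}(n^2+d_{\max}w_{\max}^2)$ time; and it can also be solved in $\widetilde{O}(n^2+d_{\#}(d_{\max}w_{\max})^{1.5})$ time.
   Context: In the problem $1\,||\,\sum w_jU_j$ we are given $n$ jobs $J=\{1,\ldots,n\}$, each job $j$ having a processing time $p_j\in\mathbb{N}$, a weight $w_j\in\mathbb{N}$ and a due date $d_j\in\mathbb{N}$. A schedule is a permutation $\sigma$ of the jobs processed non-preemptively on a single machine; the completion time of $j$ is $C_j=\sum_{i:\sigma(i)\le\sigma(j)}p_i$, and $j$ is tardy if $C_j>d_j$ and early otherwise. The goal is to compute the minimum, over all schedules, of the total weight of tardy jobs. Parameters: $n$ is the number of jobs, $d_{\max}=\max_j d_j$, $p_{\max}=\max_j p_j$, $w_{\max}=\max_j w_j$, and $d_{\#}=|\{d_j : j\in J\}|$ is the number of distinct due dates. $\widetilde{O}$ suppresses polylogarithmic factors. *)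

(* Defs.v *)
From Stdlib Require Import Arith List Permutation Lia.
Import ListNotations.

Record job := Job { proc : nat ; weight : nat ; due : nat }.

Definition is_schedule (J : list job) (s : list nat) : Prop :=
  Permutation s (seq 0 (length J)).

Definition jobs_of (J : list job) (s : list nat) : list job :=
  map (fun i => nth i J (Job 0 0 0)) s.

Fixpoint tardy_weight_from (t : nat) (l : list job) : nat :=
  match l with
  | [] => 0
  | j :: l' =>
      let C := t + proc j in
      (if due j <? C then weight j else 0) + tardy_weight_from C l'
  end.

Definition cost (J : list job) (s : list nat) : nat :=
  tardy_weight_from 0 (jobs_of J s).

Definition is_opt_value (J : list job) (v : nat) : Prop :=
  (exists s, is_schedule J s /\ cost J s = v) /\
  (forall s, is_schedule J s -> v <= cost J s).

Definition n_of (J : list job) : nat := length J.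
Definition dmax (J : list job) : nat := list_max (map due J).
Definition pmax (J : list job) : nat := list_max (map proc J).
Definition wmax (J : list job) : nat := list_max (map weight J).
Definition dnum (J : list job) : nat := length (nodup Nat.eq_dec (map due J)).

Definition inputN (J : list job) : nat := n_of J + dmax J + pmax J + wmax J + 2.

(* Memory: cells indexed by nat, each holding a word.  Instructions address
   memory directly (constant addresses) and indirectly (Load/Store).  Every
   executed instruction costs one time unit. *)
Inductive binop := OAdd | OSub | OMul | ODiv | OMod | OLt | OEq | OAnd | OOr | OXor.

Inductive instr :=
  | IConst (dst : nat) (v : nat)
  | IOp (o : binop) (dst a b : nat)
  | ILoad (dst a : nat)
  | IStore (a src : nat)
  | IJz (a target : nat)
  | IJmp (target : nat)
  | IHalt.

Definition program := list instr.
Definition memory := nat -> nat.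
Definition config := (nat * memory)%type.

Definition upd (m : memory) (a v : nat) : memory :=
  fun x => if Nat.eqb x a then v else m x.

(* All results are reduced modulo 2^w (w = word size); subtraction is
   truncated, division/modulo by zero give 0 / the dividend (Stdlib's
   conventions). *)
Definition eval_op (w : nat) (o : binop) (x y : nat) : nat :=
  (match o with
   | OAdd => x + y | OSub => x - y | OMul => x * y
   | ODiv => x / y | OMod => x mod y
   | OLt => if x <? y then 1 else 0
   | OEq => if x =? y then 1 else 0
   | OAnd => Nat.land x y | OOr => Nat.lor x y | OXor => Nat.lxor x y
   end) mod (2 ^ w).

Definition halted (P : program) (c : config) : Prop :=
  match nth_error P (fst c) with
  | None | Some IHalt => True
  | _ => False
  end.

Definition step (P : program) (w : nat) (c : config) : config :=
  let (pc, m) := c in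
  match nth_error P pc with
  | None | Some IHalt => c
  | Some (IConst d v) => (S pc, upd m d (v mod 2 ^ w))
  | Some (IOp o d a b) => (S pc, upd m d (eval_op w o (m a) (m b)))
  | Some (ILoad d a) => (S pc, upd m d (m (m a)))
  | Some (IStore a s) => (S pc, upd m (m a) (m s))
  | Some (IJz a t) => if Nat.eqb (m a) 0 then (t, m) else (S pc, m)
  | Some (IJmp t) => (t, m)
  end.

Fixpoint run (P : program) (w : nat) (t : nat) (c : config) : config :=
  match t with
  | 0 => c
  | S t' => run P w t' (step P w c)
  end.

(* Input encoding: M[0] = n, M[1+3j] = p_j, M[2+3j] = w_j, M[3+3j] = d_j,
   all other cells 0. *)
Definition encode (J : list job) : memory :=
  fun a =>
    match a with
    | 0 => length J
    | S a' =>
        let j := a' / 3 in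
        if j <? length J then
          let jb := nth j J (Job 0 0 0) in
          match a' mod 3 with
          | 0 => proc jb
          | 1 => weight jb
          | _ => due jb
          end
        else 0
    end.

Definition halts_within (P : program) (w : nat) (m0 : memory) (T : nat) (v : nat) : Prop :=
  exists t, t <= T /\ halted P (run P w t (0, m0)) /\ snd (run P w t (0, m0)) 0 = v.

(* 1||sum w_j U_j can be solved in time O~(f): there is a word-RAM program,
   with word size Theta(log N) (N = n + dmax + pmax + wmax + 2), which on every
   instance outputs the optimum within c * (f(J)+1) * (log N + 1)^k steps. *)
Definition solvable_in (f : list job -> nat) : Prop :=
  exists (P : program) (cw c k : nat),
    1 <= cw /\
    forall J : list job,
      let L := Nat.log2 (inputN J) + 1 in
      exists v, is_opt_value J v /\
        halts_within P (cw * L) (encode J) (c * (f J + 1) * L ^ k) v.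

(* Main.v *)
Require Import Defs.
From Stdlib Require Import Arith List Permutation Lia Bool Sorted ListDec Classical.
Import ListNotations.

(* All programs first sort the jobs by due date, so that a set of early jobs is
   feasible iff every prefix of it fits before the due date of the prefix.

   For the first bound, jobs with the same due date and processing time q form runs, at
   most d_# p_max of them relevant.  A run acts on the table of the best early weight within
   time t by a (max,+)-convolution, on each residue class mod q, with the concave sequence of
   its largest weights.  Concavity makes the optimal split monotone, and halving the
   stride of the rows solved so far costs O(d_max log d_max) per run.

   The other two bounds come from one program running in time about
   n^2 + n min(d_max, w_max^2).  If d_max <= n + w_max^2 it is Lawler and Moore's
   table over time.  Otherwise it tabulates the least time t(w) of a feasible set of weight w.
   A greedy algorithm gives a fractional optimum with prefix times kap_i; an exchange
   argument (swap equal-weight sets that exist by the pigeonhole principle) shows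
   that some integral optimum has, on every prefix i, a weight within O(w_max^2) of
   the best weight reachable in time kap_i.  Since the same holds for the optima
   of the truncated problems, this best weight can be read off the table
   itself, and only O(w_max^2) entries per job are ever needed. *)

(** * A structured language compiled to the word RAM *)

(** The bounds count single instructions of a machine whose input fills its lowest cells. The
    algorithms are therefore written in a small language that charges only loop iterations; compiled
    code runs for at most its length times one plus that number of steps, and lengths are constants.

    Tabulating weights in a window looks circular: the window must be placed before the table is
    known, and the table is reliable only inside the window. The invariant asks for less than least
    times: every finite entry is realised by a feasible selection, and the tie-broken optima of all
    later truncations pass through the window at no more than their own time. The truncation at the
    current job places the window; proximity keeps the optima of the later ones inside it.

    An exchange of sets of equal weight contradicts optimality only if the optimum is chosen with
    care: ties are broken by a potential that strictly drops whenever denser jobs replace less dense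
    ones.

    The term n^2 pays for the greedy algorithm: linearly many cuts, each with a linear search. *)

Inductive aop := AAdd | ASub | AMul | ADiv | AMod | ALt | AEq.

Inductive exp :=
  | Cst (v : nat)
  | Var (x : nat)
  | Bin (o : aop) (e1 e2 : exp)
  | Ld (k : nat) (e : exp).

Inductive cmd :=
  | Skip
  | Asg (x : nat) (e : exp)
  | Sto (k : nat) (e1 e2 : exp)
  | Seq (c1 c2 : cmd)
  | If (e : exp) (c1 c2 : cmd)
  | While (e : exp) (c : cmd).

Record st := St { rg : nat -> nat ; ar : nat -> nat -> nat }.

Definition setr (s : st) (x v : nat) : st :=
  St (fun y => if Nat.eqb y x then v else rg s y) (ar s).

Definition seta (s : st) (k i v : nat) : st :=
  St (rg s) (fun k' i' => if Nat.eqb k' k then if Nat.eqb i' i then v else ar s k' i' else ar s k' i').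

Definition arith (o : aop) (x y : nat) : nat :=
  match o with
  | AAdd => x + y | ASub => x - y | AMul => x * y
  | ADiv => x / y | AMod => x mod y
  | ALt => if x <? y then 1 else 0
  | AEq => if x =? y then 1 else 0
  end.

Definition binop_of (o : aop) : binop :=
  match o with
  | AAdd => OAdd | ASub => OSub | AMul => OMul | ADiv => ODiv | AMod => OMod
  | ALt => OLt | AEq => OEq
  end.

Fixpoint eval (e : exp) (s : st) : nat :=
  match e with
  | Cst v => v
  | Var x => rg s x
  | Bin o a b => arith o (eval a s) (eval b s)
  | Ld k a => ar s k (eval a s)
  end.

(** Sixteen unbounded arrays, interleaved from cell 64 on. The cells below hold the program
    variables (0 to 39) and the stack of temporaries of expressions (40 to 63). *)
Definition cell (k i : nat) : nat := 64 + 16 * i + k.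

(* Only additions, multiplications and address computations can leave the word
   range [0, B): the other operations never exceed their first operand or 1. *)
Fixpoint ok (B : nat) (e : exp) (s : st) : Prop :=
  match e with
  | Cst _ | Var _ => True
  | Bin o a b =>
      ok B a s /\ ok B b s /\
      match o with
      | AAdd | AMul => arith o (eval a s) (eval b s) < B
      | _ => True
      end
  | Ld k a => ok B a s /\ cell k (eval a s) < B
  end.

(* Time is the number of loop iterations; [comp_c_correct] turns it into steps. *)
Inductive exec (B : nat) : cmd -> st -> nat -> st -> Prop :=
  | ESkip s : exec B Skip s 0 s
  | EAsg x e s : ok B e s -> exec B (Asg x e) s 0 (setr s x (eval e s))
  | ESto k a b s : ok B a s -> ok B b s -> cell k (eval a s) < B ->
      exec B (Sto k a b) s 0 (seta s k (eval a s) (eval b s))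
  | ESeq c1 c2 s t1 s1 t2 s2 : exec B c1 s t1 s1 -> exec B c2 s1 t2 s2 ->
      exec B (Seq c1 c2) s (t1 + t2) s2
  | EIfT e c1 c2 s t s' : ok B e s -> eval e s <> 0 -> exec B c1 s t s' ->
      exec B (If e c1 c2) s t s'
  | EIfF e c1 c2 s t s' : ok B e s -> eval e s = 0 -> exec B c2 s t s' ->
      exec B (If e c1 c2) s t s'
  | EWhF e c s : ok B e s -> eval e s = 0 -> exec B (While e c) s 0 s
  | EWhT e c s t1 s1 t2 s2 : ok B e s -> eval e s <> 0 ->
      exec B c s t1 s1 -> exec B (While e c) s1 t2 s2 ->
      exec B (While e c) s (S (t1 + t2)) s2.

Definition address_code (t k : nat) : list instr :=
  [IConst (S t) 16; IOp OMul t t (S t); IConst (S t) (64 + k); IOp OAdd t t (S t)].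

Fixpoint comp_e (e : exp) (t : nat) : list instr :=
  match e with
  | Cst v => [IConst t v]
  | Var x => [IConst t 0; IOp OAdd t x t]
  | Bin o a b => comp_e a t ++ comp_e b (S t) ++ [IOp (binop_of o) t t (S t)]
  | Ld k a =>
      comp_e a t ++ address_code t k ++ [ILoad t t]
  end.

Fixpoint comp_c (c : cmd) (pc : nat) : list instr :=
  match c with
  | Skip => []
  | Asg x e => comp_e e 40 ++ [IConst 41 0; IOp OAdd x 40 41]
  | Sto k a b =>
      comp_e a 40 ++ address_code 40 k ++ comp_e b 41 ++ [IStore 40 41]
  | Seq c1 c2 => let k1 := comp_c c1 pc in k1 ++ comp_c c2 (pc + length k1)
  | If e c1 c2 =>
      let ke := comp_e e 40 in
      let p1 := pc + length ke + 1 in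
      let k1 := comp_c c1 p1 in
      let p2 := p1 + length k1 + 1 in
      let k2 := comp_c c2 p2 in
      ke ++ [IJz 40 p2] ++ k1 ++ [IJmp (p2 + length k2)] ++ k2
  | While e c1 =>
      let ke := comp_e e 40 in
      let p1 := pc + length ke + 1 in
      let k1 := comp_c c1 p1 in
      ke ++ [IJz 40 (p1 + length k1 + 1)] ++ k1 ++ [IJmp pc]
  end.

(** Constants below 128 survive the reduction modulo the word range, and temporaries below 64 never
    meet an array. [Ld] leaves room for the second temporary of [address_code]. *)
Fixpoint wf_e (e : exp) (t : nat) : bool :=
  match e with
  | Cst v => (v <? 128) && (t <? 63)
  | Var x => (x <? 40) && (t <? 63)
  | Bin _ a b => wf_e a t && wf_e b (S t)
  | Ld k a => (k <? 16) && (t <? 62) && wf_e a t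
  end.

Fixpoint wf_c (c : cmd) : bool :=
  match c with
  | Skip => true
  | Asg x e => (x <? 40) && wf_e e 40
  | Sto k a b => (k <? 16) && wf_e a 40 && wf_e b 41
  | Seq c1 c2 => wf_c c1 && wf_c c2
  | If e c1 c2 => wf_e e 40 && wf_c c1 && wf_c c2
  | While e c1 => wf_e e 40 && wf_c c1
  end.

(** * Correctness of the compiler *)

Definition bounded (B : nat) (m : memory) : Prop := forall a, m a < B.

Definition sim (s : st) (m : memory) : Prop :=
  (forall x, x < 40 -> m x = rg s x) /\
  (forall k i, k < 16 -> m (cell k i) = ar s k i).

Definition code_at (P : program) (pc : nat) (c : list instr) : Prop :=
  exists pre post, P = pre ++ c ++ post /\ length pre = pc.

Lemma code_at_app P pc c1 c2 :
  code_at P pc (c1 ++ c2) -> code_at P pc c1 /\ code_at P (pc + length c1) c2.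
Proof.
  intros (pre & post & -> & <-). split.
  - exists pre, (c2 ++ post). now rewrite <- app_assoc.
  - exists (pre ++ c1), post. rewrite length_app, <- !app_assoc. auto.
Qed.

Lemma code_at_cons P pc i c :
  code_at P pc (i :: c) -> nth_error P pc = Some i /\ code_at P (pc + 1) c.
Proof.
  intros (pre & post & -> & <-). split.
  - rewrite nth_error_app2, Nat.sub_diag by lia. reflexivity.
  - exists (pre ++ [i]), post. rewrite length_app, <- !app_assoc. split; [reflexivity | simpl; lia].
Qed.

Lemma run_add P w a b c : run P w (a + b) c = run P w b (run P w a c).
Proof. revert c. induction a; intros; simpl; auto. Qed.

Lemma run_S P w a c : run P w (S a) c = run P w a (step P w c).
Proof. reflexivity. Qed.

Lemma run_chain P w a b c c1 c2 :
  run P w a c = c1 -> run P w b c1 = c2 -> run P w (a + b) c = c2.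
Proof. intros <- <-. apply run_add. Qed.

Lemma upd_same m a v : upd m a v a = v.
Proof. unfold upd. now rewrite Nat.eqb_refl. Qed.

Lemma upd_other m a v x : x <> a -> upd m a v x = m x.
Proof. unfold upd. intros H. apply Nat.eqb_neq in H. now rewrite H. Qed.

Lemma bounded_upd B m a v : bounded B m -> v < B -> bounded B (upd m a v).
Proof. intros H1 H2 x. unfold upd. destruct (x =? a); auto. Qed.

Lemma eval_op_small w o x y :
  x < 2 ^ w -> y < 2 ^ w -> 2 <= 2 ^ w ->
  match o with AAdd | AMul => arith o x y < 2 ^ w | _ => True end ->
  eval_op w (binop_of o) x y = arith o x y /\ arith o x y < 2 ^ w.
Proof.
  intros Hx Hy H2 Ho.
  assert (Hb : arith o x y < 2 ^ w).
  { destruct o; cbn [arith] in *; auto; try lia.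
    - destruct y; [cbn; lia |].
      eapply Nat.le_lt_trans; [apply Nat.Div0.div_le_upper_bound with (q := x); nia | eassumption].
    - destruct y; [cbn; lia |].
      eapply Nat.le_lt_trans; [apply Nat.Div0.mod_le | eassumption].
    - destruct (x <? y); lia.
    - destruct (x =? y); lia. }
  split; auto.
  destruct o; cbn [arith] in *; apply Nat.mod_small; auto.
Qed.

Arguments step : simpl never.

Section Compile.

Variables (P : program) (w : nat).
Hypothesis big : 128 <= 2 ^ w.

Lemma step_const pc m d v :
  nth_error P pc = Some (IConst d v) -> v < 2 ^ w -> step P w (pc, m) = (pc + 1, upd m d v).
Proof. intros H Hv. unfold step. rewrite H, Nat.mod_small, Nat.add_1_r; auto. Qed.

Lemma step_op pc m o d a b :
  nth_error P pc = Some (IOp o d a b) ->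
  step P w (pc, m) = (pc + 1, upd m d (eval_op w o (m a) (m b))).
Proof. intros H. unfold step. now rewrite ?Nat.add_1_r, H. Qed.

Lemma step_load pc m d a :
  nth_error P pc = Some (ILoad d a) -> step P w (pc, m) = (pc + 1, upd m d (m (m a))).
Proof. intros H. unfold step. now rewrite ?Nat.add_1_r, H. Qed.

Lemma step_store pc m a b :
  nth_error P pc = Some (IStore a b) -> step P w (pc, m) = (pc + 1, upd m (m a) (m b)).
Proof. intros H. unfold step. now rewrite ?Nat.add_1_r, H. Qed.

Lemma step_jmp pc m t : nth_error P pc = Some (IJmp t) -> step P w (pc, m) = (t, m).
Proof. intros H. unfold step. now rewrite ?Nat.add_1_r, H. Qed.

Lemma step_jz pc m a t :
  nth_error P pc = Some (IJz a t) ->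
  step P w (pc, m) = if m a =? 0 then (t, m) else (pc + 1, m).
Proof. intros H. unfold step. now rewrite ?Nat.add_1_r, H. Qed.

Lemma sim_agree s m m' :
  sim s m -> (forall a, a < 40 -> m' a = m a) -> (forall a, 64 <= a -> m' a = m a) -> sim s m'.
Proof.
  intros [H1 H2] Ha Hb. split.
  - intros x Hx. rewrite Ha; auto.
  - intros k i Hk. rewrite Hb; auto. unfold cell. lia.
Qed.

Lemma run_address pc t k m i :
  code_at P pc (address_code t k) ->
  bounded (2 ^ w) m -> m t = i -> cell k i < 2 ^ w -> S t < 64 -> k < 16 ->
  exists m', run P w (length (address_code t k)) (pc, m) = (pc + length (address_code t k), m') /\ m' t = cell k i /\ bounded (2 ^ w) m' /\
    (forall a, a < t -> m' a = m a) /\ (forall a, 64 <= a -> m' a = m a).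
Proof.
  intros HC Hb Hi Hc Ht Hk. unfold cell in *.
  apply code_at_cons in HC as [C1 HC]. apply code_at_cons in HC as [C2 HC].
  apply code_at_cons in HC as [C3 HC]. apply code_at_cons in HC as [C4 _].
  set (m1 := upd m (S t) 16).
  set (m2 := upd m1 t (16 * i)).
  set (m3 := upd m2 (S t) (64 + k)).
  set (m4 := upd m3 t (64 + 16 * i + k)).
  exists m4.
  assert (E1 : step P w (pc, m) = (pc + 1, m1)) by (apply step_const; [auto | lia]).
  assert (E2 : step P w (pc + 1, m1) = (pc + 1 + 1, m2)).
  { rewrite (step_op _ _ _ _ _ _ C2). unfold m2. repeat f_equal.
    unfold m1. rewrite upd_same, upd_other by lia. rewrite Hi.
    unfold eval_op. rewrite Nat.mod_small; lia. }
  assert (E3 : step P w (pc + 1 + 1, m2) = (pc + 1 + 1 + 1, m3)) by (apply step_const; [auto | lia]).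
  assert (E4 : step P w (pc + 1 + 1 + 1, m3) = (pc + 1 + 1 + 1 + 1, m4)).
  { rewrite (step_op _ _ _ _ _ _ C4). unfold m4. repeat f_equal.
    unfold m3. rewrite upd_same, upd_other by lia. unfold m2. rewrite upd_same.
    unfold eval_op. rewrite Nat.mod_small; lia. }
  repeat split.
  - replace (pc + length (address_code t k)) with (pc + 1 + 1 + 1 + 1) by (unfold address_code; cbn [length]; lia).
    change (length (address_code t k)) with 4. now rewrite !run_S, E1, E2, E3, E4.
  - apply upd_same.
  - repeat apply bounded_upd; auto; lia.
  - intros a Ha. unfold m4, m3, m2, m1. now rewrite !upd_other by lia.
  - intros a Ha. unfold m4, m3, m2, m1. now rewrite !upd_other by lia.
Qed.

Opaque address_code.

(** Temporaries form a stack: code at level [t] leaves everything below [t] alone, so a left operand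
    survives in [t] while the right one is computed at [S t]. *)
Lemma comp_e_correct e : forall t pc m s,
  code_at P pc (comp_e e t) -> wf_e e t = true -> 40 <= t ->
  sim s m -> bounded (2 ^ w) m -> ok (2 ^ w) e s ->
  exists m', run P w (length (comp_e e t)) (pc, m) = (pc + length (comp_e e t), m') /\
    m' t = eval e s /\ bounded (2 ^ w) m' /\
    (forall a, a < t -> m' a = m a) /\ (forall a, 64 <= a -> m' a = m a).
Proof.
  induction e as [v | x | o a IHa b IHb | k a IHa]; intros t pc m s HC Hwf Ht Hs Hb Hok; simpl in *.
  - apply andb_prop in Hwf as [W1 W2]. apply Nat.ltb_lt in W1, W2.
    apply code_at_cons in HC as [C1 _].
    exists (upd m t v). rewrite (step_const _ _ _ _ C1) by lia. split; [| split; [| split; [| split]]].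
    + f_equal; lia.
    + apply upd_same.
    + apply bounded_upd; auto; lia.
    + intros; apply upd_other; lia.
    + intros; apply upd_other; lia.
  - apply andb_prop in Hwf as [W1 W2]. apply Nat.ltb_lt in W1, W2.
    apply code_at_cons in HC as [C1 HC]. apply code_at_cons in HC as [C2 _].
    assert (Hx : m x = rg s x) by (apply Hs; auto).
    exists (upd (upd m t 0) t (m x)).
    rewrite (step_const _ _ _ _ C1) by lia. rewrite (step_op _ _ _ _ _ _ C2).
    rewrite upd_same, upd_other by lia. unfold eval_op. rewrite Nat.add_0_r, Nat.mod_small by apply Hb.
    split; [| split; [| split; [| split]]].
    + f_equal; lia.
    + rewrite upd_same; auto.
    + repeat apply bounded_upd; auto; lia.
    + intros; rewrite !upd_other; lia.
    + intros; rewrite !upd_other; lia.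
  - destruct Hok as (Ka & Kb & Ko).
    apply andb_prop in Hwf as [W1 W2].
    apply code_at_app in HC as [C1 HC]. apply code_at_app in HC as [C2 HC].
    apply code_at_cons in HC as [C3 _].
    destruct (IHa t pc m s) as (m1 & R1 & V1 & B1 & L1 & H1); auto.
    assert (S1 : sim s m1) by (eapply sim_agree; [exact Hs | intros; apply L1; lia | auto]).
    destruct (IHb (S t) _ m1 s C2) as (m2 & R2 & V2 & B2 & L2 & H2); auto.
    assert (t < 63).
    { clear - W1 W2. revert W2. clear W1. generalize b. clear b.
      assert (forall b t, wf_e b t = true -> t < 63) as G.
      { induction b; simpl; intros; repeat match goal with H : _ && _ = true |- _ => apply andb_prop in H as [? ?] end;
          repeat match goal with H : (_ <? _) = true |- _ => apply Nat.ltb_lt in H end; auto; try lia.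
         }
      intros b H. apply G in H. lia. }
    destruct (eval_op_small w o (eval a s) (eval b s)) as [E1 E2]; auto; try lia.
    { rewrite <- V1. auto. }
    { rewrite <- V2. auto. }
    exists (upd m2 t (arith o (eval a s) (eval b s))).
    split; [| split; [| split; [| split]]].
    + rewrite !length_app. eapply run_chain; [exact R1 |]. eapply run_chain; [exact R2 |].
      simpl. rewrite (step_op _ _ _ _ _ _ C3), V2, L2, V1, E1 by lia. f_equal; lia.
    + apply upd_same.
    + apply bounded_upd; auto.
    + intros; rewrite upd_other, L2, L1; lia.
    + intros; rewrite upd_other, H2, H1; lia.
  - destruct Hok as (Ka & Kc).
    apply andb_prop in Hwf as [W1 W2]. apply andb_prop in W1 as [W1 W3].
    apply Nat.ltb_lt in W1, W3.
    apply code_at_app in HC as [C1 HC].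
    apply code_at_app in HC as [C2 C3]. apply code_at_cons in C3 as [C3 _].
    destruct (IHa t pc m s) as (m1 & R1 & V1 & B1 & L1 & H1); auto.
    assert (S1 : sim s m1) by (eapply sim_agree; [exact Hs | intros; apply L1; lia | auto]).
    destruct (run_address _ t k m1 (eval a s) C2) as (m2 & R2 & V2 & B2 & L2 & H2); auto; try lia.
    assert (E : m2 (m2 t) = ar s k (eval a s)).
    { rewrite V2, H2 by (unfold cell; lia). apply S1; auto. }
    exists (upd m2 t (m2 (m2 t))). split; [| split; [| split; [| split]]].
    + rewrite length_app. eapply run_chain; [exact R1 |].
      rewrite length_app. eapply run_chain; [exact R2 |].
      simpl. rewrite (step_load _ _ _ _ C3). f_equal; lia.
    + rewrite upd_same. exact E.
    + apply bounded_upd; auto.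
    + intros; rewrite upd_other, L2, L1; lia.
    + intros; rewrite upd_other, H2, H1; lia.
Qed.

Lemma sim_seta s m k i v : sim s m -> k < 16 -> sim (seta s k i v) (upd m (cell k i) v).
Proof.
  intros [H1 H2] Hk. split; simpl.
  - intros y Hy. rewrite upd_other; auto. unfold cell. lia.
  - intros k' i' Hk'. unfold upd.
    destruct (Nat.eqb_spec k' k) as [-> | Hn].
    + destruct (Nat.eqb_spec i' i) as [-> | Hi].
      * now rewrite Nat.eqb_refl.
      * destruct (Nat.eqb_spec (cell k i') (cell k i)); auto. unfold cell in *; lia.
    + destruct (Nat.eqb_spec (cell k' i') (cell k i)); auto. unfold cell in *; lia.
Qed.

Lemma comp_e_pos e t : 1 <= length (comp_e e t).
Proof. destruct e; simpl; rewrite ?length_app; simpl; lia. Qed.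

(** Apart from loops every instruction runs at most once, and each loop iteration pays for one more
    pass over the code. This gives the code length times one plus the number of iterations. *)
Lemma comp_c_correct c s t s' (E : exec (2 ^ w) c s t s') : forall pc m,
  code_at P pc (comp_c c pc) -> wf_c c = true -> sim s m -> bounded (2 ^ w) m ->
  exists k m', run P w k (pc, m) = (pc + length (comp_c c pc), m') /\
    sim s' m' /\ bounded (2 ^ w) m' /\ k <= length (comp_c c pc) * S t.
Proof.
  induction E; intros pc m HC Hwf Hs Hb; simpl in *.
  - exists 0, m. simpl. rewrite Nat.add_0_r. auto.
  - apply andb_prop in Hwf as [W1 W2]. apply Nat.ltb_lt in W1.
    apply code_at_app in HC as [C1 HC]. apply code_at_cons in HC as [C2 HC].
    apply code_at_cons in HC as [C3 _].
    destruct (comp_e_correct e 40 pc m s) as (m1 & R1 & V1 & B1 & L1 & H1); auto.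
    assert (S1 : sim s m1) by (eapply sim_agree; [exact Hs | intros; apply L1; lia | auto]).
    exists (length (comp_e e 40) + 2), (upd (upd m1 41 0) x (eval e s)). repeat split.
    + eapply run_chain; [exact R1 |]. simpl. rewrite (step_const _ _ _ _ C2) by lia.
      rewrite (step_op _ _ _ _ _ _ C3). rewrite upd_same, upd_other, V1 by lia.
      unfold eval_op. rewrite Nat.add_0_r, Nat.mod_small by (rewrite <- V1; auto).
      rewrite length_app. simpl. f_equal; lia.
    + intros y Hy. simpl. unfold upd at 1. destruct (y =? x); auto.
      rewrite upd_other by lia. apply S1; auto.
    + intros k i Hk. rewrite !upd_other by (unfold cell; lia). apply S1; auto.
    + repeat apply bounded_upd; auto; try lia. rewrite <- V1; auto.
    + rewrite length_app. simpl. lia.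
  - apply andb_prop in Hwf as [W1 W3]. apply andb_prop in W1 as [W1 W2]. apply Nat.ltb_lt in W1.
    apply code_at_app in HC as [C1 HC].
    apply code_at_app in HC as [C2 HC].
    apply code_at_app in HC as [C3 HC]. apply code_at_cons in HC as [C4 _].
    destruct (comp_e_correct a 40 pc m s) as (m1 & R1 & V1 & B1 & L1 & H1'); auto.
    assert (S1 : sim s m1) by (eapply sim_agree; [exact Hs | intros; apply L1; lia | auto]).
    destruct (run_address _ 40 k m1 (eval a s) C2) as (m2 & R2 & V2 & B2 & L2 & H2'); auto; try lia.
    assert (S2 : sim s m2) by (eapply sim_agree; [exact S1 | intros; apply L2; lia | auto]).
    destruct (comp_e_correct b 41 _ m2 s C3) as (m3 & R3 & V3 & B3 & L3 & H3'); auto.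
    assert (S3 : sim s m3) by (eapply sim_agree; [exact S2 | intros; apply L3; lia | auto]).
    exists (length (comp_e a 40) + (length (address_code 40 k) + (length (comp_e b 41) + 1))), (upd m3 (cell k (eval a s)) (eval b s)).
    split; [| split; [| split]].
    + eapply run_chain; [exact R1 |]. eapply run_chain; [exact R2 |].
      eapply run_chain; [exact R3 |]. rewrite run_S.
      rewrite (step_store _ _ _ _ C4). simpl. rewrite V3, L3, V2 by lia.
      f_equal. rewrite !length_app. simpl. lia.
    + apply sim_seta; auto.
    + apply bounded_upd; auto. rewrite <- V3; auto.
    + rewrite !length_app. simpl. lia.
  - apply andb_prop in Hwf as [W1 W2].
    apply code_at_app in HC as [C1 C2].
    destruct (IHE1 pc m) as (k1 & m1 & R1 & S1 & B1 & K1); auto.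
    destruct (IHE2 _ m1 C2) as (k2 & m2 & R2 & S2 & B2 & K2); auto.
    exists (k1 + k2), m2. split; [| split; [| split]]; auto.
    + eapply run_chain; [exact R1 |]. rewrite R2. rewrite length_app. f_equal; lia.
    + rewrite length_app. nia.
  - apply andb_prop in Hwf as [W1 W2]. apply andb_prop in W1 as [W0 W1].
    apply code_at_app in HC as [C1 HC]. apply code_at_cons in HC as [C2 HC].
    apply code_at_app in HC as [C3 HC]. apply code_at_cons in HC as [C4 C5].
    destruct (comp_e_correct e 40 pc m s) as (m1 & R1 & V1 & B1 & L1 & H1); auto.
    assert (S1 : sim s m1) by (eapply sim_agree; [exact Hs | intros; apply L1; lia | auto]).
    destruct (IHE (pc + length (comp_e e 40) + 1) m1) as (k2 & m2 & R2 & S2 & B2 & K2); auto.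
    exists (length (comp_e e 40) + (1 + (k2 + 1))), m2. split; [| split; [| split]]; auto.
    + eapply run_chain; [exact R1 |]. eapply run_chain; [rewrite run_S, (step_jz _ _ _ _ C2), V1 |].
      * destruct (Nat.eqb_spec (eval e s) 0); [lia | reflexivity].
      * eapply run_chain; [exact R2 |]. rewrite run_S.
        rewrite (step_jmp _ _ _ C4).
        rewrite !length_app. simpl. rewrite !length_app. simpl. f_equal. lia.
    + rewrite !length_app. simpl. rewrite !length_app. simpl. nia.
  - apply andb_prop in Hwf as [W1 W2]. apply andb_prop in W1 as [W0 W1].
    apply code_at_app in HC as [C1 HC]. apply code_at_cons in HC as [C2 HC].
    apply code_at_app in HC as [C3 HC]. apply code_at_cons in HC as [C4 C5].
    destruct (comp_e_correct e 40 pc m s) as (m1 & R1 & V1 & B1 & L1 & H1); auto.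
    assert (S1 : sim s m1) by (eapply sim_agree; [exact Hs | intros; apply L1; lia | auto]).
    set (p2 := pc + length (comp_e e 40) + 1 + length (comp_c c1 (pc + length (comp_e e 40) + 1)) + 1) in *.
    destruct (IHE p2 m1) as (k2 & m2 & R2 & S2 & B2 & K2); auto.
    exists (length (comp_e e 40) + (1 + k2)), m2. split; [| split; [| split]]; auto.
    + eapply run_chain; [exact R1 |]. eapply run_chain; [rewrite run_S, (step_jz _ _ _ _ C2), V1 |].
      * rewrite H0. reflexivity.
      * simpl. rewrite R2. f_equal. rewrite !length_app. simpl. rewrite !length_app. simpl.
        unfold p2. lia.
    + rewrite !length_app. simpl. rewrite !length_app. simpl. nia.
  - apply andb_prop in Hwf as [W1 W2].
    apply code_at_app in HC as [C1 HC]. apply code_at_cons in HC as [C2 HC].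
    destruct (comp_e_correct e 40 pc m s) as (m1 & R1 & V1 & B1 & L1 & H1); auto.
    assert (S1 : sim s m1) by (eapply sim_agree; [exact Hs | intros; apply L1; lia | auto]).
    exists (length (comp_e e 40) + 1), m1. split; [| split; [| split]]; auto.
    + eapply run_chain; [exact R1 |]. rewrite run_S, (step_jz _ _ _ _ C2), V1, H0. simpl.
      f_equal. rewrite !length_app. simpl. rewrite !length_app. simpl. lia.
    + rewrite !length_app. simpl. lia.
  - assert (HC' := HC). assert (Hwf' := Hwf).
    apply andb_prop in Hwf as [W1 W2].
    apply code_at_app in HC as [C1 HC]. apply code_at_cons in HC as [C2 HC].
    apply code_at_app in HC as [C3 HC]. apply code_at_cons in HC as [C4 _].
    destruct (comp_e_correct e 40 pc m s) as (m1 & R1 & V1 & B1 & L1 & H1); auto.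
    assert (S1 : sim s m1) by (eapply sim_agree; [exact Hs | intros; apply L1; lia | auto]).
    destruct (IHE1 _ m1 C3) as (k2 & m2 & R2 & S2 & B2 & K2); auto.
    destruct (IHE2 pc m2) as (k3 & m3 & R3 & S3 & B3 & K3); auto.
    exists (length (comp_e e 40) + (1 + (k2 + (1 + k3)))), m3. split; [| split; [| split]]; auto.
    + eapply run_chain; [exact R1 |]. eapply run_chain; [rewrite run_S, (step_jz _ _ _ _ C2), V1 |].
      * destruct (Nat.eqb_spec (eval e s) 0); [lia | reflexivity].
      * eapply run_chain; [exact R2 |].
        eapply run_chain; [| exact R3]. rewrite run_S.
        rewrite (step_jmp _ _ _ C4). reflexivity.
    + rewrite !length_app in *. simpl in *. rewrite !length_app in *. simpl in *.
      pose proof (comp_e_pos e 40). nia.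
Qed.

End Compile.

(** * Write sets and a program logic with time bounds *)

Fixpoint wrr (c : cmd) (x : nat) : bool :=
  match c with
  | Skip | Sto _ _ _ => false
  | Asg y _ => x =? y
  | Seq c1 c2 | If _ c1 c2 => wrr c1 x || wrr c2 x
  | While _ c1 => wrr c1 x
  end.

Fixpoint wra (c : cmd) (k : nat) : bool :=
  match c with
  | Skip | Asg _ _ => false
  | Sto k' _ _ => k =? k'
  | Seq c1 c2 | If _ c1 c2 => wra c1 k || wra c2 k
  | While _ c1 => wra c1 k
  end.

(** Write sets are computed syntactically, so that the preservation of a register or array is
    settled by [eq_refl] wherever it is used. *)
Definition frame (c : cmd) (s s' : st) : Prop :=
  (forall x, wrr c x = false -> rg s' x = rg s x) /\
  (forall k, wra c k = false -> forall i, ar s' k i = ar s k i).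

Lemma frame_refl c s : frame c s s.
Proof. split; auto. Qed.

Lemma frame_trans c s1 s2 s3 : frame c s1 s2 -> frame c s2 s3 -> frame c s1 s3.
Proof.
  intros [A1 A2] [B1 B2]. split; intros.
  - rewrite B1, A1; auto.
  - rewrite B2, A2; auto.
Qed.

Lemma frame_weaken c c' s s' :
  (forall x, wrr c' x = false -> wrr c x = false) ->
  (forall x, wra c' x = false -> wra c x = false) ->
  frame c s s' -> frame c' s s'.
Proof. intros H1 H2 [A B]. split; auto. Qed.

Lemma exec_frame B c s t s' : exec B c s t s' -> frame c s s'.
Proof.
  induction 1; try apply frame_refl.
  - split; simpl; intros; auto. rewrite H0. auto.
  - split; simpl; intros; auto. rewrite H2. auto.
  - eapply frame_trans; [eapply frame_weaken; [| | exact IHexec1] | eapply frame_weaken; [| | exact IHexec2]];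
      simpl; intros; match goal with H : _ || _ = false |- _ => apply orb_false_iff in H; tauto end.
  - eapply frame_weaken; [| | exact IHexec]; simpl; intros;
      match goal with H : _ || _ = false |- _ => apply orb_false_iff in H; tauto end.
  - eapply frame_weaken; [| | exact IHexec]; simpl; intros;
      match goal with H : _ || _ = false |- _ => apply orb_false_iff in H; tauto end.
  - eapply frame_trans; [| eassumption]. eapply frame_weaken; [| | exact IHexec1]; auto.
Qed.

Definition runs (B : nat) (c : cmd) (s : st) (T : nat) (R : st -> Prop) : Prop :=
  exists t s', exec B c s t s' /\ t <= T /\ R s'.

Lemma runs_weaken B c s T T' (R R' : st -> Prop) :
  runs B c s T R -> T <= T' -> (forall s', frame c s s' -> R s' -> R' s') -> runs B c s T' R'.
Proof.
  intros (t & s' & E & Ht & HR) HT H. exists t, s'. repeat split; auto; try lia.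
  apply H; auto. eapply exec_frame; eauto.
Qed.

(** The second command is proved inside the postcondition of the first, where the intermediate state
    and its frame are at hand. *)
Lemma runs_seq B c1 c2 s T1 T2 T R :
  T1 + T2 <= T -> runs B c1 s T1 (fun s1 => frame c1 s s1 -> runs B c2 s1 T2 R) ->
  runs B (Seq c1 c2) s T R.
Proof.
  intros HT (t1 & s1 & E1 & H1 & K).
  destruct (K (exec_frame _ _ _ _ _ E1)) as (t2 & s2 & E2 & H2 & HR).
  exists (t1 + t2), s2. repeat split; auto; try lia. econstructor; eauto.
Qed.

Lemma runs_skip B s T (R : st -> Prop) : R s -> runs B Skip s T R.
Proof. intros. exists 0, s. repeat split; auto; try lia. constructor. Qed.

Lemma runs_asg B x e s T (R : st -> Prop) :
  ok B e s -> R (setr s x (eval e s)) -> runs B (Asg x e) s T R.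
Proof. intros. eexists 0, _. repeat split; eauto; try lia. constructor; auto. Qed.

Lemma runs_sto B k a b s T (R : st -> Prop) :
  ok B a s /\ ok B b s /\ cell k (eval a s) < B ->
  R (seta s k (eval a s) (eval b s)) -> runs B (Sto k a b) s T R.
Proof. intros (? & ? & ?) ?. eexists 0, _. repeat split; eauto; try lia. constructor; auto. Qed.

Lemma runs_asg_seq B x e c s T R :
  ok B e s -> runs B c (setr s x (eval e s)) T R -> runs B (Seq (Asg x e) c) s T R.
Proof.
  intros. eapply (runs_seq _ _ _ _ 0 T); [lia |]. apply runs_asg; auto.
Qed.

Lemma runs_sto_seq B k a b c s T R :
  ok B a s /\ ok B b s /\ cell k (eval a s) < B ->
  runs B c (seta s k (eval a s) (eval b s)) T R -> runs B (Seq (Sto k a b) c) s T R.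
Proof.
  intros. eapply (runs_seq _ _ _ _ 0 T); [lia |]. apply runs_sto; auto.
Qed.

Lemma runs_if B e c1 c2 s T R :
  ok B e s -> (eval e s <> 0 -> runs B c1 s T R) -> (eval e s = 0 -> runs B c2 s T R) ->
  runs B (If e c1 c2) s T R.
Proof.
  intros Hok H1 H2. destruct (Nat.eq_dec (eval e s) 0) as [Hz | Hz].
  - destruct (H2 Hz) as (t & s' & E & ? & ?). exists t, s'. repeat split; auto. now apply EIfF.
  - destruct (H1 Hz) as (t & s' & E & ? & ?). exists t, s'. repeat split; auto. now apply EIfT.
Qed.

Lemma runs_if_seq B e c1 c2 c s T R :
  ok B e s -> (eval e s <> 0 -> runs B (Seq c1 c) s T R) ->
  (eval e s = 0 -> runs B (Seq c2 c) s T R) ->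
  runs B (Seq (If e c1 c2) c) s T R.
Proof.
  intros Hok H1 H2. destruct (Nat.eq_dec (eval e s) 0) as [Hz | Hz].
  - destruct (H2 Hz) as (t & s' & E & ? & ?). exists t, s'. repeat split; auto.
    inversion E; subst. econstructor; eauto. now apply EIfF.
  - destruct (H1 Hz) as (t & s' & E & ? & ?). exists t, s'. repeat split; auto.
    inversion E; subst. econstructor; eauto. now apply EIfT.
Qed.

Lemma runs_skip_seq B c s T R : runs B c s T R -> runs B (Seq Skip c) s T R.
Proof.
  intros. eapply (runs_seq _ _ _ _ 0 T); [lia |]. now apply runs_skip.
Qed.

Lemma runs_seq_assoc B c1 c2 c3 s T R :
  runs B (Seq c1 (Seq c2 c3)) s T R -> runs B (Seq (Seq c1 c2) c3) s T R.
Proof.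
  intros (t & s' & E & ? & ?). inversion E; subst.
  match goal with H : exec _ (Seq c2 c3) _ _ _ |- _ => inversion H; subst end.
  eexists _, s'. split; [econstructor; [econstructor; eauto | eauto] | split; auto; lia].
Qed.

(* [I n s]: the loop can be completed from [s] within [n] more iterations (its own
   and those of nested loops), so [n] is both the variant and the time credit. *)
Lemma runs_while B e c (I : nat -> st -> Prop) s0 T (R : st -> Prop) :
  I T s0 ->
  (forall n s, frame (While e c) s0 s -> I n s ->
     ok B e s /\ (eval e s = 0 -> R s) /\
     (eval e s <> 0 -> exists T',
        runs B c s T' (fun s' => exists n', S (n' + T') <= n /\ I n' s'))) ->
  runs B (While e c) s0 T R.
Proof.
  intros H0 H.
  assert (G : forall n s, frame (While e c) s0 s -> I n s -> runs B (While e c) s n R).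
  { induction n as [n IH] using lt_wf_ind. intros s F HI.
    destruct (H n s F HI) as (Hok & HZ & HN).
    destruct (Nat.eq_dec (eval e s) 0) as [Hz | Hz].
    - exists 0, s. repeat split; auto; try lia. now apply EWhF.
    - destruct (HN Hz) as (T' & t & s1 & E & Ht & n' & Hn & HI').
      destruct (IH n' ltac:(lia) s1) as (t2 & s2 & E2 & Ht2 & HR); auto.
      + eapply frame_trans; [exact F |]. apply exec_frame in E. exact E.
      + exists (S (t + t2)), s2. repeat split; auto; try lia. eapply EWhT; eauto. }
  apply G; auto using frame_refl.
Qed.

(** [T1] bounds the nested iterations of one round. The invariant is required at the state with the
    counter already advanced, since the increment is a separate command after the body [c]. *)
Lemma runs_for B x eb c (I : nat -> st -> Prop) s0 lo hi T1 T (R : st -> Prop) :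
  let W := While (Bin ALt (Var x) eb) (Seq c (Asg x (Bin AAdd (Var x) (Cst 1)))) in
  rg s0 x = lo -> lo <= hi -> hi < B -> (hi - lo) * S T1 <= T -> I lo s0 ->
  (forall s, frame W s0 s -> ok B eb s /\ eval eb s = hi) ->
  (forall k s, lo <= k < hi -> frame W s0 s -> rg s x = k -> I k s ->
     runs B c s T1 (fun s' => rg s' x = k /\ I (S k) (setr s' x (S k)))) ->
  (forall s, frame W s0 s -> rg s x = hi -> I hi s -> R s) ->
  runs B W s0 T R.
Proof.
  intros W Hx Hle HB HT HI Heb Hstep HR.
  eapply runs_weaken with (T := (hi - lo) * S T1); [| exact HT | intros s' _ K; exact K].
  apply runs_while with (I := fun n s => lo <= rg s x <= hi /\ n = (hi - rg s x) * S T1 /\ I (rg s x) s).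
  { rewrite Hx. auto with arith. }
  intros n s F (Hb & Hn & HIs). fold W in F.
  destruct (Heb s F) as [Hok Hev].
  cbn [ok eval arith]. rewrite Hev.
  destruct (Nat.ltb_spec (rg s x) hi) as [Hlt | Hge].
  - repeat split; auto; try lia. intros _. exists T1.
    apply runs_seq with (T1 := T1) (T2 := 0); [lia |].
    eapply runs_weaken; [apply (Hstep (rg s x) s); auto; lia | lia |].
    intros s' _ (Hx' & HI') _. apply runs_asg.
    { cbn [ok eval arith]. repeat split; auto. lia. }
    cbn [eval arith]. rewrite Hx', Nat.add_1_r.
    exists ((hi - S (rg s x)) * S T1). cbn [rg setr]. rewrite Nat.eqb_refl.
    repeat split; auto; try lia.
    rewrite Hn. replace (hi - rg s x) with (S (hi - S (rg s x))) by lia. lia.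
  - repeat split; auto; try lia. intros _. apply HR; auto; try lia.
    replace hi with (rg s x) by lia. auto.
Qed.

Declare Scope prog_scope.
Delimit Scope prog_scope with prog.
Notation "# v" := (Cst v) (at level 2, format "# v") : prog_scope.
Notation "! x" := (Var x) (at level 2, format "! x") : prog_scope.
Notation "k @[ e ]" := (Ld k e) (at level 3, e at level 99) : prog_scope.
Notation "a + b" := (Bin AAdd a b) : prog_scope.
Notation "a - b" := (Bin ASub a b) : prog_scope.
Notation "a * b" := (Bin AMul a b) : prog_scope.
Notation "a / b" := (Bin ADiv a b) : prog_scope.
Notation "a 'mod' b" := (Bin AMod a b) : prog_scope.
Notation "a < b" := (Bin ALt a b) : prog_scope.
Notation "a == b" := (Bin AEq a b) (at level 70) : prog_scope.
Notation "x ::= e" := (Asg x e) (at level 75) : prog_scope.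
Notation "k @@[ a ] ::= e" := (Sto k a e) (at level 75, a at level 99) : prog_scope.
Notation "c ;; d" := (Seq c d) (at level 80, right associativity) : prog_scope.
Notation "'IF' e 'THEN' c 'ELSE' d 'FI'" := (If e c d) (at level 75, c at level 80, d at level 80) : prog_scope.
Notation "'IF' e 'THEN' c 'FI'" := (If e c Skip) (at level 75, c at level 80) : prog_scope.
Notation "'WHILE' e 'DO' c 'OD'" := (While e c) (at level 75, c at level 80) : prog_scope.
Notation "'FOR' x 'UPTO' e 'DO' c 'OD'" :=
  (While (Bin ALt (Var x) e) (Seq c (Asg x (Bin AAdd (Var x) (Cst 1)))))
  (at level 75, e at level 69, c at level 80) : prog_scope.

Ltac sx := cbn [eval arith rg ar setr seta Nat.eqb].
Ltac okx := cbn [ok eval arith rg ar setr seta Nat.eqb]; unfold cell.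

Ltac carry F :=
  match type of F with
  | frame ?c ?s0 ?s =>
      repeat match goal with
      | H : rg s0 ?x = ?v |- _ =>
          lazymatch goal with
          | _ : rg s x = _ |- _ => fail
          | _ => let K := fresh "K" in
              assert (K : rg s x = v) by (rewrite (proj1 F x (eq_refl false)); exact H)
          end
      end
  end.

Ltac subregs := repeat match goal with H : rg ?s ?x = _ |- context [rg ?s ?x] => rewrite H end.

(** * Moving the input out of the registers *)

Definition save_code (j : nat) : list instr := [IOp OAdd 0 0 1; IStore 0 j].

Definition restore_code (j : nat) : list instr :=
  [IConst 2 (64 + 16 * j); ILoad 3 0; IStore 2 3; IConst 3 1; IOp OSub 0 0 3].

(** Jump targets are absolute: this code occupies addresses 25 to 37 of [prelude]. Cells move from
    the top index down, because the target [64 + 16 * i] of cell [i] is a larger index, whose old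
    content has already been moved. *)
Definition move_code : list instr :=
  [IConst 3 7; IOp OLt 3 2 3; IJz 3 29; IJmp 38;
   IConst 3 16; IOp OMul 3 2 3; IConst 4 64; IOp OAdd 3 3 4; ILoad 4 2; IStore 3 4;
   IConst 3 1; IOp OSub 2 2 3; IJmp 25].

(* The input occupies cells 0..3n, so no register is free at the start: cells 1..6 are
   first parked at 256n, ..., 256n+5, beyond everything used until they are restored. *)
Definition prelude (stop : nat) : list instr :=
  [IJz 0 stop] ++ repeat (IOp OAdd 0 0 0) 8 ++ [IStore 0 1; IConst 1 1] ++
  flat_map save_code (seq 2 5) ++
  [IConst 2 256; IOp ODiv 1 0 2; IConst 2 3; IOp OMul 2 1 2] ++
  move_code ++ flat_map restore_code (rev (seq 1 6)).

Section Prelude.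

Variables (P : program) (w : nat) (n : nat) (m0 : memory) (stop : nat).
Let B := 2 ^ w.
Hypothesis big : 1000 * n + 1000 <= B.
Hypothesis npos : 1 <= n.
Hypothesis m0n : m0 0 = n.
Hypothesis bnd : bounded B m0.
Hypothesis code : exists Q, P = prelude stop ++ Q.

Lemma nth_prelude k i : nth_error (prelude stop) k = Some i -> nth_error P k = Some i.
Proof.
  destruct code as [Q ->]. intros H. rewrite nth_error_app1; auto.
  apply nth_error_Some. congruence.
Qed.

Lemma eval_add x y : x + y < B -> eval_op w OAdd x y = x + y.
Proof. intros. unfold eval_op. now apply Nat.mod_small. Qed.

(** Cell 0 holds n, the only value known at the start, and adding it to itself needs no second
    register. *)
Lemma doubling k pc (m : memory) :
  (forall i, i < k -> nth_error P (pc + i) = Some (IOp OAdd 0 0 0)) ->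
  2 ^ k * m 0 < B -> bounded B m ->
  exists m', run P w k (pc, m) = (pc + k, m') /\ m' 0 = 2 ^ k * m 0 /\
    (forall a, 0 < a -> m' a = m a) /\ bounded B m'.
Proof.
  revert pc m. induction k; intros pc m HC Hk Hb.
  - exists m. cbn [Nat.pow run]. rewrite Nat.add_0_r, Nat.mul_1_l. auto.
  - assert (Hp : 1 <= 2 ^ k) by (pose proof (Nat.pow_nonzero 2 k); lia).
    cbn [Nat.pow] in *.
    set (m1 := upd m 0 (m 0 + m 0)).
    assert (E : step P w (pc, m) = (pc + 1, m1)).
    { rewrite (step_op _ _ pc m OAdd 0 0 0).
      - rewrite eval_add; auto. nia.
      - rewrite <- (HC 0 ltac:(lia)). f_equal. lia. }
    destruct (IHk (pc + 1) m1) as (m' & R & V & L & Bd).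
    + intros i Hi. rewrite <- (HC (S i) ltac:(lia)). f_equal. lia.
    + unfold m1. rewrite upd_same. nia.
    + apply bounded_upd; auto. nia.
    + exists m'. repeat split; auto.
      * rewrite run_S, E, R. f_equal. lia.
      * rewrite V. unfold m1. rewrite upd_same. lia.
      * intros a Ha. rewrite L; auto. unfold m1. apply upd_other. lia.
Qed.

(** Cell 0 is the pointer; cell 1, parked beforehand, holds the constant 1 that advances it. *)
Lemma saving k : forall j pc (m : memory) A,
  (forall i, i < 2 * k -> nth_error P (pc + i) = nth_error (flat_map save_code (seq j k)) i) ->
  m 0 = A -> m 1 = 1 -> bounded B m -> 1 < j -> j + k <= A -> A + k < B ->
  exists m', run P w (2 * k) (pc, m) = (pc + 2 * k, m') /\ m' 0 = A + k /\
    (forall i, i < k -> m' (A + S i) = m (j + i)) /\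
    (forall a, 0 < a <= A -> m' a = m a) /\ bounded B m'.
Proof.
  induction k; intros j pc m A HC H0 H1 Hb Hj HA HB.
  - exists m. rewrite !Nat.add_0_r. repeat split; auto. intros; lia.
  - set (m1 := upd m 0 (A + 1)). set (m2 := upd m1 (A + 1) (m j)).
    assert (E1 : step P w (pc, m) = (pc + 1, m1)).
    { rewrite (step_op _ _ pc m OAdd 0 0 1).
      - rewrite H0, H1, eval_add; auto. lia.
      - rewrite <- (Nat.add_0_r pc), HC by lia. reflexivity. }
    assert (E2 : step P w (pc + 1, m1) = (pc + 1 + 1, m2)).
    { rewrite (step_store _ _ (pc + 1) m1 0 j).
      - unfold m2, m1. rewrite upd_same, upd_other by lia. reflexivity.
      - rewrite HC by lia. reflexivity. }
    destruct (IHk (S j) (pc + 1 + 1) m2 (A + 1)) as (m' & R & V & S1 & L & Bd); try lia.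
    + intros i Hi. replace (pc + 1 + 1 + i) with (pc + (2 + i)) by lia.
      rewrite HC by lia. reflexivity.
    + unfold m2, m1. rewrite upd_other, upd_same; lia.
    + unfold m2, m1. rewrite !upd_other; lia.
    + unfold m2, m1. repeat apply bounded_upd; auto; lia.
    + exists m'. repeat split; auto; try lia.
      * replace (2 * S k) with (S (S (2 * k))) by lia.
        rewrite !run_S, E1, E2, R. f_equal. lia.
      * intros [| i] Hi.
        -- rewrite L by lia. unfold m2. rewrite upd_same. f_equal. lia.
        -- replace (A + S (S i)) with (A + 1 + S i) by lia. rewrite S1 by lia.
           unfold m2, m1. rewrite !upd_other by lia. f_equal. lia.
      * intros a Ha. rewrite L by lia. unfold m2, m1. rewrite !upd_other; lia.
Qed.

Lemma moving i : forall m : memory,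
  m 2 = i -> i <= 3 * n -> bounded B m ->
  exists k m', k <= 13 * S i /\ run P w k (25, m) = (38, m') /\
    m' 0 = m 0 /\ m' 1 = m 1 /\
    (forall j, 7 <= j <= i -> m' (64 + 16 * j) = m j) /\
    (forall a, 64 + 16 * i < a -> m' a = m a) /\ bounded B m'.
Proof.
  induction i as [i IH] using lt_wf_ind; intros m H2 Hi Hb.
  set (m1 := upd m 3 7).
  set (m2 := upd m1 3 (if i <? 7 then 1 else 0)).
  assert (E1 : step P w (25, m) = (26, m1)).
  { apply (step_const P w 25 m 3 7); [now apply nth_prelude | fold B; lia]. }
  assert (E2 : step P w (26, m1) = (27, m2)).
  { rewrite (step_op P w 26 m1 OLt 3 2 3) by (now apply nth_prelude).
    unfold m2, m1. rewrite upd_same, upd_other by lia. rewrite H2. unfold eval_op.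
    rewrite Nat.mod_small; [reflexivity |]. fold B. destruct (i <? 7); lia. }
  assert (B2 : bounded B m2)
    by (unfold m2, m1; repeat apply bounded_upd; auto; try (destruct (i <? 7)); lia).
  assert (E3 : step P w (27, m2) = if i <? 7 then (28, m2) else (29, m2)).
  { rewrite (step_jz P w 27 m2 3 29) by (now apply nth_prelude).
    unfold m2 at 1. rewrite upd_same. destruct (i <? 7); reflexivity. }
  destruct (Nat.ltb_spec i 7) as [Hs | Hs].
  - exists 4, m2. repeat split; auto; try lia.
    + rewrite !run_S, E1, E2, E3.
      now rewrite (step_jmp P w 28 m2 38) by (now apply nth_prelude).
    + intros a Ha. unfold m2, m1. rewrite !upd_other; lia.
  - set (m3 := upd m2 3 16). set (m4 := upd m3 3 (i * 16)). set (m5 := upd m4 4 64).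
    set (m6 := upd m5 3 (i * 16 + 64)). set (m7 := upd m6 4 (m i)).
    set (m8 := upd m7 (i * 16 + 64) (m i)). set (m9 := upd m8 3 1). set (m10 := upd m9 2 (i - 1)).
    assert (E4 : step P w (29, m2) = (30, m3)).
    { apply (step_const P w 29 m2 3 16); [now apply nth_prelude | fold B; lia]. }
    assert (E5 : step P w (30, m3) = (31, m4)).
    { rewrite (step_op P w 30 m3 OMul 3 2 3) by (now apply nth_prelude).
      unfold m3 at 2 3. rewrite upd_same, upd_other by lia.
      unfold m2, m1. rewrite !upd_other, H2 by lia.
      unfold eval_op. rewrite Nat.mod_small; [reflexivity |]. fold B. lia. }
    assert (E6 : step P w (31, m4) = (32, m5)).
    { apply (step_const P w 31 m4 4 64); [now apply nth_prelude | fold B; lia]. }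
    assert (E7 : step P w (32, m5) = (33, m6)).
    { rewrite (step_op P w 32 m5 OAdd 3 3 4) by (now apply nth_prelude).
      unfold m5 at 2 3. rewrite upd_same, upd_other by lia. unfold m4. rewrite upd_same.
      rewrite eval_add; [reflexivity |]. lia. }
    assert (E8 : step P w (33, m6) = (34, m7)).
    { rewrite (step_load P w 33 m6 4 2) by (now apply nth_prelude).
      unfold m7. do 2 f_equal.
      unfold m6, m5, m4, m3, m2, m1. rewrite !(upd_other _ _ _ 2) by lia. rewrite H2.
      rewrite !upd_other; lia. }
    assert (E9 : step P w (34, m7) = (35, m8)).
    { rewrite (step_store P w 34 m7 3 4) by (now apply nth_prelude).
      unfold m7 at 2 3. rewrite upd_same, upd_other by lia. unfold m6. now rewrite upd_same. }
    assert (E10 : step P w (35, m8) = (36, m9)).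
    { apply (step_const P w 35 m8 3 1); [now apply nth_prelude | fold B; lia]. }
    assert (E11 : step P w (36, m9) = (37, m10)).
    { rewrite (step_op P w 36 m9 OSub 2 2 3) by (now apply nth_prelude).
      unfold m9 at 2 3. rewrite upd_same, upd_other by lia.
      unfold m8, m7, m6, m5, m4, m3, m2, m1. rewrite !upd_other by lia. rewrite H2.
      unfold eval_op. rewrite Nat.mod_small; [reflexivity |]. fold B. lia. }
    assert (L : forall a, a = 0 \/ a = 1 \/ 5 <= a /\ a <> i * 16 + 64 -> m10 a = m a).
    { intros a Ha. unfold m10, m9, m8, m7, m6, m5, m4, m3, m2, m1. rewrite !upd_other; lia. }
    assert (L2 : m10 (i * 16 + 64) = m i).
    { unfold m10, m9, m8. rewrite !(upd_other _ 2), !(upd_other _ 3), upd_same by lia. auto. }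
    destruct (IH (i - 1) ltac:(lia) m10) as (k & m' & Hk & R & V0 & V1 & Hj & Ha & Bd); try lia.
    + unfold m10. now rewrite upd_same.
    + unfold m10, m9, m8, m7, m6, m5, m4, m3. repeat apply bounded_upd; auto; try apply Hb; lia.
    + exists (12 + k), m'. repeat split; auto; try lia.
      * rewrite run_add. cbn [plus].
        rewrite !run_S, E1, E2, E3, E4, E5, E6, E7, E8, E9, E10, E11.
        rewrite (step_jmp P w 37 m10 25) by (now apply nth_prelude). exact R.
      * rewrite V0. apply L. lia.
      * rewrite V1. apply L. lia.
      * intros j Hj'. destruct (Nat.eq_dec j i) as [-> | Hne].
        -- rewrite Ha by lia. rewrite <- L2. f_equal. lia.
        -- rewrite Hj by lia. apply L. lia.
      * intros a Ha'. rewrite Ha by lia. apply L. lia.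
Qed.

Lemma restoring k : forall pc (m : memory) A,
  (forall i, i < 5 * k -> nth_error P (pc + i) = nth_error (flat_map restore_code (rev (seq 1 k))) i) ->
  m 0 = A + k -> bounded B m -> 64 + 16 * k <= A -> A + k < B ->
  exists m', run P w (5 * k) (pc, m) = (pc + 5 * k, m') /\ m' 1 = m 1 /\
    (forall i, 1 <= i <= k -> m' (64 + 16 * i) = m (A + i)) /\
    (forall a, 64 + 16 * k < a -> m' a = m a) /\ bounded B m'.
Proof.
  induction k; intros pc m A HC H0 Hb HA HB.
  - exists m. rewrite !Nat.add_0_r. repeat split; auto. intros; lia.
  - rewrite seq_S, rev_app_distr in HC. cbn [rev app flat_map] in HC.
    set (v := m (A + S k)). set (b := 64 + 16 * S k).
    set (m1 := upd m 2 b). set (m2 := upd m1 3 v). set (m3 := upd m2 b v).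
    set (m4 := upd m3 3 1). set (m5 := upd m4 0 (A + k)).
    assert (C : forall i, i < 5 -> nth_error P (pc + i) = nth_error (restore_code (S k)) i).
    { intros i Hi. rewrite HC by lia. rewrite nth_error_app1; auto. }
    assert (E1 : step P w (pc, m) = (pc + 1, m1)).
    { apply step_const; [| fold B; unfold b; lia].
      rewrite <- (Nat.add_0_r pc), C by lia. reflexivity. }
    assert (E2 : step P w (pc + 1, m1) = (pc + 2, m2)).
    { rewrite (step_load P w (pc + 1) m1 3 0) by (rewrite C by lia; reflexivity).
      replace (pc + 1 + 1) with (pc + 2) by lia. unfold m2, v. do 2 f_equal.
      unfold m1. rewrite (upd_other _ _ _ 0), H0, upd_other by lia. reflexivity. }
    assert (E3 : step P w (pc + 2, m2) = (pc + 3, m3)).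
    { rewrite (step_store P w (pc + 2) m2 2 3) by (rewrite C by lia; reflexivity).
      replace (pc + 2 + 1) with (pc + 3) by lia. unfold m2 at 2 3. rewrite upd_same, upd_other by lia.
      unfold m1. rewrite upd_same. reflexivity. }
    assert (E4 : step P w (pc + 3, m3) = (pc + 4, m4)).
    { replace (pc + 4) with (pc + 3 + 1) by lia.
      apply step_const; [| fold B; lia]. rewrite C by lia. reflexivity. }
    assert (E5 : step P w (pc + 4, m4) = (pc + 5, m5)).
    { rewrite (step_op P w (pc + 4) m4 OSub 0 0 3) by (rewrite C by lia; reflexivity).
      replace (pc + 4 + 1) with (pc + 5) by lia. unfold m4 at 2 3. rewrite upd_same, upd_other by lia.
      unfold m3, m2, m1. rewrite !upd_other, H0 by lia.
      unfold eval_op. rewrite Nat.mod_small; [| fold B; lia]. unfold m5. do 2 f_equal. lia. }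
    assert (L : forall a, 5 <= a -> a <> b -> m5 a = m a).
    { intros a Ha Hb'. unfold m5, m4, m3, m2, m1. rewrite !upd_other; lia. }
    assert (Hbb : 64 <= b) by (unfold b; lia).
    destruct (IHk (pc + 5) m5 A) as (m' & R & V1 & Hi & Ha & Bd); try lia.
    + intros i Hi. replace (pc + 5 + i) with (pc + (5 + i)) by lia. rewrite HC by lia.
      rewrite nth_error_app2 by (cbn; lia). f_equal. cbn. lia.
    + unfold m5. now rewrite upd_same.
    + unfold m5, m4, m3, m2, m1, v, b. repeat apply bounded_upd; auto; try apply Hb; lia.
    + exists m'. repeat split; auto.
      * replace (5 * S k) with (5 + 5 * k) by lia. rewrite run_add.
        rewrite !run_S, E1, E2, E3, E4, E5. cbn [run]. rewrite R. f_equal. lia.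
      * intros i Hi'. destruct (Nat.eq_dec i (S k)) as [-> | Hne].
        -- rewrite Ha by lia. unfold m5, m4, m3.
           rewrite !(upd_other _ 0), (upd_other _ 3), upd_same by lia. reflexivity.
        -- rewrite Hi by lia. apply L; unfold b; lia.
      * intros a Ha'. rewrite Ha by lia. apply L; unfold b; lia.
Qed.

Lemma prelude_correct :
  exists k m, k <= 39 * n + 100 /\ run P w k (0, m0) = (length (prelude stop), m) /\
    m 1 = n /\ (forall j, 1 <= j <= 3 * n -> m (cell 0 j) = m0 j) /\ bounded B m.
Proof.
  assert (E0 : step P w (0, m0) = (1, m0)).
  { rewrite (step_jz P w 0 m0 0 stop) by (now apply nth_prelude). rewrite m0n.
    destruct (Nat.eqb_spec n 0); [lia | reflexivity]. }
  destruct (doubling 8 1 m0) as (m1 & R1 & V1 & L1 & B1); auto.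
  { intros i Hi. apply nth_prelude. do 8 (destruct i; [reflexivity |]). lia. }
  { rewrite m0n. cbn. lia. }
  rewrite m0n in V1. change (2 ^ 8) with 256 in V1.
  set (m2 := upd m1 (256 * n) (m0 1)). set (m3 := upd m2 1 1).
  assert (E2 : step P w (9, m1) = (10, m2)).
  { rewrite (step_store P w 9 m1 0 1) by (now apply nth_prelude). rewrite V1, L1 by lia. reflexivity. }
  assert (E3 : step P w (10, m2) = (11, m3)).
  { apply (step_const P w 10 m2 1 1); [now apply nth_prelude | fold B; lia]. }
  assert (B3 : bounded B m3) by (unfold m3, m2; repeat apply bounded_upd; auto; lia).
  destruct (saving 5 2 11 m3 (256 * n)) as (m4 & R4 & V4 & S4 & L4 & B4); auto; try lia.
  { intros i Hi. do 10 (destruct i; [now apply nth_prelude |]). lia. }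
  { unfold m3, m2. now rewrite !upd_other by lia. }
  set (m5 := upd m4 2 256). set (m6 := upd m5 1 n). set (m7 := upd m6 2 3).
  set (m8 := upd m7 2 (n * 3)).
  assert (E5 : step P w (21, m4) = (22, m5)).
  { apply (step_const P w 21 m4 2 256); [now apply nth_prelude | fold B; lia]. }
  assert (E6 : step P w (22, m5) = (23, m6)).
  { rewrite (step_op P w 22 m5 ODiv 1 0 2) by (now apply nth_prelude).
    unfold m5 at 2 3. rewrite upd_same, upd_other, V4 by lia. unfold eval_op.
    (* After five increments cell 0 holds [256 * n + 5], and the division recovers n. *)
    replace ((256 * n + 5) / 256) with n.
    - rewrite Nat.mod_small; [reflexivity |]. fold B. lia.
    - apply Nat.div_unique with (r := 5); lia. }
  assert (E7 : step P w (23, m6) = (24, m7)).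
  { apply (step_const P w 23 m6 2 3); [now apply nth_prelude | fold B; lia]. }
  assert (E8 : step P w (24, m7) = (25, m8)).
  { rewrite (step_op P w 24 m7 OMul 2 1 2) by (now apply nth_prelude).
    unfold m7 at 2 3. rewrite upd_same, upd_other by lia. unfold m6. rewrite upd_same.
    unfold eval_op. rewrite Nat.mod_small; [reflexivity |]. fold B. lia. }
  assert (B8 : bounded B m8) by (unfold m8, m7, m6, m5; repeat apply bounded_upd; auto; lia).
  destruct (moving (3 * n) m8) as (k9 & m9 & K9 & R9 & V9 & W9 & S9 & L9 & B9); auto.
  { unfold m8. rewrite upd_same. lia. }
  assert (M8 : forall a, 2 < a -> m8 a = m4 a).
  { intros a Ha. unfold m8, m7, m6, m5. rewrite !upd_other; lia. }
  (* Cell [j] was parked at [256 * n - 1 + j], and the pointer stands at the last parked cell, that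
     of [j = 6]. *)
  destruct (restoring 6 38 m9 (256 * n - 1)) as (m10 & R10 & W10 & S10 & L10 & B10); auto; try lia.
  { intros i Hi. do 30 (destruct i; [now apply nth_prelude |]). lia. }
  { rewrite V9. unfold m8, m7, m6, m5. rewrite !upd_other, V4 by lia. lia. }
  exists (1 + (8 + (2 + (2 * 5 + (4 + (k9 + 5 * 6)))))), m10.
  split; [lia |]. split; [| split; [| split]]; auto.
  - change (1 + 8) with 9 in R1. change (11 + 2 * 5) with 21 in R4.
    eapply run_chain; [exact E0 |]. eapply run_chain; [exact R1 |].
    eapply run_chain; [rewrite !run_S, E2, E3; reflexivity |].
    eapply run_chain; [exact R4 |].
    eapply run_chain; [rewrite !run_S, E5, E6, E7, E8; reflexivity |].
    eapply run_chain; [exact R9 | exact R10].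
  - rewrite W10, W9. unfold m8, m7, m6. rewrite !(upd_other _ 2) by lia. apply upd_same.
  - intros j Hj. unfold cell. rewrite Nat.add_0_r.
    destruct (le_lt_dec j 6) as [H6 | H6].
    + rewrite S10 by lia. rewrite L9 by lia. rewrite M8 by lia.
      destruct (Nat.eq_dec j 1) as [-> | Hj1].
      * replace (256 * n - 1 + 1) with (256 * n) by lia. rewrite L4 by lia.
        unfold m3, m2. rewrite (upd_other _ 1), upd_same by lia. reflexivity.
      * replace (256 * n - 1 + j) with (256 * n + S (j - 2)) by lia. rewrite S4 by lia.
        replace (2 + (j - 2)) with j by lia. unfold m3, m2. rewrite !upd_other, L1; lia.
    + rewrite L10 by lia. rewrite S9 by lia. rewrite M8, L4 by lia.
      unfold m3, m2. rewrite !upd_other, L1; lia.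
Qed.

End Prelude.

(** * From a timed command to a word-RAM program *)

Definition logN (J : list job) : nat := Nat.log2 (inputN J) + 1.

Lemma list_max_ge l x : In x l -> x <= list_max l.
Proof.
  intros H. pose proof (proj1 (list_max_le l (list_max l)) (le_n _)) as F.
  rewrite Forall_forall in F. auto.
Qed.

Lemma job_bounds J j :
  proc (nth j J (Job 0 0 0)) <= pmax J /\ weight (nth j J (Job 0 0 0)) <= wmax J /\
  due (nth j J (Job 0 0 0)) <= dmax J.
Proof.
  destruct (le_lt_dec (length J) j) as [H | H].
  - rewrite nth_overflow by auto. simpl. lia.
  - assert (I : In (nth j J (Job 0 0 0)) J) by now apply nth_In.
    unfold pmax, wmax, dmax. repeat split; apply list_max_ge; now apply in_map.
Qed.

Lemma encode_bound J a : encode J a < inputN J.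
Proof.
  unfold inputN, n_of. destruct a as [| a]; cbn [encode]; [lia |].
  destruct (a / 3 <? length J); [| lia].
  destruct (job_bounds J (a / 3)) as (? & ? & ?).
  destruct (a mod 3) as [| [| ?]]; lia.
Qed.

Lemma encode_fields J j : j < length J ->
  encode J (3 * j + 1) = proc (nth j J (Job 0 0 0)) /\
  encode J (3 * j + 2) = weight (nth j J (Job 0 0 0)) /\
  encode J (3 * j + 3) = due (nth j J (Job 0 0 0)).
Proof.
  intros Hj.
  assert (E : forall r, r < 3 -> (3 * j + r) / 3 = j /\ (3 * j + r) mod 3 = r).
  { intros r Hr. split; symmetry.
    - apply (Nat.div_unique _ _ _ r); lia.
    - apply (Nat.mod_unique _ _ j); lia. }
  replace (3 * j + 1) with (S (3 * j + 0)) by lia.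
  replace (3 * j + 2) with (S (3 * j + 1)) by lia.
  replace (3 * j + 3) with (S (3 * j + 2)) by lia.
  unfold encode.
  destruct (E 0 ltac:(lia)) as [-> ->], (E 1 ltac:(lia)) as [-> ->], (E 2 ltac:(lia)) as [-> ->].
  apply Nat.ltb_lt in Hj. rewrite Hj. auto.
Qed.

Lemma word_size_bound J : inputN J ^ 16 <= 2 ^ (16 * logN J).
Proof.
  rewrite Nat.mul_comm, Nat.pow_mul_r. apply Nat.pow_le_mono_l.
  unfold logN. rewrite Nat.add_1_r. apply Nat.lt_le_incl, Nat.log2_spec. unfold inputN. lia.
Qed.

Lemma inputN_pow N : 2 <= N -> 2 ^ 10 * N <= N ^ 16.
Proof.
  intros H. change 16 with (15 + 1). rewrite Nat.pow_add_r, Nat.pow_1_r.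
  apply Nat.mul_le_mono_r. transitivity (2 ^ 15); [| now apply Nat.pow_le_mono_l].
  apply Nat.pow_le_mono_r; lia.
Qed.

Lemma opt_nil : is_opt_value [] 0.
Proof.
  split; [exists []; split; [constructor | reflexivity] | intros; lia].
Qed.

(** Words of [16 * L] bits represent every number below [inputN J ^ 16], enough for all keys, table
    entries and addresses. The hypothesis [length J <= f J] pays for the prelude, which is linear in
    the number of jobs. *)
Lemma solvable_of_cmd c f C k :
  wf_c c = true ->
  (forall J, J <> [] -> length J <= f J) ->
  (forall J B s, J <> [] -> inputN J ^ 16 <= B -> rg s 1 = length J ->
     (forall j, 1 <= j <= 3 * length J -> ar s 0 j = encode J j) ->
     runs B c s (C * (f J + 1) * logN J ^ k) (fun s' => is_opt_value J (rg s' 0))) ->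
  solvable_in f.
Proof.
  intros Hwf Hf H.
  (* The length of [prelude] is independent of its argument, so the address just past the program
     can be computed before that argument is fixed. The program halts by running off its end. *)
  set (off := length (prelude 0)).
  set (code := comp_c c off).
  set (P := prelude (off + length code) ++ code).
  exists P, 16, (200 + 2 * length code * (C + 1)), k. split; [lia |]. intros J. cbv zeta.
  fold (logN J). set (L := logN J).
  assert (HL : 1 <= L ^ k).
  { pose proof (Nat.pow_nonzero L k). unfold L, logN in *. lia. }
  assert (HP : length P = off + length code) by (unfold P; now rewrite length_app).
  (* Without jobs the first instruction jumps past the code, and cell 0 already holds the answer
     0. *)
  destruct J as [| j0 J'].
  { exists 0. split; [apply opt_nil |].
    exists 1. split; [| split].
    - enough (1 <= 200 * 1 * 1); nia.
    - cbn. unfold halted. cbn [fst snd].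
      rewrite (proj2 (nth_error_None P _)); auto.
    - reflexivity. }
  set (J := j0 :: J') in *. assert (HJ : J <> []) by discriminate.
  assert (HN : 2 <= inputN J) by (unfold inputN; lia).
  pose proof (word_size_bound J) as HB. fold L in HB. pose proof (inputN_pow _ HN) as HB2.
  assert (E10 : 2 ^ 10 = 1024) by reflexivity. rewrite E10 in HB2. clear E10.
  set (B := 2 ^ (16 * L)) in *.
  assert (Hn : length J < inputN J) by (unfold inputN, n_of; lia).
  destruct (prelude_correct P (16 * L) (length J) (encode J) (off + length code))
    as (k1 & m & K1 & R1 & M1 & MI & Bd).
  { fold B. nia. }
  { unfold J. cbn. lia. }
  { reflexivity. }
  { intros a. fold B. pose proof (encode_bound J a). nia. }
  { exists code. reflexivity. }
  set (s := St m (fun k i => m (cell k i))).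
  destruct (H J B s HJ) as (t & s' & E & Ht & HR); auto.
  destruct (comp_c_correct P (16 * L)) with (c := c) (s := s) (t := t) (s' := s') (pc := off) (m := m)
    as (k2 & m2 & R2 & S2 & _ & K2); auto.
  { fold B. nia. }
  { exists (prelude (off + length code)), []. rewrite app_nil_r. auto. }
  { split; reflexivity. }
  exists (rg s' 0). split; auto.
  exists (k1 + k2).
  assert (R : run P (16 * L) (k1 + k2) (0, encode J) = (off + length code, m2)).
  { eapply run_chain; [exact R1 | exact R2]. }
  rewrite R. split; [| split].
  - fold code in K2. specialize (Hf J HJ). fold L in Ht.
    set (F := f J + 1) in *. assert (1 <= F) by (unfold F; lia).
    assert (HFL : F <= F * L ^ k) by nia.
    assert (H1 : k1 <= 200 * (F * L ^ k)) by lia.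
    assert (H2 : S t <= (C + 1) * (F * L ^ k)) by nia.
    assert (H3 : k2 <= 2 * length code * ((C + 1) * (F * L ^ k))) by nia.
    nia.
  - unfold halted. cbn [fst]. rewrite (proj2 (nth_error_None P _)); auto.
  - cbn [snd]. apply S2. lia.
Qed.

(** * Proximity of integral and fractional optima *)

Fixpoint sumf (f : nat -> nat) (n : nat) : nat :=
  match n with 0 => 0 | S k => sumf f k + f k end.

Definition tot (f : nat -> nat) (X : nat -> bool) (n : nat) : nat :=
  sumf (fun j => if X j then f j else 0) n.

Definition seg (X : nat -> bool) (a b : nat) : nat -> bool :=
  fun j => (a <=? j) && (j <? b) && X j.

Lemma tot_S f X n : tot f X (S n) = tot f X n + (if X n then f n else 0).
Proof. reflexivity. Qed.

Lemma sumf_ext f g n : (forall j, j < n -> f j = g j) -> sumf f n = sumf g n.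
Proof. induction n; simpl; intros H; auto. rewrite IHn, H; auto. Qed.

Lemma sumf_mono f a b : a <= b -> sumf f a <= sumf f b.
Proof. induction 1; simpl; lia. Qed.

Lemma tot_mono f X a b : a <= b -> tot f X a <= tot f X b.
Proof. apply sumf_mono. Qed.

Lemma tot_ext f X Y n : (forall j, j < n -> X j = Y j) -> tot f X n = tot f Y n.
Proof. intros H. apply sumf_ext. intros j Hj. now rewrite H. Qed.

Lemma sumf_range f g a b : a <= b -> (forall j, a <= j < b -> f j <= g j) ->
  sumf f b + sumf g a <= sumf g b + sumf f a.
Proof.
  induction 1; intros H'; [lia |]. simpl. specialize (H' m ltac:(lia)) as H1.
  enough (sumf f m + sumf g a <= sumf g m + sumf f a) by lia. apply IHle. intros. apply H'. lia.
Qed.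

Lemma sumf_add f g n : sumf (fun j => f j + g j) n = sumf f n + sumf g n.
Proof. induction n; simpl; lia. Qed.

Lemma tot_le_all f X n : tot f X n <= sumf f n.
Proof. unfold tot. induction n; simpl; auto. destruct (X n); lia. Qed.

Lemma tot_seg f X a b e : a <= b ->
  tot f (seg X a b) e + tot f X (min e a) = tot f X (min e b).
Proof.
  intros Hab. induction e; [reflexivity |]. rewrite tot_S. unfold seg at 2.
  destruct (Nat.leb_spec a e) as [H1 | H1]; cbn [andb].
  - replace (min (S e) a) with (min e a) by lia.
    destruct (Nat.ltb_spec e b) as [H2 | H2]; cbn [andb].
    + replace (min (S e) b) with (S e) by lia. replace (min e b) with e in IHe by lia.
      rewrite tot_S. lia.
    + replace (min (S e) b) with (min e b) by lia. lia.
  - replace (min (S e) a) with (S e) by lia. replace (min (S e) b) with (S e) by lia.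
    replace (min e a) with e in IHe by lia. replace (min e b) with e in IHe by lia. lia.
Qed.

Lemma tot_seg_zero f X a b e : e <= a -> tot f (seg X a b) e = 0.
Proof.
  intros H. induction e; [reflexivity |]. rewrite tot_S, IHe by lia. unfold seg.
  destruct (Nat.leb_spec a e); [lia | reflexivity].
Qed.

Lemma tot_seg_all f X a b e : a <= b -> b <= e ->
  tot f (seg X a b) e + tot f X a = tot f X b.
Proof. intros H1 H2. pose proof (tot_seg f X a b e H1). now rewrite !Nat.min_r in H by lia. Qed.

Lemma tot_seg_le f X a b e : a <= b -> tot f (seg X a b) e + tot f X a <= tot f X b.
Proof.
  intros H. destruct (le_lt_dec e b).
  - rewrite <- (tot_seg_all f X a b b) by lia. pose proof (tot_mono f (seg X a b) e b l). lia.
  - rewrite tot_seg_all; lia.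
Qed.

Definition swap (z X Y : nat -> bool) : nat -> bool :=
  fun j => if X j then false else if Y j then true else z j.

Lemma tot_swap f z X Y e :
  (forall j, X j = true -> z j = true) -> (forall j, Y j = true -> z j = false) ->
  tot f (swap z X Y) e + tot f X e = tot f z e + tot f Y e.
Proof.
  intros HX HY. induction e; [reflexivity |]. rewrite !tot_S. unfold swap at 2.
  specialize (HX e). specialize (HY e).
  destruct (X e), (Y e), (z e); try (specialize (HX eq_refl)); try (specialize (HY eq_refl)); try discriminate; lia.
Qed.

Lemma tot_none f X e : (forall j, j < e -> X j = false) -> tot f X e = 0.
Proof. induction e; intros H; [reflexivity |]. rewrite tot_S, IHe, H; auto. Qed.

Lemma cross1 c d g g' Y n :
  (forall b, b < n -> Y b = true -> c * g b <= g' b * d) ->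
  c * tot g Y n <= tot g' Y n * d.
Proof.
  induction n; intros H; [cbn; lia |]. rewrite !tot_S.
  specialize (IHn ltac:(intros; apply H; auto)). specialize (H n ltac:(lia)).
  destruct (Y n); [specialize (H eq_refl) |]; nia.
Qed.

(** Both sides expand into sums over pairs from [X] and [Y], so pairwise comparisons of densities
    add up to a comparison of the two sets. *)
Lemma cross f f' g g' X Y n n' :
  (forall a b, a < n -> b < n' -> X a = true -> Y b = true -> f a * g b <= g' b * f' a) ->
  tot f X n * tot g Y n' <= tot g' Y n' * tot f' X n.
Proof.
  induction n; intros H; [cbn; lia |]. rewrite !tot_S.
  specialize (IHn ltac:(intros; apply H; auto)).
  assert (H1 : (if X n then f n else 0) * tot g Y n' <= tot g' Y n' * (if X n then f' n else 0)).
  { apply cross1. intros b Hb HY. destruct (X n) eqn:E; [apply H; auto | lia]. }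
  nia.
Qed.

Lemma first_reach f W X t :
  f 0 = 0 -> 1 <= W -> (forall x, x < X -> f (S x) <= f x + W) -> t <= f X ->
  exists x, x <= X /\ t <= f x < t + W.
Proof.
  intros H0 HW. induction X; intros HS Ht.
  - exists 0. lia.
  - destruct (le_lt_dec t (f X)) as [H | H].
    + destruct IHX as (x & Hx & ?); auto. exists x. lia.
    + exists (S X). specialize (HS X ltac:(lia)). lia.
Qed.

Lemma pigeonhole (P : nat -> nat -> Prop) n k :
  (forall i, i < n -> exists d, d < k /\ P i d) -> k < n ->
  exists i j d, i < j < n /\ P i d /\ P j d.
Proof.
  intros H Hk.
  assert (G : exists l, length l = n /\ forall i, i < n -> nth i l 0 < k /\ P i (nth i l 0)).
  { clear Hk. induction n.
    - exists []. split; auto. lia.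
    - destruct IHn as (l & Hl & HP); auto. destruct (H n) as (d & Hd & Pd); auto.
      exists (l ++ [d]). rewrite length_app. split; [simpl; lia |]. intros i Hi.
      destruct (Nat.eq_dec i n) as [-> | Hne].
      + rewrite app_nth2, Hl, Nat.sub_diag by lia. auto.
      + rewrite app_nth1 by lia. apply HP. lia. }
  destruct G as (l & Hl & HP).
  assert (ND : ~ NoDup l).
  { intros ND. apply NoDup_incl_length with (l' := seq 0 k) in ND.
    - rewrite length_seq in ND. lia.
    - intros d Hd. apply In_nth with (d := 0) in Hd as (i & Hi & <-). apply in_seq.
      specialize (HP i). lia. }
  apply not_NoDup in ND as (d & l1 & l2 & l3 & ->); [| intros a b; destruct (Nat.eq_dec a b); [now left | now right]].
  exists (length l1), (length (l1 ++ d :: l2)), d.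
  rewrite <- Hl, !length_app. simpl length. rewrite length_app. simpl length.
  split; [lia |].
  destruct (HP (length l1)) as [_ H1]; [rewrite <- Hl, length_app; simpl; lia |].
  rewrite nth_middle in H1.
  destruct (HP (length (l1 ++ d :: l2))) as [_ H2];
    [rewrite <- Hl, !length_app; simpl; rewrite length_app; simpl; lia |].
  replace (l1 ++ d :: l2 ++ d :: l3) with ((l1 ++ d :: l2) ++ d :: l3) in H2
    by now rewrite <- app_assoc.
  rewrite nth_middle in H2. rewrite length_app in H2. simpl in H2. auto.
Qed.

Lemma stairs_mono f X : (forall x, x < X -> f x <= f (S x)) ->
  forall a b, a <= b -> b <= X -> f a <= f b.
Proof. induction 2; intros; auto. specialize (H m). lia. Qed.

(** For each of the [W + 1] thresholds [k * W], take a first point where [f] reaches it and a first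
    point where [g] reaches that value of [f]. The overshoot of [g] is one of [W] numbers, so two
    thresholds share it, and between them [f] and [g] grow by the same amount. *)
Lemma staircase W f g X Y :
  1 <= W -> f 0 = 0 -> g 0 = 0 ->
  (forall x, x < X -> f x <= f (S x) <= f x + W) ->
  (forall y, y < Y -> g y <= g (S y) <= g y + W) ->
  W * W <= f X -> W * W + W <= g Y ->
  exists x x' y y', x < x' <= X /\ y < y' <= Y /\ f x < f x' /\ f x + g y' = f x' + g y.
Proof.
  intros HW F0 G0 HF HG HX HY.
  destruct (pigeonhole (fun k d => exists x y, x <= X /\ y <= Y /\
      k * W <= f x < k * W + W /\ g y = f x + d) (S W) W) as (k & k' & d & Hk & A & B).
  - intros k Hk.
    destruct (first_reach f W X (k * W)) as (x & Hx & Fx); auto; [intros; apply HF; auto | nia |].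
    destruct (first_reach g W Y (f x)) as (y & Hy & Gy); auto; [intros; apply HG; auto | nia |].
    exists (g y - f x). split; [lia |]. exists x, y. repeat split; auto; lia.
  - lia.
  - destruct A as (x & y & Hx & Hy & Fx & Gy). destruct B as (x' & y' & Hx' & Hy' & Fx' & Gy').
    assert (f x < f x') by nia.
    exists x, x', y, y'. repeat split; auto; try lia.
    + destruct (le_lt_dec x' x); auto.
      pose proof (stairs_mono f X ltac:(intros; apply HF; auto) x' x). lia.
    + destruct (le_lt_dec y' y); auto.
      pose proof (stairs_mono g Y ltac:(intros; apply HG; auto) y' y). lia.
Qed.

(** Comparison of the densities [w a / p a] and [w b / p b] without division; among equal densities
    the larger index counts as lower. *)
Definition lower (p w : nat -> nat) (a b : nat) : Prop :=
  w a * p b < w b * p a \/ w a * p b = w b * p a /\ b < a.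

Section Proximity.

(* [r j] is the part of job [j] kept by the fractional optimum, [cap e] the capacity of the
   prefix of length [e], and [e] is tight when the kept parts exhaust it. *)
Variables (m W : nat) (p w r cap : nat -> nat).
Let kap e := sumf r e.
Let tight e := kap e = cap e.
Hypothesis W_pos : 1 <= W.
Hypothesis w_le : forall j, j < m -> w j <= W.
Hypothesis r_le : forall j, j < m -> r j <= p j.
Hypothesis kap_le : forall e, e <= m -> kap e <= cap e.
Hypothesis kap_top : tight m.
Hypothesis later_lower : forall a b, b < a < m -> r a < p a -> 0 < r b -> lower p w a b.
Hypothesis block_lower : forall a b, a < b < m -> r a < p a -> 0 < r b ->
  (forall e, a < e <= b -> ~ tight e) -> lower p w a b.

Definition fits (z : nat -> bool) (n : nat) : Prop := forall e, e <= n -> tot p z e <= cap e.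

(* Ordering optima by [psi] breaks ties first by total processing time, then by [sum w_j * j]. *)
Let psi j := m * W * W * p j + w j * j.

Variable z : nat -> bool.
Hypothesis z_fits : fits z m.
Hypothesis z_opt : forall x, fits x m -> tot w x m <= tot w z m.
Hypothesis z_psi : forall x, fits x m -> tot w x m = tot w z m -> tot psi z m <= tot psi x m.

Variables (i : nat) (y : nat -> bool).
Hypothesis i_le : i <= m.
Hypothesis y_fits : fits y i.
Hypothesis y_kap : tot p y i <= kap i.
Hypothesis y_opt : forall x, fits x i -> tot p x i <= kap i -> tot w x i <= tot w y i.

(** Per unit of weight, [psi] is larger by at least one on the lower job. If the densities differ,
    the factor [m * W * W] outweighs [w a * w b * (b + 1)]; in a tie the index term decides. *)
Lemma lower_psi a b : a < m -> b < m -> lower p w a b -> w a * (psi b + w b) <= w b * psi a.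
Proof.
  intros Ha Hb H. unfold psi. pose proof (w_le a Ha). pose proof (w_le b Hb).
  destruct H as [H | [H Hlt]].
  - assert (w a * w b * (b + 1) <= W * W * m) by (repeat apply Nat.mul_le_mono; lia).
    assert (m * W * W * (w a * p b + 1) <= m * W * W * (w b * p a)) by (apply Nat.mul_le_mono_l; lia).
    nia.
  - assert (w a * w b * (b + 1) <= w a * w b * a) by (apply Nat.mul_le_mono_l; lia).
    assert (m * W * W * (w a * p b) = m * W * W * (w b * p a)) by (f_equal; lia).
    nia.
Qed.

Lemma lower_p a b : lower p w a b -> w a * p b <= w b * p a.
Proof. intros [H | [H _]]; lia. Qed.

Lemma tot_step X x : x < m -> tot w X x <= tot w X (S x) <= tot w X x + W.
Proof. intros Hx. rewrite tot_S. pose proof (w_le x Hx). destruct (X x); lia. Qed.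

Section Exchange.

Variables extra missing : nat -> bool.
Hypothesis extra_in : forall j, extra j = true -> z j = true.
Hypothesis missing_out : forall j, missing j = true -> z j = false.
Hypothesis extra_lower : forall a b, a < m -> b < m -> extra a = true -> missing b = true -> lower p w a b.

Lemma exchange_weights X Y n n' : n <= m -> n' <= m ->
  (forall j, X j = true -> extra j = true) -> (forall j, Y j = true -> missing j = true) ->
  tot w X n * tot p Y n' <= tot w Y n' * tot p X n.
Proof.
  intros Hn Hn' HX HY. apply cross. intros. apply lower_p. apply extra_lower; auto; lia.
Qed.

Lemma seg_sub X a b j : seg X a b j = true -> X j = true.
Proof. unfold seg. intros H. now apply andb_prop in H. Qed.

(** The swap keeps the weight, so it yields another optimum, whose [psi] is smaller by at least [v]
    according to [lower_psi]. *)
Lemma no_exchange a b c d v :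
  a <= b -> b <= m -> c <= d -> d <= m -> 0 < v ->
  tot w (seg extra a b) m = v -> tot w (seg missing c d) m = v ->
  fits (swap z (seg extra a b) (seg missing c d)) m -> False.
Proof.
  intros Hab Hb Hcd Hd Hv HR HS HF.
  assert (HR' : forall j, seg extra a b j = true -> z j = true) by (intros; eapply extra_in, seg_sub; eauto).
  assert (HS' : forall j, seg missing c d j = true -> z j = false) by (intros; eapply missing_out, seg_sub; eauto).
  pose proof (tot_swap w _ _ _ m HR' HS') as E1.
  pose proof (tot_swap psi _ _ _ m HR' HS') as E2.
  specialize (z_psi _ HF ltac:(lia)).
  assert (C : tot w (seg extra a b) m * tot (fun j => psi j + w j) (seg missing c d) m
              <= tot w (seg missing c d) m * tot psi (seg extra a b) m).
  { apply cross. intros. apply lower_psi; auto. apply extra_lower; eauto using seg_sub. }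
  assert (E3 : tot (fun j => psi j + w j) (seg missing c d) m = tot psi (seg missing c d) m + tot w (seg missing c d) m).
  { unfold tot. rewrite <- sumf_add. apply sumf_ext. intros. destruct (seg missing c d j); auto. }
  rewrite E3, HR, HS in C. apply Nat.mul_le_mono_pos_l in C; lia.
Qed.

Lemma exchange_time a b c d v n n' : n <= m -> n' <= m -> 0 < v ->
  tot w (seg extra a b) n = v -> tot w (seg missing c d) n' = v ->
  tot p (seg missing c d) n' <= tot p (seg extra a b) n.
Proof.
  intros Hn Hn' Hv HR HS.
  pose proof (exchange_weights (seg extra a b) (seg missing c d) n n' Hn Hn'
    (seg_sub extra a b) (seg_sub missing c d)) as C.
  rewrite HR, HS in C. apply Nat.mul_le_mono_pos_l in C; lia.
Qed.

(** The density comparison stays true when [p b] shrinks to the kept part [r b]. In this form the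
    lead of the fractional solution, which consists of kept parts, bounds the weight of the missing
    jobs from below. *)
Lemma missing_weight x s n' : x <= m -> n' <= m -> s <= tot r missing n' -> tot p extra x < s ->
  0 < tot w extra x -> tot w extra x < tot w missing n'.
Proof.
  intros Hx Hn' Hs Hlt Hpos.
  assert (C : tot w extra x * tot r missing n' <= tot w missing n' * tot p extra x).
  { apply cross. intros a b Ha Hb HR HS.
    pose proof (lower_p a b (extra_lower a b ltac:(lia) ltac:(lia) HR HS)).
    pose proof (r_le b ltac:(lia)). nia. }
  nia.
Qed.

End Exchange.

(** * Prefixes on which the optimum lags behind the fractional solution *)

Section Behind.

Hypothesis behind : tot p z i <= kap i.
Let s := kap i - tot p z i.
Let extra j := (i <=? j) && (z j && (r j <? p j)).
Let missing j := (j <? i) && (negb (z j) && (0 <? r j)).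

Lemma R_spec j : extra j = true -> i <= j /\ z j = true /\ r j < p j.
Proof.
  unfold extra. rewrite !andb_true_iff, Nat.leb_le, Nat.ltb_lt. tauto.
Qed.

Lemma S_spec j : missing j = true -> j < i /\ z j = false /\ 0 < r j.
Proof.
  unfold missing. rewrite !andb_true_iff, negb_true_iff, !Nat.ltb_lt. tauto.
Qed.

Lemma extra_lower_behind a b : a < m -> b < m -> extra a = true -> missing b = true -> lower p w a b.
Proof.
  intros Ha Hb HR HS. apply R_spec in HR. apply S_spec in HS. apply later_lower; lia.
Qed.

Lemma extra_in_behind j : extra j = true -> z j = true.
Proof. intros H. now apply R_spec in H. Qed.

Lemma missing_out_behind j : missing j = true -> z j = false.
Proof. intros H. now apply S_spec in H. Qed.

(** From [i] back to [e] the lead of the fractional solution shrinks by at most the kept parts of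
    the missing jobs in between. *)
Lemma slack_before e : e <= i -> tot p z e + s + tot r missing e <= kap e + tot r missing i.
Proof.
  intros He.
  assert (H : sumf r i + sumf (fun j => (if z j then p j else 0) + (if missing j then r j else 0)) e <=
     sumf (fun j => (if z j then p j else 0) + (if missing j then r j else 0)) i + sumf r e).
  { apply sumf_range; auto. intros j Hj. unfold missing. pose proof (r_le j ltac:(lia)).
    destruct (Nat.ltb_spec j i); [| lia].
    destruct (z j); cbn [andb negb]; [lia |]. destruct (Nat.ltb_spec 0 (r j)); lia. }
  rewrite !sumf_add in H. unfold s, kap, tot in *. lia.
Qed.

(** Beyond [i] only jobs of [extra] can reduce the lead, each by at most its time. *)
Lemma slack_after e : i <= e -> e <= m -> tot p z e + s <= kap e + tot p extra e.
Proof.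
  intros He Hm.
  assert (H : sumf (fun j => if z j then p j else 0) e + sumf (fun j => r j + (if extra j then p j else 0)) i
     <= sumf (fun j => r j + (if extra j then p j else 0)) e + sumf (fun j => if z j then p j else 0) i).
  { apply sumf_range; auto. intros j Hj. unfold extra. pose proof (r_le j ltac:(lia)).
    destruct (Nat.leb_spec i j); [| lia].
    destruct (z j); cbn [andb negb]; [| lia]. destruct (Nat.ltb_spec (r j) (p j)); lia. }
  rewrite !sumf_add in H. unfold s, kap, tot in *. lia.
Qed.

(** Up to [i] the added jobs use the slack of [slack_before]; this is why they come from the end of
    the prefix, where all missing jobs from [c0] on take at most [s]. Between [i] and [x1] the slack
    pays for additions not yet compensated, and beyond [x1] the swap is complete and takes no more
    time than before. *)
Lemma swap_fits_behind c0 c d a b x1 :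
  c0 <= c -> c <= d -> d <= i -> a <= b -> b <= x1 -> x1 <= m ->
  tot p (seg missing c0 i) i <= s ->
  (forall e, i <= e <= x1 ->
     tot p (seg missing c d) i + tot p extra e <= s + tot p (seg extra a b) e) ->
  tot p (seg missing c d) i <= tot p (seg extra a b) x1 ->
  fits (swap z (seg extra a b) (seg missing c d)) m.
Proof.
  intros Hc Hcd Hd Hab Hb Hx Hs H1 H2 e He.
  assert (HR' : forall j, seg extra a b j = true -> z j = true)
    by (intros; eapply extra_in_behind, seg_sub; eauto).
  assert (HS' : forall j, seg missing c d j = true -> z j = false)
    by (intros; eapply missing_out_behind, seg_sub; eauto).
  pose proof (tot_swap p _ _ _ e HR' HS') as E.
  pose proof (kap_le e He) as Hk. pose proof (z_fits e He) as Hz.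
  destruct (le_lt_dec e i) as [Hei | Hei].
  - destruct (le_lt_dec e c) as [Hec | Hec].
    + rewrite (tot_seg_zero p missing c d e Hec) in E. lia.
    + pose proof (slack_before e Hei) as Hsl.
      pose proof (tot_seg_all r missing e i i Hei ltac:(lia)) as E1.
      assert (E2 : tot r (seg missing e i) i <= tot p (seg missing e i) i).
      { pose proof (sumf_range (fun j => if seg missing e i j then r j else 0)
          (fun j => if seg missing e i j then p j else 0) 0 i ltac:(lia)) as Q.
        cbn [sumf] in Q. unfold tot. rewrite !Nat.add_0_r in Q. apply Q. intros j Hj.
        destruct (seg missing e i j); auto. apply r_le. lia. }
      pose proof (tot_seg_all p missing e i i Hei ltac:(lia)) as E3.
      pose proof (tot_seg_all p missing c0 i i ltac:(lia) ltac:(lia)) as E4.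
      pose proof (tot_seg p missing c d e Hcd) as E5.
      pose proof (tot_mono p missing c0 (min e c) ltac:(lia)) as E6.
      pose proof (tot_mono p missing (min e d) e ltac:(lia)) as E7.
      lia.
  - assert (E1 : tot p (seg missing c d) e = tot p (seg missing c d) i).
    { pose proof (tot_seg_all p missing c d e). pose proof (tot_seg_all p missing c d i). lia. }
    pose proof (slack_after e ltac:(lia) He) as Hsl.
    destruct (le_lt_dec e x1) as [Hex | Hex].
    + specialize (H1 e ltac:(lia)). lia.
    + assert (E2 : tot p (seg extra a b) e = tot p (seg extra a b) x1).
      { pose proof (tot_seg_all p extra a b e). pose proof (tot_seg_all p extra a b x1). lia. }
      lia.
Qed.

(** Suppose the weight reaches [8 * W * W]. The last missing jobs before [i] of weight about
    [3 * W * W] have at most half the weight of [extra] and are denser, so they take less than half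
    of [s]. Consider the first part of [extra] of weight about [W * W]. If it takes at most half of
    [s], the pigeonhole argument yields an equal-weight swap that fits. Otherwise it takes longer
    than the chosen missing jobs, and exchanging the two entirely gains weight. *)
Lemma few_removed x : x <= m -> tot p extra x < s -> tot w extra x < 8 * W * W.
Proof.
  intros Hx Hs. destruct (le_lt_dec (8 * W * W) (tot w extra x)) as [Hbig |]; auto. exfalso.
  assert (HW : W <= W * W) by nia.
  pose proof (slack_before 0 ltac:(lia)) as Hr. cbn in Hr.
  change (kap 0) with 0 in Hr.
  assert (Hw : tot w extra x < tot w missing i).
  { apply (missing_weight extra missing extra_lower_behind x s i); auto; [| nia]. unfold tot in *. cbn in Hr. lia. }
  set (be yy := tot w (seg missing (i - yy) i) i).
  assert (Hbe : forall yy, be yy + tot w missing (i - yy) = tot w missing i).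
  { intros. apply tot_seg_all; lia. }
  assert (B0 : be 0 = 0) by (specialize (Hbe 0); rewrite Nat.sub_0_r in Hbe; lia).
  assert (BS : forall yy, yy < i -> be yy <= be (S yy) <= be yy + W).
  { intros yy Hy. pose proof (Hbe yy). pose proof (Hbe (S yy)).
    pose proof (tot_step missing (i - S yy) ltac:(lia)) as Q.
    replace (S (i - S yy)) with (i - yy) in Q by lia. lia. }
  (* The weight [3 * W * W] suffices for [staircase] and exceeds that of the removed part, which is
     below [W * W + W]; twice [3 * W * W + W] is still at most [8 * W * W]. *)
  destruct (first_reach be W i (3 * W * W)) as (y1 & Hy1 & By1); auto.
  { intros. apply BS; auto. }
  { specialize (Hbe i). rewrite Nat.sub_diag in Hbe. cbn in Hbe. lia. }
  destruct (first_reach (tot w extra) W x (W * W)) as (x1 & Hx1 & Ax1); auto.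
  { intros. apply tot_step. lia. }
  { lia. }
  set (c0 := i - y1).
  assert (Hpi : 2 * tot p (seg missing c0 i) i <= tot p extra x).
  { pose proof (exchange_weights extra missing extra_lower_behind extra (seg missing c0 i) x i Hx i_le
      (fun _ h => h) (seg_sub missing c0 i)) as C.
    fold c0 in Hbe. change (tot w (seg missing c0 i) i) with (be y1) in C.
    assert (2 * be y1 <= tot w extra x) by lia.
    assert (0 < tot w extra x) by nia.
    apply (Nat.mul_le_mono_pos_l _ _ (tot w extra x)); auto. nia. }
  pose proof (tot_mono p extra x1 x Hx1) as Hm.
  destruct (le_lt_dec (2 * tot p extra x1) s) as [Hc | Hc].
  - destruct (staircase W (tot w extra) be x1 y1) as (a & b & d & c & Hab & Hcd & Hlt & Heq); auto; try lia.
    { intros. apply tot_step. lia. }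
    { intros. apply BS. lia. }
    pose proof (tot_seg_all w extra a b m ltac:(lia) ltac:(lia)) as E1.
    pose proof (tot_seg_all w missing (i - c) (i - d) m ltac:(lia) ltac:(lia)) as E2.
    pose proof (Hbe c) as E3. pose proof (Hbe d) as E4.
    assert (Tm : tot w (seg missing (i - c) (i - d)) i = tot w (seg missing (i - c) (i - d)) m).
    { pose proof (tot_seg_all w missing (i - c) (i - d) i ltac:(lia) ltac:(lia)). lia. }
    assert (Tx : tot w (seg extra a b) x1 = tot w (seg extra a b) m).
    { pose proof (tot_seg_all w extra a b x1 ltac:(lia) ltac:(lia)). lia. }
    apply (no_exchange extra missing extra_in_behind missing_out_behind extra_lower_behind a b (i - c) (i - d)
      (tot w (seg extra a b) m)); auto; try lia.
    apply swap_fits_behind with (c0 := c0) (x1 := x1); try lia.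
    + intros e He. pose proof (tot_mono p extra e x1 ltac:(lia)).
      pose proof (tot_seg_le p missing (i - c) (i - d) i ltac:(lia)).
      pose proof (tot_seg_all p missing c0 i i ltac:(unfold c0; lia) ltac:(lia)).
      pose proof (tot_mono p missing c0 (i - c) ltac:(unfold c0; lia)).
      pose proof (tot_mono p missing (i - d) i ltac:(lia)). lia.
    + apply (exchange_time extra missing extra_lower_behind a b (i - c) (i - d) (tot w (seg extra a b) m)); lia.
  - assert (HF : fits (swap z (seg extra 0 x1) (seg missing c0 i)) m).
    { apply swap_fits_behind with (c0 := c0) (x1 := x1); unfold c0 in *; try lia.
      - intros e He. pose proof (tot_seg p extra 0 x1 e ltac:(lia)) as Q.
        rewrite Nat.min_0_r, Nat.min_l in Q by lia. cbn in Q. lia.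
      - pose proof (tot_seg_all p extra 0 x1 x1 ltac:(lia) ltac:(lia)) as Q. cbn in Q. lia. }
    pose proof (z_opt _ HF) as Ho.
    pose proof (tot_swap w z (seg extra 0 x1) (seg missing c0 i) m
      (fun j h => extra_in_behind j (seg_sub _ _ _ _ h)) (fun j h => missing_out_behind j (seg_sub _ _ _ _ h))) as E.
    pose proof (tot_seg_all w extra 0 x1 m ltac:(lia) ltac:(lia)) as E1. cbn in E1.
    pose proof (tot_seg_all w missing c0 i m ltac:(unfold c0; lia) ltac:(lia)) as E2.
    pose proof (Hbe y1) as E3. fold c0 in E3. nia.
Qed.

(** The cut is placed where removing [extra] first frees [s] units of time; the last job adds at
    most [W] to the bound of [few_removed]. If all of [extra] is too short, all of it is removed. *)
Lemma cut_point : exists X, X <= m /\ tot w extra X <= 8 * W * W + W /\ (s <= tot p extra X \/ X = m).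
Proof.
  assert (G : forall X, X <= m -> tot p extra X < s \/
     exists X', X' <= X /\ s <= tot p extra X' /\ tot w extra X' <= 8 * W * W + W).
  { induction X; intros HX.
    - destruct (le_lt_dec s (tot p extra 0)) as [H | H]; auto. right. exists 0. cbn. cbn in H. lia.
    - destruct IHX as [H | (X' & ? & ?)]; [lia | | right; exists X'; lia].
      destruct (le_lt_dec s (tot p extra (S X))) as [H1 | H1]; auto. right.
      exists (S X). pose proof (few_removed X ltac:(lia) H).
      pose proof (tot_step extra X ltac:(lia)). lia. }
  destruct (G m (le_n _)) as [H | (X' & ? & ? & ?)].
  - exists m. pose proof (few_removed m (le_n _) H). lia.
  - exists X'. lia.
Qed.

(** The hybrid takes [y] before [i] and then [z] without [extra] up to the cut. It spends at most
    [s] more on the prefix, which the removal repays, so the optimality of [z] bounds the gain of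
    [y] by the removed weight. *)
Lemma behind_bounds : tot w z i <= tot w y i /\ tot w y i <= tot w z i + (8 * W * W + W).
Proof.
  split.
  { apply y_opt; auto. intros e He. apply z_fits. lia. }
  destruct cut_point as (X & HX & HwX & HsX).
  set (h := fun j => if j <? i then y j else z j && negb (seg extra 0 X j)).
  assert (H1 : forall f e, e <= i -> tot f h e = tot f y e).
  { intros f e He. apply tot_ext. intros j Hj. unfold h. destruct (Nat.ltb_spec j i); auto. lia. }
  assert (H2 : forall f e, i <= e -> tot f h e + tot f z i + tot f (seg extra 0 X) e = tot f y i + tot f z e).
  { intros f e He. induction He.
    - rewrite H1 by auto. enough (tot f (seg extra 0 X) i = 0) by lia. apply tot_none. intros j Hj.
      unfold seg, extra. destruct (Nat.leb_spec i j); [lia |]. now rewrite andb_false_r.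
    - rewrite !tot_S. unfold h at 2. destruct (Nat.ltb_spec m0 i); [lia |].
      destruct (seg extra 0 X m0) eqn:E; cbn [negb].
      + apply seg_sub, extra_in_behind in E. rewrite E. cbn [andb]. lia.
      + rewrite andb_true_r. lia. }
  assert (HF : fits h m).
  { intros e He. destruct (le_lt_dec e i) as [Hei | Hei].
    - rewrite H1 by auto. apply y_fits; auto.
    - specialize (H2 p e ltac:(lia)). pose proof (tot_seg p extra 0 X e ltac:(lia)) as Q.
      rewrite Nat.min_0_r in Q. cbn in Q.
      pose proof (slack_after e ltac:(lia) He) as Hsl. pose proof (kap_le e He). pose proof (z_fits e He).
      destruct (le_lt_dec e X) as [HeX | HeX].
      + rewrite Nat.min_l in Q by lia. unfold s in *. lia.
      + rewrite Nat.min_r in Q by lia. unfold s in *. lia. }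
  pose proof (z_opt _ HF). specialize (H2 w m i_le).
  pose proof (tot_seg_le w extra 0 X m ltac:(lia)). lia.
Qed.

End Behind.

(** * Prefixes on which the optimum runs ahead of the fractional solution *)

Section Ahead.

Hypothesis ahead : kap i < tot p z i.
Let u := tot p z i - kap i.

(** At a tight prefix, as at the empty one, the capacity bound on [z] is a bound by [kap]. The last
    such prefix up to [i] and the first one after it delimit a block without tight prefixes in
    between, where [block_lower] compares jobs. *)
Lemma tight_before : exists a0, a0 <= i /\ tot p z a0 <= kap a0 /\
  forall e, a0 < e <= i -> ~ tight e.
Proof.
  assert (G : forall k, k <= i -> exists a0, a0 <= k /\ tot p z a0 <= kap a0 /\
    forall e, a0 < e <= k -> ~ tight e).
  { induction k; intros Hk.
    - exists 0. split; [lia |]. split; [cbn; lia |]. intros; lia.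
    - destruct (Nat.eq_dec (kap (S k)) (cap (S k))) as [T | T].
      + exists (S k). split; [lia |]. split; [rewrite T; apply z_fits; lia |]. intros; lia.
      + destruct IHk as (a0 & ? & ? & HN); [lia |]. exists a0. repeat split; auto; try lia.
        intros e He. destruct (Nat.eq_dec e (S k)) as [-> |]; auto. apply HN. lia. }
  apply G. auto.
Qed.

Lemma tight_after : exists b0, i < b0 <= m /\ tot p z b0 <= kap b0 /\
  forall e, i <= e < b0 -> ~ tight e.
Proof.
  assert (Hi : ~ tight i) by (unfold tight; specialize (z_fits i i_le); lia).
  assert (G : forall k, i <= k -> k <= m -> (forall e, i <= e <= k -> ~ tight e) \/
    exists b0, i < b0 <= k /\ tight b0 /\ forall e, i <= e < b0 -> ~ tight e).
  { intros k Hk. induction Hk; intros Hm.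
    - left. intros e He. replace e with i by lia. auto.
    - destruct IHHk as [H | (b0 & ? & ?)]; [lia | | right; exists b0; split; [lia | tauto]].
      destruct (Nat.eq_dec (kap (S m0)) (cap (S m0))) as [T | T].
      + right. exists (S m0). repeat split; auto; try lia. intros; apply H; lia.
      + left. intros e He. destruct (Nat.eq_dec e (S m0)) as [-> |]; auto. apply H. lia. }
  destruct (G m i_le (le_n _)) as [H | (b0 & Hb & T & HN)].
  - exfalso. apply (H m); auto.
  - exists b0. repeat split; auto; try lia. rewrite T. apply z_fits. lia.
Qed.

(** Here the removed jobs precede [i] and the added ones follow it, so every equal-weight swap fits
    without any slack: no prefix becomes longer. The same constant as in the other case is used. *)
Lemma ahead_bounds : tot w y i <= tot w z i /\ tot w z i <= tot w y i + (8 * W * W + W).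
Proof.
  split.
  (* The prefix chosen by [y] is shorter than that of [z], so the continuation of [z] still fits. *)
  { set (h := fun j => if j <? i then y j else z j).
    assert (H1 : forall f e, e <= i -> tot f h e = tot f y e).
    { intros f e He. apply tot_ext. intros j Hj. unfold h. destruct (Nat.ltb_spec j i); auto. lia. }
    assert (H2 : forall f e, i <= e -> tot f h e + tot f z i = tot f y i + tot f z e).
    { intros f e He. induction He; [rewrite H1 by auto; lia |].
      rewrite !tot_S. unfold h at 2. destruct (Nat.ltb_spec m0 i); lia. }
    assert (HF : fits h m).
    { intros e He. destruct (le_lt_dec e i) as [Hei | Hei].
      - rewrite H1 by auto. apply y_fits; auto.
      - specialize (H2 p e ltac:(lia)). pose proof (z_fits e He). lia. }
    pose proof (z_opt _ HF). specialize (H2 w m i_le). lia. }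
  destruct tight_before as (a0 & Ha0 & Hza & Na).
  destruct tight_after as (b0 & Hb0 & Hzb & Nb).
  set (extra := fun j => ((a0 <=? j) && (j <? i)) && (z j && (r j <? p j))).
  set (missing := fun j => ((i <=? j) && (j <? b0)) && (negb (z j) && (0 <? r j))).
  assert (HR : forall j, extra j = true -> a0 <= j < i /\ z j = true /\ r j < p j).
  { intros j. unfold extra. rewrite !andb_true_iff, Nat.leb_le, !Nat.ltb_lt. tauto. }
  assert (HS : forall j, missing j = true -> i <= j < b0 /\ z j = false /\ 0 < r j).
  { intros j. unfold missing. rewrite !andb_true_iff, negb_true_iff, Nat.leb_le, !Nat.ltb_lt. tauto. }
  assert (extra_in : forall j, extra j = true -> z j = true) by (intros j H; now apply HR in H).
  assert (missing_out : forall j, missing j = true -> z j = false) by (intros j H; now apply HS in H).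
  assert (HL : forall a b, a < m -> b < m -> extra a = true -> missing b = true -> lower p w a b).
  { intros a b Ha Hb H1 H2. apply HR in H1. apply HS in H2. apply block_lower; try lia.
    intros e He. destruct (le_lt_dec e i); [apply Na | apply Nb]; lia. }
  assert (Hu1 : u <= tot p extra i).
  { assert (H : sumf (fun j => if z j then p j else 0) i + sumf (fun j => r j + (if extra j then p j else 0)) a0
       <= sumf (fun j => r j + (if extra j then p j else 0)) i + sumf (fun j => if z j then p j else 0) a0).
    { apply sumf_range; auto. intros j Hj. unfold extra. pose proof (r_le j ltac:(lia)).
      destruct (Nat.leb_spec a0 j); [| lia]. destruct (Nat.ltb_spec j i); [| lia].
      destruct (z j); cbn [andb]; [| lia]. destruct (Nat.ltb_spec (r j) (p j)); lia. }
    rewrite !sumf_add in H. unfold u, kap, tot in *. lia. }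
  assert (Hu2 : u <= tot r missing m).
  { assert (H : sumf r b0 + sumf (fun j => (if z j then p j else 0) + (if missing j then r j else 0)) i <=
       sumf (fun j => (if z j then p j else 0) + (if missing j then r j else 0)) b0 + sumf r i).
    { apply sumf_range; [lia |]. intros j Hj. unfold missing. pose proof (r_le j ltac:(lia)).
      destruct (Nat.leb_spec i j); [| lia]. destruct (Nat.ltb_spec j b0); [| lia].
      destruct (z j); cbn [andb negb]; [lia |]. destruct (Nat.ltb_spec 0 (r j)); lia. }
    rewrite !sumf_add in H. pose proof (tot_mono r missing b0 m ltac:(lia)).
    unfold u, kap, tot in *. lia. }
  assert (few : forall x, x <= i -> tot p extra x < u -> tot w extra x < 8 * W * W).
  { intros x Hx Hlt. destruct (le_lt_dec (8 * W * W) (tot w extra x)) as [Hbig |]; auto. exfalso.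
    assert (HW : W <= W * W) by nia.
    assert (Hw : tot w extra x < tot w missing m).
    { apply (missing_weight extra missing HL x u m); auto; try lia. }
    destruct (staircase W (tot w extra) (tot w missing) x m) as (a & b & c & d & Hab & Hcd & Hlt' & Heq); auto; try lia.
    { intros. apply tot_step. lia. }
    { intros. apply tot_step. lia. }
    pose proof (tot_seg_all w extra a b m ltac:(lia) ltac:(lia)) as E1.
    pose proof (tot_seg_all w missing c d m ltac:(lia) ltac:(lia)) as E2.
    pose proof (exchange_time extra missing HL a b c d (tot w (seg extra a b) m) m m ltac:(lia) ltac:(lia)
      ltac:(lia) eq_refl ltac:(lia)) as Ht.
    apply (no_exchange extra missing extra_in missing_out HL a b c d (tot w (seg extra a b) m)); try lia.
    intros e He.
    pose proof (tot_swap p z (seg extra a b) (seg missing c d) e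
      (fun j h => extra_in j (seg_sub _ _ _ _ h)) (fun j h => missing_out j (seg_sub _ _ _ _ h))) as E.
    pose proof (z_fits e He).
    destruct (le_lt_dec e i) as [Hei | Hei].
    - assert (tot p (seg missing c d) e = 0); [| lia]. apply tot_none. intros j Hj.
      unfold seg, missing. destruct (Nat.leb_spec i j); [lia |]. now rewrite andb_false_r.
    - pose proof (tot_seg_all p extra a b e ltac:(lia) ltac:(lia)).
      pose proof (tot_seg_all p extra a b m ltac:(lia) ltac:(lia)).
      pose proof (tot_mono p (seg missing c d) e m He). lia. }
  assert (cut : exists X, X <= i /\ u <= tot p extra X /\ tot w extra X <= 8 * W * W + W).
  { assert (G : forall X, X <= i -> tot p extra X < u \/
       exists X', X' <= X /\ u <= tot p extra X' /\ tot w extra X' <= 8 * W * W + W).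
    { induction X; intros HX.
      - left. cbn. unfold u. lia.
      - destruct IHX as [H | (X' & ? & ?)]; [lia | | right; exists X'; lia].
        destruct (le_lt_dec u (tot p extra (S X))) as [H1 | H1]; auto. right.
        exists (S X). pose proof (few X ltac:(lia) H).
        pose proof (tot_step extra X ltac:(lia)). lia. }
    destruct (G i (le_n _)) as [H | H]; [lia | exact H]. }
  destruct cut as (X & HX & HuX & HwX).
  (* Without the cut part of [extra], [z] spends at most [kap i] on the prefix and thus competes
     with [y]. *)
  set (h := swap z (seg extra 0 X) (fun _ => false)).
  assert (Hh : forall f e, tot f h e + tot f (seg extra 0 X) e = tot f z e).
  { intros f e. unfold h. rewrite tot_swap; [| intros j Hj; eapply extra_in, seg_sub; eauto | discriminate].
    rewrite (tot_none f (fun _ => false)); auto. }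
  assert (Hy : tot w h i <= tot w y i).
  { apply y_opt.
    - intros e He. pose proof (Hh p e). pose proof (z_fits e ltac:(lia)). lia.
    - pose proof (Hh p i). pose proof (tot_seg_all p extra 0 X i ltac:(lia) HX) as Q. cbn in Q.
      unfold u in *. lia. }
  pose proof (Hh w i). pose proof (tot_seg_le w extra 0 X i ltac:(lia)). lia.
Qed.

End Ahead.

Theorem proximity :
  tot w z i <= tot w y i + 9 * W * W /\ tot w y i <= tot w z i + 9 * W * W.
Proof.
  assert (HW : W <= W * W) by nia.
  destruct (le_lt_dec (tot p z i) (kap i)) as [H | H].
  - pose proof (behind_bounds H). lia.
  - pose proof (ahead_bounds H). lia.
Qed.

End Proximity.

Lemma exists_min {A} (P : A -> Prop) (f : A -> nat) :
  (exists a, P a) -> exists a, P a /\ forall b, P b -> f a <= f b.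
Proof.
  intros [a Ha]. remember (f a) as k eqn:E. revert a E Ha.
  induction k as [k IH] using lt_wf_ind. intros a -> Ha.
  destruct (classic (exists b, P b /\ f b < f a)) as [(b & Hb & Hlt) | HN].
  - eapply IH; eauto.
  - exists a. split; auto. intros b Hb. destruct (le_lt_dec (f a) (f b)); auto.
    exfalso. eauto.
Qed.

(** * Schedules and feasible selections *)

Definition job0 : job := Job 0 0 0.
Definition pj (L : list job) (j : nat) : nat := proc (nth j L job0).
Definition wj (L : list job) (j : nat) : nat := weight (nth j L job0).
Definition dj (L : list job) (j : nat) : nat := due (nth j L job0).

Definition total (l : list job) : nat := list_sum (map weight l).

Definition feasible (p d : nat -> nat) (x : nat -> bool) (n : nat) : Prop :=
  forall e, e < n -> tot p x (S e) <= d e.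

Definition early_opt (L : list job) (V : nat) : Prop :=
  (exists x, feasible (pj L) (dj L) x (length L) /\ tot (wj L) x (length L) = V) /\
  (forall x, feasible (pj L) (dj L) x (length L) -> tot (wj L) x (length L) <= V).

(** Earliness is attached to the jobs themselves, so that a permutation carries it along even when
    equal jobs occur several times. *)
Fixpoint flags (t : nat) (l : list job) : list (job * bool) :=
  match l with
  | [] => []
  | j :: l' => let C := t + proc j in (j, negb (due j <? C)) :: flags C l'
  end.

Definition ftime (d : nat) (a : job * bool) : nat :=
  if snd a && (due (fst a) <=? d) then proc (fst a) else 0.

Definition fweight (a : job * bool) : nat := if snd a then weight (fst a) else 0.

Lemma list_sum_perm l l' : Permutation l l' -> list_sum l = list_sum l'.
Proof. induction 1; simpl; lia. Qed.

Lemma list_sum_nth {A} (f : A -> nat) (a0 : A) l :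
  list_sum (map f l) = sumf (fun j => f (nth j l a0)) (length l).
Proof.
  induction l as [| a l IH] using rev_ind; [reflexivity |].
  rewrite map_app, list_sum_app, length_app. cbn [length map list_sum fold_right].
  rewrite Nat.add_1_r, Nat.add_0_r. cbn [sumf]. rewrite nth_middle, IH. f_equal.
  apply sumf_ext. intros j Hj. now rewrite app_nth1.
Qed.

Lemma flags_fst t l : map fst (flags t l) = l.
Proof. revert t. induction l; simpl; intros; auto. now rewrite IHl. Qed.

Lemma flags_weight t l :
  tardy_weight_from t l + list_sum (map fweight (flags t l)) = total l.
Proof.
  revert t. induction l as [| j l IH]; intros t; [reflexivity |].
  unfold total in *. simpl. specialize (IH (t + proc j)). unfold fweight at 1. simpl.
  destruct (due j <? t + proc j); simpl; lia.
Qed.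

(** The last early job due by [d] is complete by then, and the others of this kind precede it. The
    alternative 0 covers a start [t] already beyond [d]. *)
Lemma flags_time t l d :
  list_sum (map (ftime d) (flags t l)) = 0 \/ t + list_sum (map (ftime d) (flags t l)) <= d.
Proof.
  revert t. induction l as [| j l IH]; intros t; [left; reflexivity |].
  simpl. unfold ftime at 1 3. simpl. specialize (IH (t + proc j)).
  destruct (Nat.ltb_spec (due j) (t + proc j)); simpl; [lia |].
  destruct (Nat.leb_spec (due j) d); simpl; lia.
Qed.

(** The early jobs of any schedule are feasible in due-date order: those among the first [e + 1]
    jobs of [L] are due by [dj L e], so together they fit before it. *)
Lemma early_weight_le L l V :
  (forall i j, i <= j < length L -> dj L i <= dj L j) ->
  Permutation l L -> early_opt L V -> total L <= tardy_weight_from 0 l + V.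
Proof.
  intros Hs Hp [_ HV].
  assert (HP : Permutation L (map fst (flags 0 l))) by (rewrite flags_fst; now symmetry).
  apply Permutation_map_inv in HP as (fl & HL & HP).
  set (x := fun j => snd (nth j fl (job0, false))).
  assert (Hlen : length L = length fl) by (rewrite HL; apply length_map).
  assert (Hnth : forall j, nth j L job0 = fst (nth j fl (job0, false))).
  { intros j. rewrite HL. exact (map_nth fst fl (job0, false) j). }
  assert (Hw : tot (wj L) x (length L) = list_sum (map fweight fl)).
  { rewrite (list_sum_nth _ (job0, false)), Hlen. apply sumf_ext. intros j Hj.
    unfold x, wj, fweight. now rewrite Hnth. }
  assert (Hf : feasible (pj L) (dj L) x (length L)).
  { intros e He.
    assert (Hle : tot (pj L) x (S e) <= list_sum (map (ftime (dj L e)) fl)).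
    { rewrite (list_sum_nth _ (job0, false)), <- Hlen.
      etransitivity; [| apply (sumf_mono _ (S e)); lia].
      pose proof (sumf_range (fun j => if x j then pj L j else 0)
        (fun j => ftime (dj L e) (nth j fl (job0, false))) 0 (S e) ltac:(lia)) as Q.
      cbn [sumf] in Q. rewrite !Nat.add_0_r in Q. apply Q. intros j Hj. unfold ftime, x.
      destruct (snd (nth j fl (job0, false))); simpl; [| lia].
      rewrite <- Hnth. fold (dj L j). destruct (Nat.leb_spec (dj L j) (dj L e)); [reflexivity |].
      specialize (Hs j e ltac:(lia)). lia. }
    pose proof (flags_time 0 l (dj L e)) as H.
    rewrite (list_sum_perm _ _ (Permutation_map (ftime (dj L e)) HP)) in H. lia. }
  specialize (HV _ Hf). rewrite Hw in HV.
  rewrite <- (list_sum_perm _ _ (Permutation_map fweight HP)) in HV.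
  pose proof (flags_weight 0 l).
  assert (total l = total L) by (apply list_sum_perm, Permutation_map; auto). lia.
Qed.

Definition part (L : list job) (x : nat -> bool) (n : nat) : list job :=
  map (fun i => nth i L job0) (filter x (seq 0 n)).

Lemma part_S L x n : part L x (S n) = part L x n ++ (if x n then [nth n L job0] else []).
Proof.
  unfold part. rewrite seq_S, filter_app, map_app. simpl. now destruct (x n).
Qed.

Lemma part_sum L x n (f : job -> nat) :
  list_sum (map f (part L x n)) = tot (fun j => f (nth j L job0)) x n.
Proof.
  induction n; [reflexivity |]. rewrite part_S, map_app, list_sum_app, tot_S, IHn.
  destruct (x n); simpl; lia.
Qed.

Lemma tardy_app t a b :
  tardy_weight_from t (a ++ b) =
  tardy_weight_from t a + tardy_weight_from (t + list_sum (map proc a)) b.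
Proof.
  revert t. induction a as [| j a IH]; intros t; simpl; [now rewrite Nat.add_0_r |].
  rewrite IH, !Nat.add_assoc. reflexivity.
Qed.

Lemma tardy_le_total t l : tardy_weight_from t l <= total l.
Proof. pose proof (flags_weight t l). lia. Qed.

Lemma part_early L x n : feasible (pj L) (dj L) x n -> tardy_weight_from 0 (part L x n) = 0.
Proof.
  induction n; intros H; [reflexivity |].
  rewrite part_S, tardy_app, IHn by (intros e He; apply H; lia).
  specialize (H n ltac:(lia)). rewrite tot_S in H. rewrite part_sum.
  change (fun j => proc (nth j L job0)) with (pj L).
  destruct (x n); simpl; auto.
  fold (dj L n). fold (pj L n). destruct (Nat.ltb_spec (dj L n) (tot (pj L) x n + pj L n)); lia.
Qed.

Lemma filter_split {A} (f : A -> bool) l :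
  Permutation (filter f l ++ filter (fun a => negb (f a)) l) l.
Proof.
  induction l as [| a l IH]; simpl; auto. destruct (f a); simpl; auto.
  symmetry. apply Permutation_cons_app. now symmetry.
Qed.

Lemma map_nth_seq (L : list job) : map (fun i => nth i L job0) (seq 0 (length L)) = L.
Proof.
  apply nth_ext with job0 job0; rewrite length_map, length_seq; auto. intros i Hi.
  rewrite nth_indep with (d' := nth 0 L job0) by now rewrite length_map, length_seq.
  rewrite (map_nth (fun i => nth i L job0)), seq_nth; auto.
Qed.

(** The selected jobs run first, in due-date order and on time; the others follow and lose at most
    their whole weight. *)
Lemma early_weight_attained L V : early_opt L V ->
  exists l, Permutation l L /\ tardy_weight_from 0 l + V <= total L.
Proof.
  intros [(x & Hx & HV) _].
  exists (part L x (length L) ++ part L (fun j => negb (x j)) (length L)). split.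
  - unfold part. rewrite <- map_app. rewrite <- (map_nth_seq L) at 3.
    apply Permutation_map, filter_split.
  - rewrite tardy_app, part_early by auto.
    pose proof (tardy_le_total (0 + list_sum (map proc (part L x (length L))))
      (part L (fun j => negb (x j)) (length L))) as H.
    unfold total in *. rewrite (part_sum _ _ _ weight) in H.
    rewrite (list_sum_nth weight job0). rewrite <- HV. fold (wj L) in *.
    change (fun j => weight (nth j L job0)) with (wj L) in *.
    assert (E : sumf (wj L) (length L) =
      tot (wj L) x (length L) + tot (wj L) (fun j => negb (x j)) (length L)).
    { unfold tot. rewrite <- sumf_add. apply sumf_ext. intros. destruct (x j); simpl; lia. }
    lia.
Qed.

Theorem opt_of_early_opt J L V :
  Permutation J L -> (forall i j, i <= j < length L -> dj L i <= dj L j) ->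
  early_opt L V -> is_opt_value J (total J - V).
Proof.
  intros HJ Hs HV.
  assert (HT : total J = total L) by (apply list_sum_perm, Permutation_map; auto).
  assert (Hge : forall s, is_schedule J s -> total J - V <= cost J s).
  { intros s Hsch. unfold cost.
    assert (Permutation (jobs_of J s) L).
    { etransitivity; [| exact HJ]. rewrite <- (map_nth_seq J) at 2.
      unfold jobs_of. apply Permutation_map. exact Hsch. }
    pose proof (early_weight_le L _ V Hs H HV). lia. }
  split; auto.
  destruct (early_weight_attained L V HV) as (l & Hl & Hle).
  assert (HP : Permutation l (map (fun i => nth i J job0) (seq 0 (length J)))).
  { rewrite map_nth_seq. etransitivity; [exact Hl | now symmetry]. }
  apply Permutation_map_inv in HP as (s & -> & HP).
  exists s. assert (is_schedule J s) by (unfold is_schedule; now symmetry).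
  split; auto. specialize (Hge s H). unfold cost, jobs_of in *.
  change (Job 0 0 0) with job0 in *. lia.
Qed.

(** * The largest early weight within a given time *)

Section Best.

Variables (p w d : nat -> nat) (N : nat).
Hypothesis d_mono : forall i j, i <= j < N -> d i <= d j.

Fixpoint best (n t : nat) : nat :=
  match n with
  | 0 => 0
  | S k =>
      max (best k t)
        (if p k <=? min t (d k) then best k (min t (d k) - p k) + w k else 0)
  end.

Lemma best_mono n : forall t t', t <= t' -> best n t <= best n t'.
Proof.
  induction n; intros t t' H; simpl; auto.
  pose proof (IHn t t' H).
  destruct (Nat.leb_spec (p n) (min t (d n))), (Nat.leb_spec (p n) (min t' (d n))); try lia.
  pose proof (IHn (min t (d n) - p n) (min t' (d n) - p n) ltac:(lia)). lia.
Qed.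

(** Sorted due dates turn the last prefix condition into the next one when job [n] is left out. *)
Lemma feasible_le n x : n < N -> feasible p d x n -> tot p x n <= d n.
Proof.
  intros Hn H. destruct n; [cbn; lia |].
  specialize (H n ltac:(lia)). specialize (d_mono n (S n) ltac:(lia)). lia.
Qed.

Lemma best_complete n : forall t x, n <= N -> feasible p d x n -> tot p x n <= t ->
  tot w x n <= best n t.
Proof.
  induction n; intros t x Hn H Ht; [cbn; lia |].
  assert (H' : feasible p d x n) by (intros e He; apply H; lia).
  specialize (H n ltac:(lia)). cbn [best]. rewrite !tot_S in *.
  destruct (x n).
  - pose proof (IHn (min t (d n) - p n) x ltac:(lia) H' ltac:(lia)).
    destruct (Nat.leb_spec (p n) (min t (d n))); lia.
  - pose proof (IHn t x ltac:(lia) H' ltac:(lia)). lia.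
Qed.

Lemma best_sound n : forall t, n <= N ->
  exists x, feasible p d x n /\ tot p x n <= t /\ tot w x n = best n t.
Proof.
  induction n; intros t Hn.
  - exists (fun _ => false). split; [intros e He; lia |]. cbn. lia.
  - cbn [best].
    assert (X : forall b x f e, e <= n -> tot f (fun j => if j =? n then b else x j) e = tot f x e).
    { intros b x f e He. apply tot_ext. intros j Hj. destruct (Nat.eqb_spec j n); [lia | auto]. }
    assert (Skip : exists x, feasible p d x (S n) /\ tot p x (S n) <= t /\ tot w x (S n) = best n t).
    { destruct (IHn t ltac:(lia)) as (x & F & T & E).
      exists (fun j => if j =? n then false else x j).
      rewrite !tot_S, !X, Nat.eqb_refl, !Nat.add_0_r by auto. repeat split; auto.
      intros e He. destruct (Nat.eq_dec e n) as [-> | Hne].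
      - rewrite tot_S, X, Nat.eqb_refl, Nat.add_0_r by auto. apply feasible_le; auto.
      - rewrite X by lia. apply F. lia. }
    destruct (Nat.leb_spec (p n) (min t (d n))) as [Hp | Hp]; [| now rewrite Nat.max_0_r].
    destruct (le_lt_dec (best n (min t (d n) - p n) + w n) (best n t)) as [Hb | Hb].
    + now rewrite Nat.max_l by auto.
    + rewrite Nat.max_r by lia.
      destruct (IHn (min t (d n) - p n) ltac:(lia)) as (x & F & T & E).
      exists (fun j => if j =? n then true else x j).
      rewrite !tot_S, !X, Nat.eqb_refl by auto. repeat split; try lia.
      intros e He. destruct (Nat.eq_dec e n) as [-> | Hne].
      * rewrite tot_S, X, Nat.eqb_refl by auto. lia.
      * rewrite X by lia. apply F. lia.
Qed.

End Best.

Lemma early_opt_best L D : (forall i j, i <= j < length L -> dj L i <= dj L j) ->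
  (forall j, j < length L -> dj L j <= D) ->
  early_opt L (best (pj L) (wj L) (dj L) (length L) D).
Proof.
  intros Hs HD. split.
  - destruct (best_sound (pj L) (wj L) (dj L) (length L) Hs (length L) D (le_n _)) as (x & F & _ & E).
    now exists x.
  - intros x F. apply best_complete with (N := length L); auto.
    destruct (length L) as [| n]; [cbn; lia |].
    specialize (F n ltac:(lia)). specialize (HD n ltac:(lia)). lia.
Qed.

(** * Reading and sorting the jobs *)

(** The base-[M] digits are due date, processing time and complemented weight, so increasing keys
    mean decreasing weights within a run. The code is invertible, and keys are sorted without
    carrying the jobs along. *)
Definition key (M : nat) (j : job) : nat := (due j * M + proc j) * M + (M - 1 - weight j).

Definition unkey (M k : nat) : job := Job ((k / M) mod M) (M - 1 - k mod M) (k / M / M).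

Lemma unkey_key M j : proc j < M -> weight j < M -> unkey M (key M j) = j.
Proof.
  intros Hp Hw. unfold unkey, key. destruct j as [p w d]; simpl in *.
  assert (E1 : ((d * M + p) * M + (M - 1 - w)) / M = d * M + p).
  { symmetry. apply (Nat.div_unique _ _ _ (M - 1 - w)); lia. }
  assert (E2 : ((d * M + p) * M + (M - 1 - w)) mod M = M - 1 - w).
  { symmetry. apply (Nat.mod_unique _ _ (d * M + p)); lia. }
  rewrite E1, E2. f_equal.
  - symmetry. apply (Nat.mod_unique _ _ d); lia.
  - lia.
  - symmetry. apply (Nat.div_unique _ _ _ p); lia.
Qed.

Lemma key_lex M a b : proc a < M -> weight a < M -> proc b < M -> weight b < M ->
  key M a <= key M b ->
  due a < due b \/ due a = due b /\ (proc a < proc b \/ proc a = proc b /\ weight b <= weight a).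
Proof.
  intros Hpa Hwa Hpb Hwb H. unfold key in H.
  assert (H1 : due a * M + proc a <= due b * M + proc b).
  { apply Nat.lt_succ_r. apply (Nat.mul_lt_mono_pos_r M); [lia |]. nia. }
  destruct (lt_eq_lt_dec (due a) (due b)) as [[Hd | Hd] | Hd]; auto.
  - right. split; auto. rewrite Hd in *.
    destruct (lt_eq_lt_dec (proc a) (proc b)) as [[Hp | Hp] | Hp]; auto; try lia.
  - exfalso. nia.
Qed.

Lemma key_bound M j : proc j < M -> weight j < M -> due j < M -> key M j < M * M * M.
Proof.
  intros. unfold key. assert (due j * M + proc j + 1 <= M * M) by nia. nia.
Qed.

(** * Binary radix sort of the keys *)

Section Radix.

Definition bit (q v a : nat) : bool := a / q mod 2 =? v.

Definition by_low (q a b : nat) : Prop := a mod q <= b mod q.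

Lemma sorted_filter (R R' : nat -> nat -> Prop) f l :
  (forall a b, f a = true -> f b = true -> R a b -> R' a b) ->
  StronglySorted R l -> StronglySorted R' (filter f l).
Proof.
  intros H. induction 1 as [| a l Hl IH Ha]; simpl; [constructor |].
  destruct (f a) eqn:E; auto. constructor; auto.
  rewrite Forall_forall in *. intros b Hb. apply filter_In in Hb as [Hb1 Hb2]. auto.
Qed.

Lemma sorted_app (R : nat -> nat -> Prop) l1 l2 :
  StronglySorted R l1 -> StronglySorted R l2 ->
  (forall a b, In a l1 -> In b l2 -> R a b) -> StronglySorted R (l1 ++ l2).
Proof.
  induction 1 as [| a l Hl IH Ha]; simpl; intros H2 H; auto.
  constructor; auto. rewrite Forall_app. split; auto. apply Forall_forall. auto.
Qed.

Lemma sorted_trivial l : StronglySorted (by_low 1) l.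
Proof.
  induction l; constructor; auto. apply Forall_forall. intros. unfold by_low.
  now rewrite !Nat.mod_1_r.
Qed.

(** Filters keep the old order within each bucket, and the new bit is the leading digit modulo
    [q + q]. *)
Lemma pass_sorted q l : q <> 0 -> StronglySorted (by_low q) l ->
  StronglySorted (by_low (q + q)) (filter (bit q 0) l ++ filter (bit q 1) l).
Proof.
  intros Hq H.
  assert (E : forall a, a mod (q + q) = a mod q + q * ((a / q) mod 2)).
  { intros a. replace (q + q) with (q * 2) by lia. apply Nat.Div0.mod_mul_r. }
  apply sorted_app.
  - eapply sorted_filter; [| exact H]. unfold bit, by_low. intros a b Ha Hb Hab.
    apply Nat.eqb_eq in Ha, Hb. rewrite !E, Ha, Hb. lia.
  - eapply sorted_filter; [| exact H]. unfold bit, by_low. intros a b Ha Hb Hab.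
    apply Nat.eqb_eq in Ha, Hb. rewrite !E, Ha, Hb. lia.
  - intros a b Ha Hb. apply filter_In in Ha as [_ Ha], Hb as [_ Hb]. unfold bit, by_low in *.
    apply Nat.eqb_eq in Ha, Hb. rewrite !E, Ha, Hb.
    pose proof (Nat.mod_upper_bound a q Hq). lia.
Qed.

Lemma pass_perm q l : Permutation l (filter (bit q 0) l ++ filter (bit q 1) l).
Proof.
  symmetry. rewrite <- (filter_split (bit q 0) l) at 3. apply Permutation_app_head.
  erewrite filter_ext; [reflexivity |]. intros a. unfold bit.
  pose proof (Nat.mod_upper_bound (a / q) 2 ltac:(lia)).
  destruct (a / q mod 2) as [| [| ?]]; auto; lia.
Qed.

Lemma sorted_nth (R : nat -> nat -> Prop) l : StronglySorted R l ->
  forall i j, i < j < length l -> R (nth i l 0) (nth j l 0).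
Proof.
  induction 1 as [| a l Hl IH Ha]; simpl; intros i j Hij; [lia |].
  destruct j as [| j]; [lia |]. destruct i as [| i].
  - rewrite Forall_forall in Ha. apply Ha, nth_In. lia.
  - apply IH. lia.
Qed.

End Radix.

Definition arr (s : st) (k : nat) (l : list nat) : Prop :=
  forall j, j < length l -> ar s k j = nth j l 0.

Lemma arr_snoc s k l v i : arr s k l -> i = length l -> arr (seta s k i v) k (l ++ [v]).
Proof.
  intros H -> j Hj. rewrite length_app in Hj. cbn [length] in Hj. cbn [ar seta].
  rewrite Nat.eqb_refl. destruct (Nat.eqb_spec j (length l)) as [-> | Hne].
  - now rewrite nth_middle.
  - rewrite app_nth1 by lia. apply H. lia.
Qed.

Lemma arr_ext s s' k l : (forall i, ar s' k i = ar s k i) -> arr s k l -> arr s' k l.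
Proof. intros H H' j Hj. rewrite H. auto. Qed.

Lemma firstn_snoc {A} (a0 : A) l i : i < length l -> firstn (S i) l = firstn i l ++ [nth i l a0].
Proof.
  revert i. induction l; simpl; intros i Hi; [lia |]. destruct i; simpl; auto.
  f_equal. apply IHl. lia.
Qed.

(** * The program that reads and sorts the jobs *)

Open Scope prog_scope.

(** With truncated subtraction, [a + (b - a)] is a maximum and, in later programs, [a - (a - b)] a
    minimum. Register 6 receives the base of the keys. *)
Definition stats : cmd :=
  2 ::= #0;; 3 ::= #0;; 4 ::= #0;; 5 ::= #0;; 9 ::= #0;;
  FOR 9 UPTO !1 DO
    10 ::= #3 * !9;;
    11 ::= 0@[!10 + #1];; 12 ::= 0@[!10 + #2];; 13 ::= 0@[!10 + #3];;
    3 ::= !3 + (!11 - !3);; 4 ::= !4 + (!12 - !4);; 2 ::= !2 + (!13 - !2);;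
    5 ::= !5 + !12
  OD;;
  6 ::= !2 + !3 + !4 + #1.

Definition keys : cmd :=
  9 ::= #0;;
  FOR 9 UPTO !1 DO
    10 ::= #3 * !9;;
    1@@[!9] ::= (0@[!10 + #3] * !6 + 0@[!10 + #1]) * !6 + (!6 - #1 - 0@[!10 + #2])
  OD.

Definition select (v : nat) : cmd :=
  9 ::= #0;;
  FOR 9 UPTO !1 DO
    10 ::= 1@[!9];;
    IF (!10 / !8) mod #2 == #v THEN 2@@[!11] ::= !10;; 11 ::= !11 + #1 FI
  OD.

Definition copy_back : cmd :=
  9 ::= #0;; FOR 9 UPTO !1 DO 1@@[!9] ::= 2@[!9] OD.

Definition radix : cmd :=
  7 ::= !6 * !6 * !6;; 8 ::= #1;;
  WHILE !8 < !7 DO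
    11 ::= #0;; select 0;; select 1;; copy_back;; 8 ::= !8 + !8
  OD.

Definition decode : cmd :=
  9 ::= #0;;
  FOR 9 UPTO !1 DO
    10 ::= 1@[!9];;
    3@@[!9] ::= (!10 / !6) mod !6;;
    4@@[!9] ::= !6 - #1 - !10 mod !6;;
    5@@[!9] ::= !10 / !6 / !6
  OD.

Definition front : cmd := stats;; keys;; radix;; decode.

Close Scope prog_scope.

Lemma fields_bound J j : pj J j <= pmax J /\ wj J j <= wmax J /\ dj J j <= dmax J.
Proof. exact (job_bounds J j). Qed.

Lemma total_bound J : total J <= length J * wmax J.
Proof.
  enough (H : forall l, (forall a, In a l -> weight a <= wmax J) -> total l <= length l * wmax J).
  { apply H. intros a Ha. apply list_max_ge, in_map, Ha. }
  induction l as [| a l IH]; intros H; [reflexivity |].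
  unfold total in *. simpl. specialize (H a (or_introl eq_refl)) as H1.
  specialize (IH (fun b Hb => H b (or_intror Hb))). lia.
Qed.

Section Front.

Variables (J : list job) (B : nat).
Let n := length J.
Let N := inputN J.
Hypothesis J_ne : J <> [].
Hypothesis big : N ^ 16 <= B.

Lemma n_pos : 1 <= n.
Proof. unfold n. destruct J; [congruence | simpl; lia]. Qed.

Lemma N_ge : n + dmax J + pmax J + wmax J + 2 = N.
Proof. reflexivity. Qed.

Lemma B_lin : 1000 * N <= B /\ 1000 * (N * N) <= B /\ 1000 * (N * N * N) <= B /\
  N <= N * N /\ N * N <= N * N * N.
Proof.
  assert (H2 : 2 <= N) by (unfold N, inputN; lia).
  assert (H : 2 ^ 10 * (N * N * N) <= N ^ 16).
  { change 16 with (13 + 3). rewrite Nat.pow_add_r.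
    replace (N ^ 3) with (N * N * N) by (cbn; lia). apply Nat.mul_le_mono_r.
    transitivity (2 ^ 13); [apply Nat.pow_le_mono_r; lia | now apply Nat.pow_le_mono_l]. }
  replace (2 ^ 10) with 1024 in H by reflexivity.
  assert (N <= N * N) by nia. assert (N * N <= N * N * N) by nia. lia.
Qed.

Definition input (s : st) : Prop := forall j, 1 <= j <= 3 * n -> ar s 0 j = encode J j.

Lemma input_fields s j : input s -> j < n ->
  ar s 0 (3 * j + 1) = pj J j /\ ar s 0 (3 * j + 2) = wj J j /\ ar s 0 (3 * j + 3) = dj J j.
Proof.
  intros H Hj. rewrite !H by lia. apply encode_fields. exact Hj.
Qed.

Lemma stats_correct s : rg s 1 = n -> input s ->
  runs B stats s n (fun s' => rg s' 2 = dmax J /\ rg s' 3 = pmax J /\ rg s' 4 = wmax J /\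
    rg s' 5 = total J /\ rg s' 6 = dmax J + pmax J + wmax J + 1).
Proof.
  intros H1 HI. pose proof B_lin as HB. pose proof N_ge as HN.
  unfold stats.
  do 5 (apply runs_asg_seq; [exact I | sx]).
  eapply (runs_seq _ _ _ _ n 0); [lia |].
  apply runs_for with (lo := 0) (hi := n) (T1 := 0)
    (I := fun i s => rg s 2 = list_max (map due (firstn i J)) /\
      rg s 3 = list_max (map proc (firstn i J)) /\ rg s 4 = list_max (map weight (firstn i J)) /\
      rg s 5 = total (firstn i J)); sx; auto; try lia.
  - intros s1 F. split; [exact I |]. sx. rewrite (proj1 F 1 eq_refl). sx. exact H1.
  - intros k s1 Hk F H9 (I2 & I3 & I4 & I5).
    assert (HI1 : input s1) by (intros j Hj; rewrite (proj2 F 0 eq_refl); sx; apply HI; auto).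
    destruct (input_fields s1 k HI1 ltac:(lia)) as (Ep & Ew & Ed).
    destruct (fields_bound J k) as (Bp & Bw & Bd).
    assert (S2 : list_max (map due (firstn (S k) J)) = max (list_max (map due (firstn k J))) (dj J k)).
    { rewrite (firstn_snoc job0), map_app, list_max_app by lia. simpl. fold (dj J k). lia. }
    assert (S3 : list_max (map proc (firstn (S k) J)) = max (list_max (map proc (firstn k J))) (pj J k)).
    { rewrite (firstn_snoc job0), map_app, list_max_app by lia. simpl. fold (pj J k). lia. }
    assert (S4 : list_max (map weight (firstn (S k) J)) = max (list_max (map weight (firstn k J))) (wj J k)).
    { rewrite (firstn_snoc job0), map_app, list_max_app by lia. simpl. fold (wj J k). lia. }
    assert (S5 : total (firstn (S k) J) = total (firstn k J) + wj J k).
    { unfold total. rewrite (firstn_snoc job0), map_app, list_sum_app by lia. simpl. fold (wj J k). lia. }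
    assert (M : forall f, list_max (map f (firstn k J)) <= list_max (map f J)).
    { intros f. rewrite <- (firstn_skipn k J) at 2. rewrite map_app, list_max_app. lia. }
    pose proof (M due) as M2. pose proof (M proc) as M3. pose proof (M weight) as M4.
    fold (dmax J) in M2. fold (pmax J) in M3. fold (wmax J) in M4.
    assert (M5 : total (firstn (S k) J) <= N * N).
    { transitivity (total J).
      - unfold total. rewrite <- (firstn_skipn (S k) J) at 2. rewrite map_app, list_sum_app. lia.
      - pose proof (total_bound J) as Q. fold n in Q. nia. }
    apply runs_asg_seq; [okx; lia | sx].
    do 3 (apply runs_asg_seq; [okx; rewrite ?H9; repeat split; auto; lia | sx]).
    rewrite H9, Ep, Ew, Ed.
    do 3 (apply runs_asg_seq; [okx; subregs; repeat split; auto; lia | sx]).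
    apply runs_asg; [okx; subregs; repeat split; auto; lia | sx]. subregs.
    repeat split; auto; lia.
  - intros s1 F H9 (I2 & I3 & I4 & I5) _. unfold n in *. rewrite firstn_all in *.
    apply runs_asg; [okx; subregs; repeat split; auto; unfold dmax, pmax, wmax in *; lia | sx]. subregs. auto.
Qed.

Let M := dmax J + pmax J + wmax J + 1.

Lemma M_le : M * M * M <= N * N * N /\ M * M <= N * N /\ M <= N /\ 1 <= M.
Proof.
  pose proof N_ge. assert (HM : M <= N) by (unfold M; lia).
  repeat split; try (unfold M; lia); repeat apply Nat.mul_le_mono; auto.
Qed.

Lemma fields_lt j : pj J j < M /\ wj J j < M /\ dj J j < M.
Proof. pose proof (fields_bound J j). unfold M. lia. Qed.

Lemma keys_correct s : rg s 1 = n -> rg s 6 = M -> input s ->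
  runs B keys s n (fun s' => arr s' 1 (map (key M) J)).
Proof.
  intros H1 H6 HI. pose proof B_lin as HB. pose proof M_le as HM. pose proof N_ge as HN.
  unfold keys. apply runs_asg_seq; [exact I | sx].
  apply runs_for with (lo := 0) (hi := n) (T1 := 0)
    (I := fun i s => forall j, j < i -> ar s 1 j = key M (nth j J job0)); sx; auto; try lia.
  - intros s1 F. split; [exact I |]. sx. rewrite (proj1 F 1 eq_refl). sx. exact H1.
  - intros k s1 Hk F H9 HA.
    assert (HI1 : input s1) by (intros j Hj; rewrite (proj2 F 0 eq_refl); sx; apply HI; auto).
    assert (K6 : rg s1 6 = M) by (rewrite (proj1 F 6 eq_refl); sx; exact H6).
    destruct (input_fields s1 k HI1 ltac:(lia)) as (Ep & Ew & Ed).
    destruct (fields_lt k) as (Bp & Bw & Bd).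
    assert (X1 : dj J k * M + pj J k < M * M) by nia.
    assert (X2 : (dj J k * M + pj J k) * M + (M - 1 - wj J k) < M * M * M).
    { exact (key_bound M (nth k J job0) Bp Bw Bd). }
    clear F.
    apply runs_asg_seq; [okx; rewrite H9; repeat split; auto; lia | sx].
    apply runs_sto; [okx; rewrite H9, K6, ?Ed, ?Ep; repeat split; auto; lia | sx].
    rewrite H9, K6, Ep, Ew, Ed. split; auto.
    intros j Hj. destruct (Nat.eqb_spec j k) as [-> | Hne]; [reflexivity |].
    apply HA. lia.
  - intros s1 _ _ HA j Hj. rewrite length_map in Hj. rewrite HA by auto.
    rewrite nth_indep with (d' := key M job0) by now rewrite length_map.
    symmetry. apply map_nth.
Qed.

Lemma select_correct v s l l0 q :
  length l = n -> length l0 <= n -> v < 100 -> q <> 0 ->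
  rg s 1 = n -> rg s 8 = q -> arr s 1 l -> arr s 2 l0 -> rg s 11 = length l0 ->
  runs B (select v) s n (fun s' =>
    arr s' 2 (l0 ++ filter (bit q v) l) /\ rg s' 11 = length (l0 ++ filter (bit q v) l)).
Proof.
  intros Hl Hl0 Hv Hq H1 H8 HA H2 H11. pose proof B_lin as HB. pose proof N_ge as HN.
  unfold select. apply runs_asg_seq; [exact I | sx].
  apply runs_for with (lo := 0) (hi := n) (T1 := 0)
    (I := fun i s => arr s 2 (l0 ++ filter (bit q v) (firstn i l)) /\
       rg s 11 = length (l0 ++ filter (bit q v) (firstn i l))); sx; auto; try lia.
  - rewrite app_nil_r. auto.
  - intros s1 F. split; [exact I |]. sx. rewrite (proj1 F 1 eq_refl). sx. exact H1.
  - intros k s1 Hk F H9 (HT & K11).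
    assert (K8 : rg s1 8 = q) by (rewrite (proj1 F 8 eq_refl); sx; exact H8).
    assert (KA : ar s1 1 k = nth k l 0) by (rewrite (proj2 F 1 eq_refl); sx; apply HA; lia).
    assert (Hlen : length (l0 ++ filter (bit q v) (firstn k l)) <= n + k).
    { rewrite length_app. pose proof (filter_length_le (bit q v) (firstn k l)) as Q.
      pose proof (firstn_le_length k l). rewrite length_firstn in Q. lia. }
    rewrite (firstn_snoc 0), filter_app, app_assoc by lia. simpl filter.
    apply runs_asg_seq; [okx; rewrite H9; repeat split; auto; lia | sx].
    rewrite H9, KA. unfold bit at 2 4. clear F.
    apply runs_if; [okx; auto | |]; sx; rewrite K8; intros Hb.
    + destruct (nth k l 0 / q mod 2 =? v); [| lia].
      apply runs_sto_seq; [okx; rewrite K11; repeat split; auto; lia | sx].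
      rewrite K11. apply runs_asg; [okx; rewrite K11; repeat split; auto; lia | sx].
      split; auto. split.
      * eapply arr_ext; [| apply (arr_snoc s1 2 _ (nth k l 0) _ HT eq_refl)]. intros j. reflexivity.
      * rewrite K11, !length_app. simpl. lia.
    + destruct (nth k l 0 / q mod 2 =? v); [lia |].
      apply runs_skip. sx. rewrite app_nil_r. auto.
  - intros s1 _ _ (HT & K11). rewrite <- Hl, firstn_all in *. auto.
Qed.

Lemma copy_back_correct s l : length l = n -> rg s 1 = n -> arr s 2 l ->
  runs B copy_back s n (fun s' => arr s' 1 l).
Proof.
  intros Hl H1 HA. pose proof B_lin as HB. pose proof N_ge as HN.
  unfold copy_back. apply runs_asg_seq; [exact I | sx].
  apply runs_for with (lo := 0) (hi := n) (T1 := 0)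
    (I := fun i s => forall j, j < i -> ar s 1 j = nth j l 0); sx; auto; try lia.
  - intros s1 F. split; [exact I |]. sx. rewrite (proj1 F 1 eq_refl). sx. exact H1.
  - intros k s1 Hk F H9 HT.
    assert (KA : ar s1 2 k = nth k l 0) by (rewrite (proj2 F 2 eq_refl); sx; apply HA; lia).
    clear F. apply runs_sto; [okx; rewrite H9; repeat split; auto; lia | sx].
    rewrite H9, KA. split; auto.
    intros j Hj. destruct (Nat.eqb_spec j k) as [-> | Hne]; [reflexivity |].
    apply HT. lia.
  - intros s1 _ _ HT j Hj. apply HT. lia.
Qed.

Let L3 := 3 * logN J.

Lemma M3_log : M * M * M < 2 ^ L3.
Proof.
  assert (H : M < 2 ^ logN J).
  { eapply Nat.lt_trans with N; [unfold M, N, inputN; lia |].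
    unfold logN. rewrite Nat.add_1_r. apply Nat.log2_spec. unfold N, inputN. lia. }
  unfold L3. rewrite (Nat.mul_comm 3), Nat.pow_mul_r. cbn [Nat.pow]. rewrite Nat.mul_1_r.
  rewrite (Nat.mul_assoc (2 ^ _)). now repeat apply Nat.mul_lt_mono.
Qed.

(** Keys are below [2 ^ L3] by [M3_log], so at most [L3] passes of three linear loops are made. Once
    [2 ^ b] exceeds all keys, the order modulo [2 ^ b] is the usual one. *)
Lemma radix_correct s l : rg s 1 = n -> rg s 6 = M -> length l = n ->
  (forall a, In a l -> a < M * M * M) -> arr s 1 l ->
  runs B radix s (L3 * (3 * n + 1)) (fun s' => exists l',
    Permutation l l' /\ StronglySorted le l' /\ arr s' 1 l').
Proof.
  intros H1 H6 Hl Hb HA. pose proof B_lin as HB. pose proof M_le as HM. pose proof N_ge as HN.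
  unfold radix. apply runs_asg_seq; [okx; subregs; repeat split; auto; lia | sx].
  apply runs_asg_seq; [exact I | sx]. rewrite H6.
  apply runs_while with (I := fun c s => exists b l', rg s 8 = 2 ^ b /\ b <= L3 /\
    c = (L3 - b) * (3 * n + 1) /\ Permutation l l' /\ StronglySorted (by_low (2 ^ b)) l' /\ arr s 1 l').
  { exists 0, l. sx. rewrite Nat.sub_0_r. repeat split; auto; try lia. apply sorted_trivial. }
  intros c s1 F (b & l' & K8 & Hb3 & -> & HP & HS & HA1).
  assert (K1 : rg s1 1 = n) by (rewrite (proj1 F 1 eq_refl); sx; exact H1).
  assert (K7 : rg s1 7 = M * M * M) by (rewrite (proj1 F 7 eq_refl); reflexivity).
  assert (Hl' : length l' = n) by (rewrite <- (Permutation_length HP); exact Hl).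
  clear F.
  split; [okx; auto |]. sx. rewrite K7, K8.
  destruct (Nat.ltb_spec (2 ^ b) (M * M * M)) as [Hlt | Hge]; (split; [intros Hc | intros Hc]); try lia.
  - assert (Hb' : b < L3).
    { pose proof M3_log. destruct (le_lt_dec L3 b); auto.
      pose proof (Nat.pow_le_mono_r 2 L3 b ltac:(lia) l0). lia. }
    pose proof (Nat.pow_nonzero 2 b ltac:(lia)) as Hq.
    exists (3 * n).
    apply runs_asg_seq; [exact I | sx].
    apply runs_seq with (T1 := n) (T2 := 2 * n); [lia |].
    eapply runs_weaken;
      [apply (select_correct 0 _ l' [] (2 ^ b)); sx; auto; try lia; [cbn; lia | intros j Hj; cbn in Hj; lia] | lia |].
    intros s2 F2 (T2 & C2) _.
    assert (G1 : rg s2 1 = n) by (rewrite (proj1 F2 1 eq_refl); sx; auto).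
    assert (G8 : rg s2 8 = 2 ^ b) by (rewrite (proj1 F2 8 eq_refl); sx; auto).
    assert (GA : arr s2 1 l') by (eapply arr_ext; [| exact HA1]; intros; rewrite (proj2 F2 1 eq_refl); auto).
    apply runs_seq with (T1 := n) (T2 := n); [lia |].
    eapply runs_weaken; [apply (select_correct 1 _ l' (filter (bit (2 ^ b) 0) l') (2 ^ b)); auto; try lia | lia |].
    { pose proof (filter_length_le (bit (2 ^ b) 0) l'). lia. }
    intros s3 F3 (T3 & C3) _.
    assert (E1 : rg s3 1 = n) by (rewrite (proj1 F3 1 eq_refl); auto).
    assert (E8 : rg s3 8 = 2 ^ b) by (rewrite (proj1 F3 8 eq_refl); auto).
    pose proof (pass_perm (2 ^ b) l') as HP'.
    set (l2 := filter (bit (2 ^ b) 0) l' ++ filter (bit (2 ^ b) 1) l') in *.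
    apply runs_seq with (T1 := n) (T2 := 0); [lia |].
    eapply runs_weaken; [apply (copy_back_correct s3 l2); auto | lia |].
    { rewrite <- (Permutation_length HP'). exact Hl'. }
    intros s4 F4 HA4 _.
    assert (D8 : rg s4 8 = 2 ^ b) by (rewrite (proj1 F4 8 eq_refl); auto).
    apply runs_asg; [okx; subregs; repeat split; auto; lia | sx]. rewrite D8.
    exists ((L3 - S b) * (3 * n + 1)). split.
    { replace (L3 - b) with (S (L3 - S b)) by lia. lia. }
    exists (S b), l2. sx. repeat split; auto; try lia.
    + cbn. lia.
    + now rewrite HP.
    + replace (2 ^ S b) with (2 ^ b + 2 ^ b) by (cbn; lia). now apply pass_sorted.
  - exists l'. repeat split; auto.
    assert (Hin : forall a, In a l' -> a mod 2 ^ b = a).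
    { intros a Ha. apply Nat.mod_small. eapply Nat.lt_le_trans; [apply Hb | exact Hge].
      eapply Permutation_in; [symmetry; exact HP | exact Ha]. }
    clear - HS Hin. induction HS as [| a l Hl IH Ha]; constructor.
    + apply IH. intros; apply Hin; now right.
    + rewrite Forall_forall in *. intros x Hx. specialize (Ha x Hx). unfold by_low in Ha.
      rewrite !Hin in Ha; auto; [now right | now left].
Qed.

Lemma decode_correct s l : rg s 1 = n -> rg s 6 = M -> length l = n -> arr s 1 l ->
  runs B decode s n (fun s' => forall j, j < n ->
    ar s' 3 j = pj (map (unkey M) l) j /\ ar s' 4 j = wj (map (unkey M) l) j /\
    ar s' 5 j = dj (map (unkey M) l) j).
Proof.
  intros H1 H6 Hl HA. pose proof B_lin as HB. pose proof N_ge as HN.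
  unfold decode. apply runs_asg_seq; [exact I | sx].
  apply runs_for with (lo := 0) (hi := n) (T1 := 0)
    (I := fun i s => forall j, j < i -> ar s 3 j = proc (unkey M (nth j l 0)) /\
       ar s 4 j = weight (unkey M (nth j l 0)) /\ ar s 5 j = due (unkey M (nth j l 0)));
    sx; auto; try lia.
  - intros s1 F. split; [exact I |]. sx. rewrite (proj1 F 1 eq_refl). sx. exact H1.
  - intros k s1 Hk F H9 HT.
    assert (KA : ar s1 1 k = nth k l 0) by (rewrite (proj2 F 1 eq_refl); sx; apply HA; lia).
    assert (K6 : rg s1 6 = M) by (rewrite (proj1 F 6 eq_refl); sx; exact H6).
    clear F.
    apply runs_asg_seq; [okx; rewrite H9; repeat split; auto; lia | sx]. rewrite H9, KA.
    do 2 (apply runs_sto_seq; [okx; rewrite H9; repeat split; auto; lia | sx]).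
    apply runs_sto; [okx; rewrite H9; repeat split; auto; lia | sx].
    rewrite H9, K6. split; auto.
    intros j Hj. destruct (Nat.eqb_spec j k) as [-> | Hne]; [auto |].
    apply HT. lia.
  - intros s1 _ _ HT j Hj. destruct (HT j Hj) as (E3 & E4 & E5). unfold pj, wj, dj.
    rewrite (nth_indep _ job0 (unkey M 0)) by now rewrite length_map, Hl.
    rewrite map_nth. auto.
Qed.

Definition sorted_jobs (L : list job) : Prop :=
  Permutation J L /\ forall i j, i < j < n ->
    dj L i < dj L j \/ dj L i = dj L j /\
      (pj L i < pj L j \/ pj L i = pj L j /\ wj L j <= wj L i).

Theorem front_correct s : rg s 1 = n -> input s ->
  runs B front s (3 * n + L3 * (3 * n + 1)) (fun s' =>
    rg s' 1 = n /\ rg s' 2 = dmax J /\ rg s' 3 = pmax J /\ rg s' 4 = wmax J /\ rg s' 5 = total J /\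
    exists L, sorted_jobs L /\ forall j, j < n ->
      ar s' 3 j = pj L j /\ ar s' 4 j = wj L j /\ ar s' 5 j = dj L j).
Proof.
  intros H1 HI. unfold front.
  apply runs_seq with (T1 := n) (T2 := 2 * n + L3 * (3 * n + 1)); [lia |].
  eapply runs_weaken; [apply stats_correct; auto | lia |].
  intros s1 F1 (D1 & P1 & W1 & T1 & M1) _.
  assert (A1 : rg s1 1 = n) by (rewrite (proj1 F1 1 eq_refl); auto).
  assert (AI : input s1) by (intros j Hj; rewrite (proj2 F1 0 eq_refl); apply HI; auto).
  apply runs_seq with (T1 := n) (T2 := n + L3 * (3 * n + 1)); [lia |].
  eapply runs_weaken; [apply keys_correct; auto | lia |].
  intros s2 F2 K2 _. carry F2.
  apply runs_seq with (T1 := L3 * (3 * n + 1)) (T2 := n); [lia |].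
  assert (KB : forall a, In a (map (key M) J) -> a < M * M * M).
  { intros a Ha. apply in_map_iff in Ha as (b & <- & Hb).
    apply In_nth with (d := job0) in Hb as (j & Hj & <-). apply key_bound; apply (fields_lt j). }
  eapply runs_weaken; [apply (radix_correct s2 (map (key M) J)); auto; apply length_map | lia |].
  intros s3 F3 (l & HP & HS & HA3) _. carry F3.
  assert (Hl : length l = n) by (rewrite <- (Permutation_length HP); apply length_map).
  eapply runs_weaken; [apply (decode_correct s3 l); auto | lia |].
  intros s4 F4 HD. carry F4. repeat split; auto.
  exists (map (unkey M) l). split; auto.
  assert (HJ : map (unkey M) (map (key M) J) = J).
  { rewrite map_map. rewrite <- (map_id J) at 2. apply map_ext_in. intros a Ha.
    apply In_nth with (d := job0) in Ha as (j & Hj & <-). apply unkey_key; apply (fields_lt j). }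
  assert (HPJ : Permutation J (map (unkey M) l)).
  { rewrite <- HJ at 1. now apply Permutation_map. }
  split; auto. intros i j Hij.
  assert (Hk : forall i, i < n -> nth i l 0 = key M (nth i (map (unkey M) l) job0) /\
    pj (map (unkey M) l) i < M /\ wj (map (unkey M) l) i < M).
  { intros k Hk. assert (Hin : In (nth k l 0) (map (key M) J)).
    { eapply Permutation_in; [symmetry; exact HP |]. apply nth_In. lia. }
    apply in_map_iff in Hin as (b & Eb & Hb).
    apply In_nth with (d := job0) in Hb as (k' & Hk' & Eb').
    pose proof (fields_lt k') as Q. unfold pj, wj, dj in *. rewrite Eb' in Q.
    assert (EU : nth k (map (unkey M) l) job0 = b).
    { rewrite (nth_indep _ job0 (unkey M 0)) by (rewrite length_map; lia).
      rewrite map_nth, <- Eb. apply unkey_key; tauto. }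
    rewrite EU. repeat split; try tauto. now rewrite Eb. }
  destruct (Hk i ltac:(lia)) as (E1 & ? & ?). destruct (Hk j ltac:(lia)) as (E2 & ? & ?).
  apply key_lex with (M := M); auto. rewrite <- E1, <- E2. apply sorted_nth; auto. lia.
Qed.

End Front.

(** * The Lawler-Moore dynamic program *)

(** Jobs become functions of an index with common bounds, so that the program proofs mention neither
    lists nor sorting. [bound] stands for [inputN] and [gross] for the total weight. *)
Record instance := Instance {
  size : nat ; bound : nat ; deadline : nat ; heaviest : nat ; gross : nat ;
  time_of : nat -> nat ; value_of : nat -> nat ; due_of : nat -> nat
}.

Record fits_word (X : instance) (B : nat) : Prop := {
  word_big : 1000 * (bound X * bound X * bound X) <= B ;
  bound_ge : 2 <= bound X ;
  size_pos : 1 <= size X ;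
  size_lt : size X < bound X ;
  deadline_lt : deadline X < bound X ;
  heaviest_lt : heaviest X < bound X ;
  time_lt : forall j, j < size X -> time_of X j < bound X ;
  value_le : forall j, j < size X -> value_of X j <= heaviest X ;
  due_le : forall j, j < size X -> due_of X j <= deadline X ;
  due_mono : forall i j, i <= j < size X -> due_of X i <= due_of X j
}.

Definition loaded (X : instance) (s : st) : Prop :=
  (rg s 1 = size X /\ rg s 2 = deadline X /\ rg s 4 = heaviest X /\ rg s 5 = gross X) /\
  forall j, j < size X ->
    ar s 3 j = time_of X j /\ ar s 4 j = value_of X j /\ ar s 5 j = due_of X j.

(** Register 3, which held the largest processing time, is left out: [by_runs] reuses it as an
    accumulator. *)
Definition keeps (c : cmd) : bool :=
  negb (wrr c 1 || wrr c 2 || wrr c 4 || wrr c 5 || wra c 3 || wra c 4 || wra c 5).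

Lemma loaded_frame X c s s' : keeps c = true -> frame c s s' -> loaded X s -> loaded X s'.
Proof.
  unfold keeps. rewrite negb_true_iff, !orb_false_iff. intros H [F1 F2] [HR HA].
  split.
  - rewrite !F1 by tauto. exact HR.
  - intros j Hj. rewrite !F2 by tauto. auto.
Qed.

Ltac keep_loaded F :=
  match type of F with
  | frame ?c ?s ?s' =>
      match goal with
      | H : loaded ?X s |- _ =>
          let K := fresh "K" in
          assert (K : loaded X s') by (apply (loaded_frame X c s s'); [reflexivity | exact F | exact H]);
          clear F; rename K into F
      end
  end.

Lemma best_bound p w d n c : (forall j, j < n -> w j <= c) -> forall t, best p w d n t <= n * c.
Proof.
  induction n; intros H t; simpl; [lia |].
  specialize (IHn ltac:(intros; apply H; lia)) as IH. pose proof (IH t).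
  pose proof (IH (min t (d n) - p n)). specialize (H n ltac:(lia)).
  destruct (p n <=? min t (d n)); lia.
Qed.

Open Scope prog_scope.

(** One row is updated in place. The time descends, so every entry read has an index not yet
    overwritten and still belongs to the previous row. *)
Definition lawler_moore : cmd :=
  9 ::= #0;;
  FOR 9 UPTO !2 + #1 DO 6@@[!9] ::= #0 OD;;
  9 ::= #0;;
  FOR 9 UPTO !1 DO
    10 ::= 3@[!9];; 11 ::= 4@[!9];; 12 ::= 5@[!9];; 13 ::= !2 + #1;;
    WHILE #0 < !13 DO
      13 ::= !13 - #1;;
      14 ::= !13 - (!13 - !12);;
      IF !14 < !10 THEN Skip ELSE
        15 ::= 6@[!14 - !10] + !11;;
        IF 6@[!13] < !15 THEN 6@@[!13] ::= !15 FI
      FI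
    OD
  OD;;
  0 ::= !5 - 6@[!2].

Close Scope prog_scope.

Section LawlerMoore.

Variables (X : instance) (B : nat).
Hypothesis fw : fits_word X B.
Local Notation n := (size X).
Local Notation N := (bound X).
Local Notation D := (deadline X).
Local Notation p := (time_of X).
Local Notation w := (value_of X).
Local Notation d := (due_of X).
Local Notation opt := (best p w d).

Lemma word_facts : 1000 * N <= B /\ 1000 * (N * N) <= B /\ N <= N * N /\ n < N /\ D < N /\
  heaviest X < N /\ 1 <= n /\ n * heaviest X + heaviest X <= N * N.
Proof.
  destruct fw.
  assert (N <= N * N) by nia. assert (N * N <= N * N * N) by nia.
  assert (n * heaviest X + heaviest X <= N * N) by nia. lia.
Qed.

Lemma opt_bound k t : k <= n -> opt k t <= n * heaviest X.
Proof.
  intros Hk. pose proof (best_bound p w d k (heaviest X)) as H.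
  specialize (H ltac:(intros j Hj; apply (value_le _ _ fw); lia) t). nia.
Qed.

Lemma lawler_moore_correct s : loaded X s ->
  runs B lawler_moore s (D + 1 + n * (D + 2)) (fun s' => rg s' 0 = gross X - opt n D).
Proof.
  intros HL. pose proof word_facts as HB.
  unfold lawler_moore. apply runs_asg_seq; [okx; auto | sx].
  assert (HL1 : loaded X (setr s 9 0)) by exact HL.
  set (s1 := setr s 9 0) in *. assert (K9 : rg s1 9 = 0) by reflexivity. clearbody s1.
  apply runs_seq with (T1 := D + 1) (T2 := n * (D + 2)); [lia |].
  apply runs_for with (lo := 0) (hi := D + 1) (T1 := 0)
    (I := fun i s => forall t, t < i -> ar s 6 t = 0); auto; try lia.
  { intros s2 F. keep_loaded F. destruct F as [(? & E & _) _].
    okx. rewrite E. repeat split; auto; lia. }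
  { intros k s2 Hk F E9 HA. apply runs_sto; [okx; rewrite E9; repeat split; auto; lia | sx].
    rewrite E9. split; auto. intros t Ht. destruct (Nat.eqb_spec t k); auto. apply HA. lia. }
  intros s2 F _ HA F'. clear F'. keep_loaded F.
  apply runs_asg_seq; [okx; auto | sx].
  assert (HL2 : loaded X (setr s2 9 0)) by exact F.
  assert (HA2 : forall t, t < D + 1 -> ar (setr s2 9 0) 6 t = 0) by exact HA.
  set (s3 := setr s2 9 0) in *. assert (K3 : rg s3 9 = 0) by reflexivity. clearbody s3.
  apply runs_seq with (T1 := n * (D + 2)) (T2 := 0); [lia |].
  apply runs_for with (lo := 0) (hi := n) (T1 := D + 1)
    (I := fun i s => forall t, t <= D -> ar s 6 t = opt i t); auto; try lia.
  { intros t Ht. apply HA2. lia. }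
  { intros s4 G. keep_loaded G. split; [exact I | apply G]. }
  { intros k s4 Hk G E9 HI. keep_loaded G.
    destruct G as [(E1 & E2 & E4 & E5) GA]. destruct (GA k ltac:(lia)) as (Ep & Ew & Ed).
    pose proof (time_lt _ _ fw k ltac:(lia)) as Bp. pose proof (value_le _ _ fw k ltac:(lia)) as Bw.
    pose proof (due_le _ _ fw k ltac:(lia)) as Bd.
    do 3 (apply runs_asg_seq; [okx; rewrite E9; repeat split; auto; lia | sx]).
    rewrite E9, Ep, Ew, Ed.
    apply runs_asg_seq; [okx; rewrite E2; repeat split; auto; lia | sx]. rewrite E2.
    set (s5 := setr _ 13 _).
    assert (R9 : rg s5 9 = k) by exact E9. assert (R2 : rg s5 2 = D) by exact E2.
    assert (R10 : rg s5 10 = p k) by reflexivity. assert (R11 : rg s5 11 = w k) by reflexivity.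
    assert (R12 : rg s5 12 = d k) by reflexivity. assert (R13 : rg s5 13 = D + 1) by reflexivity.
    assert (HI5 : forall t, t <= D -> ar s5 6 t = opt k t) by exact HI.
    clearbody s5.
    apply runs_while with (I := fun c s => rg s 13 = c /\ c <= D + 1 /\
      forall t, t <= D -> ar s 6 t = if c <=? t then opt (S k) t else opt k t).
    { rewrite R13. repeat split; auto. intros t Ht. rewrite HI5 by auto.
      destruct (Nat.leb_spec (D + 1) t); auto; lia. }
    intros c s6 F6 (Q13 & Hc & HA6). carry F6. clear F6. split; [okx; auto |]. sx. rewrite Q13.
    destruct (Nat.ltb_spec 0 c) as [Hpos | Hz]; (split; [intros Hq | intros Hq]); try lia.
    - exists 0.
      assert (Fin : forall s', rg s' 13 = c - 1 -> ar s' 6 (c - 1) = opt (S k) (c - 1) ->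
        (forall t, t <= D -> t <> c - 1 -> ar s' 6 t = ar s6 6 t) ->
        exists n', S (n' + 0) <= c /\ rg s' 13 = n' /\ n' <= D + 1 /\
          forall t, t <= D -> ar s' 6 t = if n' <=? t then opt (S k) t else opt k t).
      { intros s' A1 A2 A3. exists (c - 1). repeat split; auto; try lia. intros t Ht.
        destruct (Nat.eq_dec t (c - 1)) as [-> | Hne].
        - now rewrite Nat.leb_refl.
        - rewrite A3, HA6 by auto.
          destruct (Nat.leb_spec c t), (Nat.leb_spec (c - 1) t); auto; lia. }
      assert (Old : ar s6 6 (c - 1) = opt k (c - 1)).
      { rewrite HA6 by lia. destruct (Nat.leb_spec c (c - 1)); auto; lia. }
      apply runs_asg_seq; [okx; auto | sx]. rewrite Q13.
      apply runs_asg_seq; [okx; auto | sx]. rewrite K.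
      assert (Em : c - 1 - (c - 1 - d k) = min (c - 1) (d k)) by lia. rewrite Em.
      assert (Eb : opt (S k) (c - 1) = max (opt k (c - 1))
        (if p k <=? min (c - 1) (d k) then opt k (min (c - 1) (d k) - p k) + w k else 0)) by reflexivity.
      apply runs_if; [okx; auto | |]; sx; rewrite K1; intros Hlt.
      + apply runs_skip. apply Fin; sx; auto. rewrite Old, Eb.
        destruct (Nat.leb_spec (p k) (min (c - 1) (d k))); [| now rewrite Nat.max_0_r].
        destruct (Nat.ltb_spec (min (c - 1) (d k)) (p k)); lia.
      + destruct (Nat.ltb_spec (min (c - 1) (d k)) (p k)) as [? | Hle]; [lia |].
        assert (Rd : ar s6 6 (min (c - 1) (d k) - p k) = opt k (min (c - 1) (d k) - p k)).
        { rewrite HA6 by lia. destruct (Nat.leb_spec c (min (c - 1) (d k) - p k)); auto; lia. }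
        pose proof (opt_bound k (min (c - 1) (d k) - p k) ltac:(lia)) as Bo.
        destruct (Nat.leb_spec (p k) (min (c - 1) (d k))) as [_ |]; [| lia].
        apply runs_asg_seq; [okx; rewrite K1, K0, Rd; repeat split; auto; lia | sx].
        rewrite K1, K0, Rd.
        apply runs_if; [okx; repeat split; auto; lia | |]; sx; rewrite Old; intros Hb.
        * destruct (Nat.ltb_spec (opt k (c - 1)) (opt k (min (c - 1) (d k) - p k) + w k)); [| lia].
          apply runs_sto; [okx; repeat split; auto; lia |].
          apply Fin; sx; auto.
          -- rewrite Nat.eqb_refl. sx. lia.
          -- intros t _ Ht. destruct (Nat.eqb_spec t (c - 1)); [lia | auto].
        * destruct (Nat.ltb_spec (opt k (c - 1)) (opt k (min (c - 1) (d k) - p k) + w k)); [lia |].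
          apply runs_skip. apply Fin; sx; auto. rewrite Old. lia.
    - split; auto. intros t Ht. sx. rewrite HA6 by auto. destruct (Nat.leb_spec c t); auto; lia. }
  intros s4 G _ HI G'. clear G'. keep_loaded G.
  destruct G as [(E1 & E2 & E4 & E5) _].
  apply runs_asg; [okx; rewrite E2; repeat split; auto; lia | sx].
  rewrite E2, E5, HI; auto.
Qed.

End LawlerMoore.

(** * The fractional optimum *)

Definition put (f : nat -> nat) (c v : nat) : nat -> nat :=
  fun j => if j =? c then v else f j.

Lemma sumf_put_out f c v e : e <= c -> sumf (put f c v) e = sumf f e.
Proof.
  intros H. apply sumf_ext. intros j Hj. unfold put. destruct (Nat.eqb_spec j c); [lia | auto].
Qed.

Lemma sumf_put_in f c v e : c < e -> sumf (put f c v) e + f c = sumf f e + v.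
Proof.
  induction e; intros H; [lia |]. cbn [sumf]. destruct (Nat.eq_dec c e) as [-> | Hne].
  - rewrite sumf_put_out by auto. unfold put. rewrite Nat.eqb_refl. lia.
  - specialize (IHe ltac:(lia)). unfold put at 2. destruct (Nat.eqb_spec e c); [lia |]. lia.
Qed.

Section Greedy.

Variables p w d : nat -> nat.

Definition tight_at (r : nat -> nat) (e : nat) : Prop := sumf r e = d (e - 1).

(* State of the greedy algorithm on the first [k] jobs: among the kept parts the job of
   lowest density is cut first, ties being broken towards the larger index. *)
Record kept (r : nat -> nat) (k : nat) : Prop := {
  kept_le : forall j, j < k -> r j <= p j ;
  kept_later : forall a b, b < a < k -> r a < p a -> 0 < r b -> lower p w a b ;
  kept_block : forall a b, a < b < k -> r a < p a -> 0 < r b ->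
    (forall e, a < e <= b -> ~ tight_at r e) -> lower p w a b ;
  kept_fits : forall e, 1 <= e < k -> sumf r e <= d (e - 1)
}.

(** Jobs are cut only because a later prefix overflows, and cutting stops when that prefix is
    exactly full. This makes the total kept time maximal and separates cut jobs from later
    arrivals. *)
Definition settled (r : nat -> nat) (k m : nat) : Prop :=
  forall a, a < k -> r a < p a -> exists e, a < e <= m /\ tight_at r e.

Lemma lower_trans a j b : 0 < p a -> 0 < p j -> 0 < p b -> lower p w a j -> lower p w j b -> lower p w a b.
Proof.
  intros Ha Hj Hb H1 H2. unfold lower in *.
  assert (E1 : w a * p b * p j = w a * p j * p b) by ring.
  assert (E2 : w j * p a * p b = w j * p b * p a) by ring.
  assert (E3 : w b * p a * p j = w b * p j * p a) by ring.
  assert (M1 : w a * p j < w j * p a -> w a * p j * p b < w j * p a * p b)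
    by (intros; apply Nat.mul_lt_mono_pos_r; auto).
  assert (M2 : w j * p b < w b * p j -> w j * p b * p a < w b * p j * p a)
    by (intros; apply Nat.mul_lt_mono_pos_r; auto).
  destruct H1 as [H1 | [H1 L1]], H2 as [H2 | [H2 L2]].
  - left. apply (Nat.mul_lt_mono_pos_r (p j)); auto. specialize (M1 H1). specialize (M2 H2). lia.
  - left. apply (Nat.mul_lt_mono_pos_r (p j)); auto. specialize (M1 H1). rewrite H2 in E2. lia.
  - left. apply (Nat.mul_lt_mono_pos_r (p j)); auto. specialize (M2 H2). rewrite H1 in E1. lia.
  - right. split; [| lia]. apply (Nat.mul_cancel_r _ _ (p j)); [lia |].
    rewrite H1 in E1. rewrite H2 in E2. lia.
Qed.

Lemma kept_nil r : kept r 0.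
Proof. constructor; intros; lia. Qed.

(** The new job is uncut, and [settled] provides a tight prefix between any cut job and it, so no
    new comparison arises. *)
Lemma kept_add r k : kept r k -> (1 <= k -> sumf r k <= d (k - 1)) -> settled r k k ->
  kept (put r k (p k)) (S k) /\ settled (put r k (p k)) (S k) k.
Proof.
  intros [K1 K2 K3 K4] Hk HS.
  assert (P : forall j, j < k -> put r k (p k) j = r j).
  { intros j Hj. unfold put. destruct (Nat.eqb_spec j k); [lia | auto]. }
  assert (Pk : put r k (p k) k = p k) by (unfold put; now rewrite Nat.eqb_refl).
  assert (T : forall e, e <= k -> tight_at (put r k (p k)) e <-> tight_at r e).
  { intros e He. unfold tight_at. rewrite sumf_put_out by auto. reflexivity. }
  split; [constructor |].
  - intros j Hj. destruct (Nat.eq_dec j k) as [-> | Hne]; [lia |]. rewrite P by lia. apply K1. lia.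
  - intros a b Hab Ha Hb. destruct (Nat.eq_dec a k) as [-> | Hne]; [lia |].
    rewrite P in Ha, Hb by lia. apply K2; auto. lia.
  - intros a b Hab Ha Hb HN. rewrite P in Ha by lia.
    destruct (Nat.eq_dec b k) as [-> | Hne].
    + exfalso. destruct (HS a ltac:(lia) Ha) as (e & He & Te). apply (HN e He), T; auto. lia.
    + rewrite P in Hb by lia. apply K3; auto; [lia |]. intros e He Te. apply (HN e He), T; auto. lia.
  - intros e He. rewrite sumf_put_out by lia. destruct (Nat.eq_dec e k) as [-> | Hne].
    + apply Hk. lia.
    + apply K4. lia.
  - intros a Ha Hlt. destruct (Nat.eq_dec a k) as [-> | Hne]; [lia |]. rewrite P in Hlt by lia.
    destruct (HS a ltac:(lia) Hlt) as (e & He & Te). exists e. split; auto. apply T; auto. lia.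
Qed.

(** Prefixes beyond [c] may cease to be tight, which creates new pairs to compare. In such a pair
    the later job lies beyond [c], the earlier one is lower than [c], and [c] is lower than the
    later one by choice; transitivity does the rest. *)
Lemma kept_cut r k c v : kept r k -> c < k -> v < r c ->
  (forall j, j < k -> j <> c -> 0 < r j -> lower p w c j) ->
  kept (put r c v) k.
Proof.
  intros [K1 K2 K3 K4] Hc Hv Hlow.
  assert (P : forall j, j <> c -> put r c v j = r j).
  { intros j Hj. unfold put. destruct (Nat.eqb_spec j c); [lia | auto]. }
  assert (Pc : put r c v c = v) by (unfold put; now rewrite Nat.eqb_refl).
  assert (Pos : forall j, 0 < put r c v j -> 0 < r j).
  { intros j. destruct (Nat.eq_dec j c) as [-> | Hne]; [lia | rewrite P by auto; auto]. }
  pose proof (K1 c Hc) as Hpc.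
  constructor.
  - intros j Hj. destruct (Nat.eq_dec j c) as [-> | Hne]; [lia |]. rewrite P by auto. auto.
  - intros a b Hab Ha Hb. apply Pos in Hb. destruct (Nat.eq_dec a c) as [-> | Hne].
    + apply Hlow; auto; lia.
    + rewrite P in Ha by auto. apply K2; auto.
  - intros a b Hab Ha Hb HN. apply Pos in Hb. destruct (Nat.eq_dec a c) as [-> | Hne].
    { apply Hlow; auto; lia. }
    rewrite P in Ha by auto.
    assert (Keep : forall e, e <= c -> tight_at r e -> tight_at (put r c v) e).
    { intros e He. unfold tight_at. now rewrite sumf_put_out. }
    destruct (le_lt_dec b c) as [Hbc | Hbc].
    { apply K3; auto. intros e He Te. apply (HN e He). apply Keep; auto. lia. }
    assert (Hcb : lower p w c b) by (apply Hlow; auto; lia).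
    assert (0 < p b) by (specialize (K1 b ltac:(lia)); lia).
    apply lower_trans with c; [lia | lia | auto | | exact Hcb].
    destruct (le_lt_dec c a) as [Hca | Hca].
    + apply K2; auto; lia.
    + apply K3; auto; try lia. intros e He Te. apply (HN e ltac:(lia)). apply Keep; auto. lia.
  - intros e He. destruct (le_lt_dec e c) as [Hec | Hec].
    + rewrite sumf_put_out by auto. apply K4; auto.
    + pose proof (sumf_put_in r c v e Hec). specialize (K4 e He). lia.
Qed.

(** Beyond the last tight prefix no job is cut, and up to it the kept parts exhaust the due date.
    Hence no feasible selection uses more time than the fractional solution. *)
Lemma settled_fits r n x : (forall i j, i <= j < n -> d i <= d j) ->
  (forall j, j < n -> r j <= p j) -> settled r n n -> feasible p d x n -> tot p x n <= sumf r n.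
Proof.
  intros Hm Hr HS Hx.
  assert (G : forall k, k <= n -> exists a0, a0 <= k /\ tot p x a0 <= sumf r a0 /\
    forall e, a0 < e <= k -> ~ tight_at r e).
  { induction k; intros Hk.
    - exists 0. cbn. repeat split; auto. lia.
    - destruct (Nat.eq_dec (sumf r (S k)) (d (S k - 1))) as [T | T].
      + exists (S k). split; [lia |]. split; [| intros; lia]. rewrite T, Nat.sub_succ, Nat.sub_0_r.
        apply Hx. lia.
      + destruct IHk as (a0 & ? & ? & HN); [lia |]. exists a0. repeat split; auto.
        intros e He. destruct (Nat.eq_dec e (S k)) as [-> |]; auto. apply HN. lia. }
  destruct (G n (le_n _)) as (a0 & Ha & Hle & HN).
  pose proof (sumf_range (fun j => if x j then p j else 0) r a0 n Ha) as Q.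
  unfold tot in *. enough (sumf (fun j => if x j then p j else 0) n + sumf r a0 <=
    sumf r n + sumf (fun j => if x j then p j else 0) a0) by lia.
  apply Q. intros j Hj. destruct (le_lt_dec (p j) (r j)) as [H | H].
  - destruct (x j); lia.
  - exfalso. destruct (HS j ltac:(lia) H) as (e & He & Te). apply (HN e); auto. lia.
Qed.

End Greedy.

Open Scope prog_scope.

(** The number of jobs in register 17 marks that no candidate has been found yet. In a tie of
    densities the later index wins, as in [lower]. *)
Definition lowest : cmd :=
  17 ::= !1;; 10 ::= #0;;
  FOR 10 UPTO !9 + #1 DO
    IF #0 < 7@[!10] THEN
      IF !17 == !1 THEN 17 ::= !10 ELSE
        IF 4@[!17] * 3@[!10] < 4@[!10] * 3@[!17] THEN Skip ELSE 17 ::= !10 FI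
      FI
    FI
  OD.

(** Register 16 is the total kept time of the jobs up to the current one. Each round either cuts one
    job, by the smaller of the excess and its kept part, or admits the next job. *)
Definition greedy : cmd :=
  9 ::= #0;; 7@@[#0] ::= 3@[#0];; 16 ::= 3@[#0];;
  WHILE !9 < !1 DO
    IF 5@[!9] < !16 THEN
      lowest;;
      18 ::= !16 - 5@[!9];; 19 ::= 7@[!17];; 18 ::= !18 - (!18 - !19);;
      7@@[!17] ::= !19 - !18;; 16 ::= !16 - !18
    ELSE
      9 ::= !9 + #1;;
      IF !9 < !1 THEN 7@@[!9] ::= 3@[!9];; 16 ::= !16 + 3@[!9] FI
    FI
  OD.

Close Scope prog_scope.

Section GreedyProgram.

Variables (X : instance) (B : nat).
Hypothesis fw : fits_word X B.
Local Notation n := (size X).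
Local Notation N := (bound X).
Local Notation D := (deadline X).
Local Notation p := (time_of X).
Local Notation w := (value_of X).
Local Notation d := (due_of X).

Lemma lowest_correct s r i : loaded X s -> i < n -> rg s 9 = i ->
  (forall j, j <= i -> ar s 7 j = r j) -> (forall j, j <= i -> r j <= p j) -> 0 < sumf r (S i) ->
  runs B lowest s (S i) (fun s' => exists c, rg s' 17 = c /\ c <= i /\ 0 < r c /\
    forall j, j <= i -> j <> c -> 0 < r j -> lower p w c j).
Proof.
  intros HL Hi H9 HA Hr Hpos. pose proof (word_facts X B fw) as HB.
  destruct (proj1 HL) as (E1 & _).
  unfold lowest. do 2 (apply runs_asg_seq; [okx; auto | sx]).
  assert (HL1 : loaded X (setr (setr s 17 (rg s 1)) 10 0)) by exact HL.
  assert (HA1 : forall j, j <= i -> ar (setr (setr s 17 (rg s 1)) 10 0) 7 j = r j) by exact HA.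
  assert (R9 : rg (setr (setr s 17 (rg s 1)) 10 0) 9 = i) by exact H9.
  assert (R10 : rg (setr (setr s 17 (rg s 1)) 10 0) 10 = 0) by reflexivity.
  assert (R17 : rg (setr (setr s 17 (rg s 1)) 10 0) 17 = n) by exact E1.
  set (s1 := setr (setr s 17 (rg s 1)) 10 0) in *. clearbody s1.
  apply runs_for with (lo := 0) (hi := i + 1) (T1 := 0)
    (I := fun k s => (rg s 17 = n /\ forall j, j < k -> r j = 0) \/
       (rg s 17 < k /\ 0 < r (rg s 17) /\
        forall j, j < k -> j <> rg s 17 -> 0 < r j -> lower p w (rg s 17) j)); auto; try lia.
  - left. split; auto. intros; lia.
  - intros s2 F. carry F. okx. subregs. repeat split; auto; lia.
  - intros k s2 Hk F E10 HI. assert (F' := F). keep_loaded F.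
    assert (K1 : rg s2 1 = n) by apply F.
    assert (KA : forall j, j <= i -> ar s2 7 j = r j)
      by (intros j Hj; rewrite (proj2 F' 7 eq_refl); auto).
    clear F'. destruct F as [_ GA]. destruct (GA k ltac:(lia)) as (Ep & Ew & _).
    pose proof (time_lt _ _ fw k ltac:(lia)) as Bp. pose proof (value_le _ _ fw k ltac:(lia)) as Bw.
    apply runs_if; [okx; rewrite E10; repeat split; auto; lia | |]; sx; rewrite E10, KA by lia; intros Hb.
    + destruct (Nat.ltb_spec 0 (r k)) as [Hrk |]; [| lia]. clear Hb.
      apply runs_if; [okx; auto | |]; sx; rewrite K1; intros Hb.
      * destruct (Nat.eqb_spec (rg s2 17) n) as [E17 |]; [| lia].
        destruct HI as [[_ HZ] | (? & _)]; [| lia].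
        apply runs_asg; [exact I | sx]. rewrite E10. split; auto. right. repeat split; auto; try lia.
        intros j Hj Hne Hrj. rewrite HZ in Hrj; lia.
      * destruct (Nat.eqb_spec (rg s2 17) n) as [E17 | N17]; [lia |].
        destruct HI as [[? _] | (Hc & Hrc & Hlow)]; [lia |].
        set (c := rg s2 17) in *.
        destruct (GA c ltac:(lia)) as (Epc & Ewc & _).
        pose proof (time_lt _ _ fw c ltac:(lia)) as Bpc. pose proof (value_le _ _ fw c ltac:(lia)) as Bwc.
        assert (w c * p k <= N * N /\ w k * p c <= N * N) by (split; apply Nat.mul_le_mono; lia).
        apply runs_if; [okx; fold c; rewrite E10, Ewc, Ep, Ew, Epc; repeat split; auto; lia | |];
          sx; fold c; rewrite E10, Ewc, Ep, Ew, Epc; intros Hcmp.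
        -- destruct (Nat.ltb_spec (w c * p k) (w k * p c)) as [Hlt |]; [| lia].
           apply runs_skip. split; auto. right. sx. fold c. repeat split; auto; try lia.
           intros j Hj Hne Hrj. destruct (Nat.eq_dec j k) as [-> | Hjk].
           ++ left. exact Hlt.
           ++ apply Hlow; auto. lia.
        -- destruct (Nat.ltb_spec (w c * p k) (w k * p c)) as [| Hge]; [lia |].
           assert (Hkc : lower p w k c) by (unfold lower; lia).
           apply runs_asg; [exact I | sx]. rewrite E10. split; auto. right. repeat split; auto; try lia.
           intros j Hj Hne Hrj. destruct (Nat.eq_dec j c) as [-> | Hjc]; auto.
           apply lower_trans with c; auto.
           ++ specialize (Hr k ltac:(lia)). lia.
           ++ specialize (Hr c ltac:(lia)). lia.
           ++ specialize (Hr j ltac:(lia)). lia.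
           ++ apply Hlow; auto. lia.
    + destruct (Nat.ltb_spec 0 (r k)) as [|]; [lia |]. apply runs_skip. split; auto. sx.
      destruct HI as [[E17 HZ] | (Hc & Hrc & Hlow)].
      * left. split; auto. intros j Hj. destruct (Nat.eq_dec j k) as [-> |]; [lia | apply HZ; lia].
      * right. repeat split; auto; try lia. intros j Hj Hne Hrj. apply Hlow; auto.
        destruct (Nat.eq_dec j k) as [-> |]; lia.
  - intros s2 F _ [[_ HZ] | (Hc & Hrc & Hlow)].
    + exfalso. assert (sumf r (S i) = 0); [| lia].
      rewrite <- (tot_none r (fun _ => false) (S i)) by auto. apply sumf_ext. intros j Hj. apply HZ. lia.
    + exists (rg s2 17). repeat split; auto; try lia. intros j Hj. apply Hlow. lia.
Qed.

Definition count (r : nat -> nat) (k : nat) : nat := tot (fun _ => 1) (fun j => 0 <? r j) k.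

Lemma count_ext r r' k : (forall j, j < k -> r j = r' j) -> count r k = count r' k.
Proof. intros H. apply tot_ext. intros j Hj. now rewrite H. Qed.

Lemma count_put_zero r c k : c < k -> 0 < r c -> S (count (put r c 0) k) = count r k.
Proof.
  intros Hc Hr. induction k; [lia |]. unfold count in *. rewrite !tot_S.
  destruct (Nat.eq_dec c k) as [-> | Hne].
  - unfold put at 2. rewrite Nat.eqb_refl. destruct (Nat.ltb_spec 0 (r k)); [| lia]. cbn [Nat.ltb Nat.leb].
    rewrite Nat.add_0_r, Nat.add_1_r. f_equal. apply (count_ext (put r k 0) r). intros j Hj. unfold put.
    destruct (Nat.eqb_spec j k); [lia | auto].
  - rewrite <- IHk by lia. unfold put at 2. destruct (Nat.eqb_spec k c); [lia |]. lia.
Qed.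

Lemma count_put_le r c v k : 0 < r c -> count (put r c v) k <= count r k.
Proof.
  intros Hr. induction k; [auto |]. unfold count in *. rewrite !tot_S.
  unfold put at 2. destruct (Nat.eqb_spec k c) as [-> |].
  - destruct (Nat.ltb_spec 0 (r c)); [| lia]. destruct (0 <? v); lia.
  - lia.
Qed.

(** The potential counts three for each index from the current one on, one for every job with a
    positive kept part and one for an excess. Admitting a job lowers the first count by three and
    raises the others by at most two; a cut either exhausts its job or removes the excess. Every
    round costs at most [n + 2], mostly the search for the lowest job. *)
Lemma greedy_correct s : loaded X s ->
  runs B greedy s ((n + 2) * (3 * n + 2)) (fun s' => exists r,
    (forall j, j < n -> ar s' 7 j = r j) /\ kept p w d r n /\ settled p d r n n /\
    sumf r n <= d (n - 1)).
Proof.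
  intros HL. pose proof (word_facts X B fw) as HB.
  unfold greedy. apply runs_asg_seq; [okx; auto | sx].
  apply runs_sto_seq; [okx; repeat split; auto; lia | sx].
  apply runs_asg_seq; [okx; repeat split; auto; lia | sx].
  assert (E0 : ar s 3 0 = p 0) by (apply HL; lia). rewrite E0.
  set (s1 := setr _ _ _).
  assert (HL1 : loaded X s1) by exact HL.
  assert (R9 : rg s1 9 = 0) by reflexivity. assert (R16 : rg s1 16 = p 0) by reflexivity.
  assert (A7 : ar s1 7 0 = p 0) by reflexivity. clearbody s1. clear HL E0 s.
  apply runs_while with (I := fun c s =>
    (rg s 9 < n /\ exists r, (forall j, j <= rg s 9 -> ar s 7 j = r j) /\ kept p w d r (S (rg s 9)) /\
       rg s 16 = sumf r (S (rg s 9)) /\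
       (settled p d r (S (rg s 9)) (rg s 9) \/ d (rg s 9) <= sumf r (S (rg s 9))) /\
       (n + 2) * (3 * (n - rg s 9) + count r (S (rg s 9)) +
         (if d (rg s 9) <? sumf r (S (rg s 9)) then 1 else 0)) <= c) \/
    (rg s 9 = n /\ exists r, (forall j, j < n -> ar s 7 j = r j) /\ kept p w d r n /\
       settled p d r n n /\ sumf r n <= d (n - 1))).
  { left. rewrite R9. split; [lia |].
    destruct (kept_add p w d (fun _ => 0) 0 (kept_nil _ _ _ _) ltac:(lia) ltac:(intros a Ha; lia)) as [K1 K2].
    exists (put (fun _ => 0) 0 (p 0)).
    repeat split; try apply K1; auto.
    - intros j Hj. replace j with 0 by lia. rewrite A7. reflexivity.
    - unfold count. cbn [tot sumf].
      assert (forall b1 b2 : bool, (if b1 then 1 else 0) + (if b2 then 1 else 0) <= 2) as H2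
        by (intros [] []; lia).
      apply Nat.mul_le_mono_l. unfold tot. cbn [sumf].
      specialize (H2 (0 <? put (fun _ => 0) 0 (p 0) 0) (d 0 <? 0 + put (fun _ => 0) 0 (p 0) 0)). lia. }
  intros c s F HI. keep_loaded F. destruct F as [(E1 & E2 & E4 & E5) GA].
  assert (HL : loaded X s) by (split; auto). clear s1 HL1 R9 R16 A7.
  split; [okx; auto |]. sx. rewrite E1.
  destruct HI as [(Hi & r & HA & HK & R16 & HS & Hc) | (Hi & HR)].
  2: { split; auto. intros Hb. destruct (Nat.ltb_spec (rg s 9) n); lia. }
  remember (rg s 9) as i eqn:R9. symmetry in R9.
  split. { intros Hb. destruct (Nat.ltb_spec i n); lia. }
  intros _. destruct (GA i Hi) as (Ep & Ew & Ed).
  pose proof (due_le _ _ fw i Hi) as Bd.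
  destruct (le_lt_dec (sumf r (S i)) (d i)) as [Hle | Hgt].
  - exists 0.
    (* A cut never takes the kept time below the due date, so after cuts the prefix ends exactly
       full and serves as the tight prefix for every cut job. *)
    assert (HS' : settled p d r (S i) (S i)).
    { destruct HS as [HS | HS].
      - intros a Ha Hlt. destruct (HS a Ha Hlt) as (e & He & Te). exists e. split; auto. lia.
      - intros a Ha _. exists (S i). split; [lia |]. unfold tight_at. rewrite Nat.sub_succ, Nat.sub_0_r. lia. }
    apply runs_if; [okx; rewrite R9; repeat split; auto; lia | |]; sx; rewrite R9, Ed, R16; intros Hb.
    { destruct (Nat.ltb_spec (d i) (sumf r (S i))); lia. }
    clear Hb. apply runs_asg_seq; [okx; rewrite R9; repeat split; auto; lia | sx]. rewrite R9, Nat.add_1_r.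
    apply runs_if; [okx; auto | |]; sx; rewrite E1; intros Hb.
    + destruct (Nat.ltb_spec (S i) n) as [Hi' |]; [| lia]. clear Hb.
      destruct (GA (S i) Hi') as (Ep' & _).
      pose proof (time_lt _ _ fw (S i) Hi') as Bp'.
      apply runs_sto_seq; [okx; repeat split; auto; lia | sx]. rewrite Ep'.
      apply runs_asg; [okx; rewrite R16, Ep'; repeat split; auto; lia |].
      exists (c - 1).
      destruct (kept_add p w d r (S i) HK) as [K1 K2]; auto.
      { intros _. rewrite Nat.sub_succ, Nat.sub_0_r. auto. }
      set (r' := put r (S i) (p (S i))) in *.
      assert (Hsum : sumf r' (S (S i)) = sumf r (S i) + p (S i)).
      { change (sumf r' (S (S i))) with (sumf r' (S i) + r' (S i)).
        unfold r'. rewrite sumf_put_out by lia. unfold put. rewrite Nat.eqb_refl. reflexivity. }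
      assert (Hcnt : count r' (S (S i)) <= count r (S i) + 1).
      { unfold count. rewrite tot_S. fold (count r' (S i)). rewrite (count_ext r' r).
        - fold (count r (S i)). destruct (0 <? r' (S i)); lia.
        - intros j Hj. unfold r', put. destruct (Nat.eqb_spec j (S i)); [lia | auto]. }
      assert (Hcr : (n + 2) * (3 * (n - S i) + count r' (S (S i)) +
           (if d (S i) <? sumf r' (S (S i)) then 1 else 0)) + 1 <= c).
      { assert (3 * (n - S i) + count r' (S (S i)) + (if d (S i) <? sumf r' (S (S i)) then 1 else 0) + 1
           <= 3 * (n - i) + count r (S i) + (if d i <? sumf r (S i) then 1 else 0)).
        { destruct (d (S i) <? sumf r' (S (S i))); lia. }
        nia. }
      split; [lia |]. left. sx. split; auto. exists r'. repeat split; try apply K1; auto.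
      * intros j Hj. destruct (Nat.eqb_spec j (S i)) as [-> | Hne].
        -- unfold r', put. now rewrite Nat.eqb_refl.
        -- unfold r', put. destruct (Nat.eqb_spec j (S i)); [lia |]. apply HA. lia.
      * lia.
      * lia.
    + destruct (Nat.ltb_spec (S i) n) as [|]; [lia |]. assert (En : S i = n) by lia.
      apply runs_skip. exists 0. split.
      { assert (1 <= 3 * (n - i)) by lia. nia. }
      right. sx. split; auto. exists r. rewrite <- En, Nat.sub_succ, Nat.sub_0_r in *.
      repeat split; try apply HK; auto. intros j Hj. apply HA. lia.
  - exists (S i).
    apply runs_if; [okx; rewrite R9; repeat split; auto; lia | |]; sx; rewrite R9, Ed, R16; intros Hb.
    2: { destruct (Nat.ltb_spec (d i) (sumf r (S i))); lia. }
    clear Hb. apply runs_seq with (T1 := S i) (T2 := 0); [lia |].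
    eapply runs_weaken; [apply (lowest_correct s r i); auto; try lia | lia |].
    { intros j Hj. apply (kept_le _ _ _ _ _ HK). lia. }
    intros s1 F (cc & R17 & Hcc & Hrc & Hlow) F'. clear F'. assert (F' := F). keep_loaded F.
    assert (Q9 : rg s1 9 = i) by (rewrite (proj1 F' 9 eq_refl); auto).
    assert (Q16 : rg s1 16 = sumf r (S i)) by (rewrite (proj1 F' 16 eq_refl); auto).
    assert (QA : forall j, j <= i -> ar s1 7 j = r j)
      by (intros j Hj; rewrite (proj2 F' 7 eq_refl); auto).
    clear F'. destruct F as [_ GA1]. destruct (GA1 i Hi) as (_ & _ & Ed1).
    apply runs_asg_seq; [okx; rewrite Q9; repeat split; auto; lia | sx].
    apply runs_asg_seq; [okx; rewrite R17; repeat split; auto; lia | sx].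
    apply runs_asg_seq; [okx; auto | sx].
    apply runs_sto_seq; [okx; rewrite R17; repeat split; auto; lia | sx].
    rewrite Q9, R17, Q16, Ed1, QA by auto.
    replace (sumf r (S i) - d i - (sumf r (S i) - d i - r cc)) with (min (sumf r (S i) - d i) (r cc)) by lia.
    set (cut := min (sumf r (S i) - d i) (r cc)).
    apply runs_asg; [okx; auto |]. sx. rewrite Q16.
    set (r' := put r cc (r cc - cut)).
    assert (Hcut : 0 < cut <= r cc) by (unfold cut; lia).
    assert (HK' : kept p w d r' (S i)).
    { apply kept_cut; auto; try lia. intros j Hj. apply Hlow. lia. }
    pose proof (sumf_put_in r cc (r cc - cut) (S i) ltac:(lia)) as Hsum. fold r' in Hsum.
    assert (Hsum' : sumf r' (S i) = sumf r (S i) - cut) by lia.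
    assert (Hge : d i <= sumf r' (S i)) by (unfold cut in *; lia).
    assert (Hcnt : count r' (S i) + (if d i <? sumf r' (S i) then 1 else 0) < count r (S i) + 1).
    { destruct (Nat.ltb_spec (d i) (sumf r' (S i))) as [Hl | Hl].
      - assert (Ez : r cc - cut = 0) by (unfold cut in *; lia).
        unfold r'. rewrite Ez. rewrite <- (count_put_zero r cc (S i)); auto; lia.
      - pose proof (count_put_le r cc (r cc - cut) (S i) Hrc). fold r' in H. lia. }
    assert (Hcr : (n + 2) * (3 * (n - i) + count r' (S i) +
         (if d i <? sumf r' (S i) then 1 else 0)) + (n + 2) <= c).
    { destruct (Nat.ltb_spec (d i) (sumf r (S i))) as [_ |] in Hc; [| lia]. nia. }
    assert (n + 2 <= c) by (eapply Nat.le_trans; [| exact Hcr]; apply Nat.le_add_l).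
    exists (c - (n + 2)). split; [lia |]. left. rewrite Q9. split; auto.
    exists r'. repeat split; try apply HK'; auto.
    + intros j Hj. unfold r', put. destruct (Nat.eqb_spec j cc) as [-> | Hne]; auto.
    + lia.
Qed.

End GreedyProgram.

(** * The dynamic program over a window of weights *)

Open Scope prog_scope.

(** Updated in place with descending weight. [D + 1] means unreachable; it also replaces the entries
    above the old upper end, where memory may hold values of an earlier, wider window. *)
Definition relax : cmd :=
  13 ::= !22 + !11 + #1;;
  WHILE !21 < !13 DO
    13 ::= !13 - #1;;
    14 ::= !25;;
    IF !22 < !13 THEN Skip ELSE 14 ::= 8@[!13] FI;;
    IF !13 < !21 + !11 THEN Skip ELSE
      15 ::= 8@[!13 - !11] + !10;;
      IF !12 < !15 THEN Skip ELSE IF !15 < !14 THEN 14 ::= !15 FI FI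
    FI;;
    8@@[!13] ::= !14
  OD.

Definition scan : cmd :=
  22 ::= !22 + !11;; 23 ::= !22;;
  WHILE (!21 < !23) * (!20 < 8@[!23]) DO 23 ::= !23 - #1 OD.

(** Register 24 is the radius [9 * W * W] of [proximity], with [W] one more than the largest weight
    and hence positive. Register 23 is the weight around which the next window is centred, register
    20 the kept time of the prefix. *)
Definition window : cmd :=
  20 ::= #0;; 21 ::= #0;; 22 ::= #0;; 23 ::= #0;;
  24 ::= #9 * (!4 + #1) * (!4 + #1);; 25 ::= !2 + #1;; 8@@[#0] ::= #0;; 9 ::= #0;;
  FOR 9 UPTO !1 DO
    10 ::= 3@[!9];; 11 ::= 4@[!9];; 12 ::= 5@[!9];; 20 ::= !20 + 7@[!9];;
    relax;; scan;;
    21 ::= !21 + ((!23 - !24) - !21);;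
    22 ::= !22 - (!22 - (!23 + !24))
  OD;;
  0 ::= !5 - !23.

Close Scope prog_scope.

(** * Soundness and completeness of the window *)

Section WindowTheory.

Variables (n D W : nat) (p w d r : nat -> nat).
Hypothesis W_pos : 1 <= W.
Hypothesis w_le : forall j, j < n -> w j <= W.
Hypothesis d_le : forall j, j < n -> d j <= D.
Hypothesis d_mono : forall i j, i <= j < n -> d i <= d j.
Hypothesis r_kept : kept p w d r n.
Hypothesis r_settled : settled p d r n n.
Hypothesis r_fits : sumf r n <= d (n - 1).

(** The last due date is replaced by the kept time, which makes the whole prefix of length [m]
    tight, as [proximity] requires. *)
Definition caps (m e : nat) : nat := if e =? m then sumf r m else d (e - 1).

(* The optima of the prefix of length [m] restricted to total time [sumf r m] that the
   proximity theorem speaks about. *)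
Definition good (m : nat) (Y : nat -> bool) : Prop :=
  fits p (caps m) Y m /\
  (forall x, fits p (caps m) x m -> tot w x m <= tot w Y m) /\
  (forall x, fits p (caps m) x m -> tot w x m = tot w Y m ->
     tot (fun j => m * W * W * p j + w j * j) Y m <= tot (fun j => m * W * W * p j + w j * j) x m).

Lemma prefix_fits e : 1 <= e <= n -> sumf r e <= d (e - 1).
Proof.
  intros He. destruct (Nat.eq_dec e n) as [-> | Hne]; auto.
  apply (kept_fits _ _ _ _ _ r_kept). lia.
Qed.

Lemma caps_le m e : 1 <= e <= m -> m <= n -> caps m e <= d (e - 1).
Proof.
  intros He Hm. unfold caps. destruct (Nat.eqb_spec e m) as [-> |]; auto. apply prefix_fits. lia.
Qed.

Lemma fits_feasible m x : m <= n -> fits p (caps m) x m -> feasible p d x m.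
Proof.
  intros Hm H e He. specialize (H (S e) ltac:(lia)).
  pose proof (caps_le m (S e) ltac:(lia) Hm) as Q. rewrite Nat.sub_succ, Nat.sub_0_r in Q. lia.
Qed.

Lemma feasible_fits m x : m <= n -> feasible p d x m -> tot p x m <= sumf r m -> fits p (caps m) x m.
Proof.
  intros Hm H Ht e He. unfold caps. destruct (Nat.eqb_spec e m) as [-> |]; auto.
  destruct e as [| e]; [cbn; lia |]. rewrite Nat.sub_succ, Nat.sub_0_r. apply H. lia.
Qed.

Lemma good_exists m : exists Y, good m Y.
Proof.
  destruct (exists_min (fun x => fits p (caps m) x m) (fun x => sumf w m - tot w x m)) as (Y0 & F0 & O0).
  { exists (fun _ => false). intros e _. rewrite tot_none; auto. lia. }
  destruct (exists_min (fun x => fits p (caps m) x m /\ tot w x m = tot w Y0 m)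
    (fun x => tot (fun j => m * W * W * p j + w j * j) x m)) as (Y & (F & E) & O); [now exists Y0 |].
  exists Y. split; auto. split.
  - intros x Hx. specialize (O0 x Hx). pose proof (tot_le_all w x m). pose proof (tot_le_all w Y0 m). lia.
  - intros x Hx Ex. apply O. split; auto. lia.
Qed.

(** This is [proximity] at prefix [i] of problem [m]. The optimum of problem [i] serves as [y]: the
    two problems have the same capacities before [i], and at [i] the capacity of problem [i] is
    exactly the time limit imposed on [y]. *)
Lemma good_near m i Y Y' : i <= m -> m <= n -> good m Y -> good i Y' ->
  tot w Y i <= tot w Y' i + 9 * W * W /\ tot w Y' i <= tot w Y i + 9 * W * W.
Proof.
  intros Hi Hm (F & O & P) (F' & O' & _).
  assert (CI : forall e, e <= i -> e <> i -> caps i e = caps m e).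
  { intros e He Hne. unfold caps. destruct (Nat.eqb_spec e i), (Nat.eqb_spec e m); auto; lia. }
  assert (KC : forall e, e <= m -> sumf r e <= caps m e).
  { intros e He. unfold caps. destruct (Nat.eqb_spec e m) as [-> |]; auto.
    destruct e as [| e]; [cbn; lia |]. apply prefix_fits. lia. }
  assert (Ti : forall x, fits p (caps i) x i -> tot p x i <= sumf r i).
  { intros x Hx. specialize (Hx i (le_n _)). unfold caps in Hx. now rewrite Nat.eqb_refl in Hx. }
  destruct r_kept as [K1 K2 K3 K4].
  apply (proximity m W p w r (caps m)); auto.
  - intros j Hj. apply w_le. lia.
  - intros j Hj. apply K1. lia.
  - unfold caps. now rewrite Nat.eqb_refl.
  - intros a b Hab. apply K2. lia.
  - intros a b Hab Ha Hb HN. apply K3; auto; [lia |]. intros e He Te. apply (HN e He).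
    unfold caps. destruct (Nat.eqb_spec e m); [lia | exact Te].
  - intros e He. destruct (Nat.eq_dec e i) as [-> | Hne].
    + specialize (Ti _ F'). specialize (KC i Hi). lia.
    + rewrite <- CI; auto.
  - intros x Hx Hk. apply O'. intros e He. destruct (Nat.eq_dec e i) as [-> | Hne].
    + unfold caps. now rewrite Nat.eqb_refl.
    + rewrite CI; auto.
Qed.

Definition step_window (i lo hi : nat) (F : nat -> nat) (x : nat) : nat :=
  let old := if hi <? x then D + 1 else F x in
  if x <? lo + w i then old
  else let c := F (x - w i) + p i in
    if d i <? c then old else if c <? old then c else old.

Record window_sound (i lo hi : nat) (F : nat -> nat) : Prop := {
  F_le : forall x, lo <= x <= hi -> F x <= D + 1 ;
  F_sound : forall x, lo <= x <= hi -> F x <= D ->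
    exists z, feasible p d z i /\ tot w z i = x /\ tot p z i = F x
}.

(** By soundness, finite entries are upper bounds of the least times; here they are shown small
    enough for all optima that matter. The case [m = i] locates the next window and [m = n] gives
    the answer. *)
Definition window_complete (i lo hi : nat) (F : nat -> nat) : Prop :=
  forall m Y, i <= m <= n -> good m Y -> lo <= tot w Y i <= hi /\ F (tot w Y i) <= tot p Y i.

Lemma step_sound i lo hi F : i < n -> window_sound i lo hi F ->
  window_sound (S i) lo (hi + w i) (step_window i lo hi F).
Proof.
  intros Hi [HF HS].
  assert (Ext : forall b z f e, e <= i -> tot f (fun j => if j =? i then b else z j) e = tot f z e).
  { intros b z f e He. apply tot_ext. intros j Hj. destruct (Nat.eqb_spec j i); [lia | auto]. }
  assert (Old : forall x, lo <= x <= hi + w i -> (if hi <? x then D + 1 else F x) <= D ->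
    exists z, feasible p d z (S i) /\ tot w z (S i) = x /\ tot p z (S i) = (if hi <? x then D + 1 else F x)).
  { intros x Hx Hle. destruct (Nat.ltb_spec hi x); [lia |].
    destruct (HS x ltac:(lia) Hle) as (z & Fz & Wz & Tz).
    exists (fun j => if j =? i then false else z j).
    rewrite !tot_S, !Ext, Nat.eqb_refl, !Nat.add_0_r by auto. repeat split; auto.
    intros e He. destruct (Nat.eq_dec e i) as [-> | Hne].
    - rewrite tot_S, Ext, Nat.eqb_refl, Nat.add_0_r by auto. apply (feasible_le p d n d_mono); auto.
    - rewrite Ext by lia. apply Fz. lia. }
  assert (OldB : forall x, lo <= x <= hi + w i -> (if hi <? x then D + 1 else F x) <= D + 1).
  { intros x Hx. destruct (Nat.ltb_spec hi x); [lia |]. apply HF. lia. }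
  specialize (d_le i Hi) as Hd.
  split; intros x Hx; unfold step_window;
    destruct (Nat.ltb_spec x (lo + w i)); auto;
    destruct (Nat.ltb_spec (d i) (F (x - w i) + p i)); auto;
    destruct (Nat.ltb_spec (F (x - w i) + p i) (if hi <? x then D + 1 else F x)); auto; try lia.
  intros Hle. destruct (HS (x - w i) ltac:(lia) ltac:(lia)) as (z & Fz & Wz & Tz).
  exists (fun j => if j =? i then true else z j).
  rewrite !tot_S, !Ext, Nat.eqb_refl by auto. repeat split; try lia.
  intros e He. destruct (Nat.eq_dec e i) as [-> | Hne].
  - rewrite tot_S, Ext, Nat.eqb_refl by auto. lia.
  - rewrite Ext by lia. apply Fz. lia.
Qed.

Lemma step_complete i lo hi F : i < n -> window_complete i lo hi F ->
  window_complete (S i) lo (hi + w i) (step_window i lo hi F).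
Proof.
  intros Hi HC m Y Hm HY. destruct (HC m Y ltac:(lia) HY) as (Hr & Hle).
  assert (Hf : tot p Y (S i) <= d i).
  { apply (fits_feasible m Y); [lia | apply HY | lia]. }
  rewrite !tot_S in *. unfold step_window. destruct (Y i).
  - split; [lia |]. rewrite Nat.add_sub.
    destruct (Nat.ltb_spec (tot w Y i + w i) (lo + w i)); [lia |].
    destruct (Nat.ltb_spec (d i) (F (tot w Y i) + p i)); [lia |].
    destruct (Nat.ltb_spec (F (tot w Y i) + p i)
      (if hi <? tot w Y i + w i then D + 1 else F (tot w Y i + w i))); lia.
  - rewrite !Nat.add_0_r in *. split; [lia |].
    destruct (Nat.ltb_spec hi (tot w Y i)); [lia |].
    destruct (tot w Y i <? lo + w i); auto.
    destruct (d i <? F (tot w Y i - w i) + p i); auto.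
    destruct (Nat.ltb_spec (F (tot w Y i - w i) + p i) (F (tot w Y i))); lia.
Qed.

(** Completeness keeps the optimum of problem [i] inside the window and, since larger weights take
    too long, at most [g]; soundness makes [g] attainable within the kept time. The alternative
    [g = lo] is where the search stops without a test. *)
Lemma top_weight i lo hi F g : i <= n -> 1 <= i -> window_sound i lo hi F -> window_complete i lo hi F ->
  lo <= g <= hi -> g = lo \/ F g <= sumf r i -> (forall x, g < x <= hi -> sumf r i < F x) ->
  forall Y, good i Y -> tot w Y i = g.
Proof.
  intros Hi Hi1 [HF HS] HC Hg Hlow Hhigh Y HY.
  destruct (HC i Y ltac:(lia) HY) as (Hr & Hle).
  assert (Tk : tot p Y i <= sumf r i).
  { destruct HY as (FY & _). specialize (FY i (le_n _)). unfold caps in FY. now rewrite Nat.eqb_refl in FY. }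
  assert (H1 : tot w Y i <= g).
  { destruct (le_lt_dec (tot w Y i) g); auto. specialize (Hhigh (tot w Y i) ltac:(lia)). lia. }
  destruct Hlow as [-> | Hk]; [lia |].
  pose proof (prefix_fits i ltac:(lia)). specialize (d_le (i - 1) ltac:(lia)) as Hd.
  destruct (HS g Hg ltac:(lia)) as (z & Fz & Wz & Tz).
  destruct HY as (_ & OY & _). specialize (OY z (feasible_fits i z Hi Fz ltac:(lia))). lia.
Qed.

Lemma cut_sound i lo hi F lo' hi' : lo <= lo' -> hi' <= hi -> window_sound i lo hi F ->
  window_sound i lo' hi' F.
Proof. intros ? ? [HF HS]. split; intros; [apply HF | apply HS]; auto; lia. Qed.

(** On this prefix the optima of all later problems lie within the radius of the optimum of problem
    [i], so shrinking the window around its weight [g] loses none of them. *)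
Lemma cut_complete i lo hi F g lo' hi' : window_complete i lo hi F ->
  (forall Y, good i Y -> tot w Y i = g) ->
  lo' = max lo (g - 9 * W * W) -> hi' = min hi (g + 9 * W * W) ->
  window_complete i lo' hi' F.
Proof.
  intros HC Hg -> -> m Y Hm HY. destruct (HC m Y Hm HY) as (Hr & Hle).
  destruct (good_exists i) as (Y' & HY').
  pose proof (good_near m i Y Y' ltac:(lia) ltac:(lia) HY HY') as Hn.
  rewrite (Hg Y' HY') in Hn. split; [lia | auto].
Qed.

Lemma start_sound F : F 0 = 0 -> window_sound 0 0 0 F.
Proof.
  intros H. split; intros x Hx.
  - replace x with 0 by lia. lia.
  - intros _. exists (fun _ => false). split; [intros e He; lia |]. cbn. replace x with 0 by lia. lia.
Qed.

Lemma start_complete F : F 0 = 0 -> window_complete 0 0 0 F.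
Proof. intros H m Y _ _. cbn. lia. Qed.

(** The last truncation excludes nothing: by [settled_fits] no feasible selection takes longer than
    [sumf r n]. *)
Lemma good_best Y : 1 <= n -> good n Y -> tot w Y n = best p w d n D.
Proof.
  intros Hn HY. apply Nat.le_antisymm.
  - apply best_complete with (N := n); auto.
    + apply fits_feasible; auto. apply HY.
    + destruct HY as (FY & _). specialize (FY n (le_n _)).
      pose proof (caps_le n n ltac:(lia) (le_n _)). specialize (d_le (n - 1) ltac:(lia)). lia.
  - destruct (best_sound p w d n d_mono n D (le_n _)) as (x & Fx & _ & <-).
    apply HY. apply feasible_fits; auto. apply (settled_fits p d r n); auto.
    apply (kept_le _ _ _ _ _ r_kept).
Qed.

End WindowTheory.

(** * Correctness of the window program *)

Section WindowProgram.

Variables (X : instance) (B : nat).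
Hypothesis fw : fits_word X B.
Local Notation n := (size X).
Local Notation N := (bound X).
Local Notation D := (deadline X).
Local Notation W := (S (heaviest X)).
Local Notation p := (time_of X).
Local Notation w := (value_of X).
Local Notation d := (due_of X).

Lemma relax_correct s i lo hi : loaded X s -> i < n ->
  rg s 10 = p i -> rg s 11 = w i -> rg s 12 = d i -> rg s 21 = lo -> rg s 22 = hi -> rg s 25 = D + 1 ->
  lo <= hi -> hi + w i <= N * N -> (forall x, lo <= x <= hi -> ar s 8 x <= D + 1) ->
  runs B relax s (hi + w i + 1 - lo) (fun s' =>
    forall x, lo <= x <= hi + w i -> ar s' 8 x = step_window D p w d i lo hi (ar s 8) x).
Proof.
  intros HL Hi R10 R11 R12 R21 R22 R25 Hlo Hhi HF. pose proof (word_facts X B fw) as HB.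
  pose proof (time_lt _ _ fw i Hi) as Bp. pose proof (value_le _ _ fw i Hi) as Bw.
  unfold relax. apply runs_asg_seq; [okx; subregs; repeat split; auto; lia | sx]. rewrite R22, R11.
  set (F := ar s 8) in *.
  assert (A8 : forall x, ar (setr s 13 (hi + w i + 1)) 8 x = F x) by reflexivity.
  assert (Q10 : rg (setr s 13 (hi + w i + 1)) 10 = p i) by exact R10.
  assert (Q11 : rg (setr s 13 (hi + w i + 1)) 11 = w i) by exact R11.
  assert (Q12 : rg (setr s 13 (hi + w i + 1)) 12 = d i) by exact R12.
  assert (Q13 : rg (setr s 13 (hi + w i + 1)) 13 = hi + w i + 1) by reflexivity.
  assert (Q21 : rg (setr s 13 (hi + w i + 1)) 21 = lo) by exact R21.
  assert (Q22 : rg (setr s 13 (hi + w i + 1)) 22 = hi) by exact R22.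
  assert (Q25 : rg (setr s 13 (hi + w i + 1)) 25 = D + 1) by exact R25.
  set (s1 := setr s 13 (hi + w i + 1)) in *. clearbody s1 F. clear R10 R11 R12 R21 R22 R25 HL s.
  apply runs_while with (I := fun c s => lo <= rg s 13 <= hi + w i + 1 /\ c = rg s 13 - lo /\
    forall x, lo <= x <= hi + w i ->
      ar s 8 x = if rg s 13 <=? x then step_window D p w d i lo hi F x else F x).
  { rewrite Q13. repeat split; auto; try lia. intros x Hx.
    destruct (Nat.leb_spec (hi + w i + 1) x); [lia | auto]. }
  intros c s2 G (Hx0 & -> & HA).
  assert (K10 : rg s2 10 = p i) by (rewrite (proj1 G 10 eq_refl); auto).
  assert (K11 : rg s2 11 = w i) by (rewrite (proj1 G 11 eq_refl); auto).
  assert (K12 : rg s2 12 = d i) by (rewrite (proj1 G 12 eq_refl); auto).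
  assert (K21 : rg s2 21 = lo) by (rewrite (proj1 G 21 eq_refl); auto).
  assert (K22 : rg s2 22 = hi) by (rewrite (proj1 G 22 eq_refl); auto).
  assert (K25 : rg s2 25 = D + 1) by (rewrite (proj1 G 25 eq_refl); auto).
  clear G A8 Q10 Q11 Q12 Q13 Q21 Q22 Q25.
  split; [okx; auto |]. sx. rewrite K21.
  destruct (Nat.ltb_spec lo (rg s2 13)) as [Hlt | Hge]; (split; [intros Hq | intros Hq]); try lia.
  2: { intros x Hx. rewrite HA by auto. destruct (Nat.leb_spec (rg s2 13) x); auto; lia. }
  exists 0. clear Hq. remember (rg s2 13 - 1) as x eqn:Ex.
  assert (Ex' : rg s2 13 = S x) by lia.
  assert (Fin : forall s', rg s' 13 = x -> ar s' 8 x = step_window D p w d i lo hi F x ->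
    (forall y, y <> x -> ar s' 8 y = ar s2 8 y) ->
    exists n', S (n' + 0) <= rg s2 13 - lo /\ lo <= rg s' 13 <= hi + w i + 1 /\ n' = rg s' 13 - lo /\
      forall y, lo <= y <= hi + w i ->
        ar s' 8 y = if rg s' 13 <=? y then step_window D p w d i lo hi F y else F y).
  { intros s' A1 A2 A3. exists (x - lo). rewrite A1. repeat split; auto; try lia.
    intros y Hy. destruct (Nat.eq_dec y x) as [-> | Hne].
    - now rewrite Nat.leb_refl.
    - rewrite A3, HA by auto. rewrite Ex'.
      destruct (Nat.leb_spec (S x) y), (Nat.leb_spec x y); auto; lia. }
  assert (Rd : forall y, lo <= y <= x -> ar s2 8 y = F y).
  { intros y Hy. rewrite HA by lia. destruct (Nat.leb_spec (rg s2 13) y); auto; lia. }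
  apply runs_asg_seq; [okx; auto | sx]. rewrite <- Ex.
  apply runs_asg_seq; [okx; auto | sx]. rewrite K25.
  unfold step_window in Fin.
  set (old := if hi <? x then D + 1 else F x) in *.
  apply runs_seq with (T1 := 0) (T2 := 0); [lia |].
  eapply runs_weaken with (T := 0)
    (R := fun s3 => rg s3 14 = old /\ rg s3 13 = x /\ forall y, ar s3 8 y = ar s2 8 y); [| lia |].
  { apply runs_if; [okx; auto | |]; sx; rewrite K22; intros Hq; unfold old;
      destruct (Nat.ltb_spec hi x) as [Hh | Hh]; try lia.
    - apply runs_skip. auto.
    - apply runs_asg; [okx; repeat split; auto; lia | sx]. rewrite Rd by lia. auto. }
  intros s3 G (R14 & R13 & RA) _.
  assert (R10 : rg s3 10 = p i) by (rewrite (proj1 G 10 eq_refl); auto).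
  assert (R11 : rg s3 11 = w i) by (rewrite (proj1 G 11 eq_refl); auto).
  assert (R12 : rg s3 12 = d i) by (rewrite (proj1 G 12 eq_refl); auto).
  assert (R21 : rg s3 21 = lo) by (rewrite (proj1 G 21 eq_refl); auto).
  clear G.
  assert (Store : forall s4, rg s4 13 = x -> (forall y, ar s4 8 y = ar s2 8 y) ->
    rg s4 14 = (if x <? lo + w i then old
      else let c := F (x - w i) + p i in if d i <? c then old else if c <? old then c else old) ->
    runs B (Sto 8 (Var 13) (Var 14)) s4 0 (fun s' => exists n', S (n' + 0) <= rg s2 13 - lo /\
      lo <= rg s' 13 <= hi + w i + 1 /\ n' = rg s' 13 - lo /\
      forall y, lo <= y <= hi + w i ->
        ar s' 8 y = if rg s' 13 <=? y then step_window D p w d i lo hi F y else F y)).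
  { intros s4 A13 A8 A14. apply runs_sto; [okx; rewrite A13; repeat split; auto; lia |].
    apply Fin; sx; rewrite A13; auto.
    - now rewrite Nat.eqb_refl.
    - intros y Hy. destruct (Nat.eqb_spec y x); [lia | auto]. }
  apply runs_if_seq; [okx; rewrite R21, R11; repeat split; auto; lia | |]; sx; rewrite R13, R21, R11; intros Hq.
  - apply runs_skip_seq. apply Store; auto. rewrite R14. destruct (x <? lo + w i); [auto | lia].
  - destruct (Nat.ltb_spec x (lo + w i)) as [| Hx]; [lia |].
    assert (Rx : F (x - w i) <= D + 1 /\ ar s2 8 (x - w i) = F (x - w i)).
    { split; [apply HF; lia | apply Rd; lia]. }
    destruct Rx as [BF RF].
    apply runs_seq_assoc.
    apply runs_asg_seq; [okx; rewrite R13, R11, R10, RA, RF; repeat split; auto; lia | sx].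
    rewrite R13, R11, R10, RA, RF.
    apply runs_if_seq; [okx; auto | |]; sx; rewrite R12; intros Hc.
    + apply runs_skip_seq. apply Store; sx; auto.
      destruct (d i <? F (x - w i) + p i); [auto | lia].
    + destruct (d i <? F (x - w i) + p i) eqn:Ec; [lia |].
      apply runs_if_seq; [okx; auto | |]; sx; rewrite R14; intros Hc'.
      * apply runs_asg_seq; [okx; auto |]. apply Store; sx; auto. rewrite Ec.
        destruct (F (x - w i) + p i <? old); [auto | lia].
      * apply runs_skip_seq. apply Store; sx; auto. rewrite Ec.
        destruct (F (x - w i) + p i <? old); [lia | auto].
Qed.

Lemma scan_correct s lo hi c v : rg s 11 = v -> rg s 20 = c -> rg s 21 = lo -> rg s 22 = hi ->
  lo <= hi -> hi + v <= N * N ->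
  runs B scan s (hi + v - lo) (fun s' => rg s' 22 = hi + v /\ lo <= rg s' 23 <= hi + v /\
    (rg s' 23 = lo \/ ar s 8 (rg s' 23) <= c) /\ forall x, rg s' 23 < x <= hi + v -> c < ar s 8 x).
Proof.
  intros R11 R20 R21 R22 Hlo Hhi. pose proof (word_facts X B fw) as HB.
  unfold scan. apply runs_asg_seq; [okx; subregs; repeat split; auto; lia | sx]. rewrite R22, R11.
  apply runs_asg_seq; [okx; auto | sx].
  apply runs_while with (I := fun m s' => lo <= rg s' 23 <= hi + v /\ m = rg s' 23 - lo /\
    forall x, rg s' 23 < x <= hi + v -> c < ar s 8 x).
  { sx. repeat split; auto; lia. }
  intros m s1 F (Hr & -> & HA).
  assert (K20 : rg s1 20 = c) by (rewrite (proj1 F 20 eq_refl); auto).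
  assert (K21 : rg s1 21 = lo) by (rewrite (proj1 F 21 eq_refl); auto).
  assert (K22 : rg s1 22 = hi + v) by (rewrite (proj1 F 22 eq_refl); auto).
  assert (A8 : forall x, ar s1 8 x = ar s 8 x) by (intros; rewrite (proj2 F 8 eq_refl); auto).
  clear F.
  split.
  { okx. repeat split; auto; try lia.
    destruct (rg s1 21 <? rg s1 23), (rg s1 20 <? ar s1 8 (rg s1 23)); lia. }
  sx. rewrite K20, K21, A8.
  destruct (Nat.ltb_spec lo (rg s1 23)), (Nat.ltb_spec c (ar s 8 (rg s1 23)));
    (split; [intros Hq | intros Hq]); try lia.
  - exists 0. apply runs_asg; [okx; auto | sx].
    exists (rg s1 23 - 1 - lo). repeat split; auto; try lia.
    intros x Hx. destruct (Nat.eq_dec x (rg s1 23)) as [-> |]; auto. apply HA. lia.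
  - split; [exact K22 |]. repeat split; auto; lia.
  - split; [exact K22 |]. repeat split; auto; lia.
  - split; [exact K22 |]. repeat split; auto; lia.
Qed.

(** The window has width at most [18 * W * W]. Extended by [w i], it is traversed twice per job, by
    [relax] and by [scan], which [40 * W * W + 2] covers. *)
Lemma window_correct s r : loaded X s ->
  (forall j, j < n -> ar s 7 j = r j) -> kept p w d r n -> settled p d r n n -> sumf r n <= d (n - 1) ->
  runs B window s (n * (40 * W * W + 3)) (fun s' => rg s' 0 = gross X - best p w d n D).
Proof.
  intros HL HR HK HS HF. pose proof (word_facts X B fw) as HB. destruct (proj1 HL) as (E1 & E2 & E4 & E5).
  assert (W_pos : 1 <= W) by lia.
  assert (HWN : W * W <= N * N) by (apply Nat.mul_le_mono; lia).
  assert (HWW : W <= W * W) by nia.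
  assert (w_leW : forall j, j < n -> w j <= W).
  { intros j Hj. pose proof (value_le _ _ fw j Hj). lia. }
  pose proof (due_le _ _ fw) as d_leD. pose proof (due_mono _ _ fw) as d_mon.
  set (H := 9 * W * W) in *.
  assert (EH : H = 9 * (W * W)) by (unfold H; lia).
  unfold window. do 4 (apply runs_asg_seq; [okx; auto | sx]).
  apply runs_asg_seq; [okx; rewrite E4; repeat split; auto; lia | sx].
  apply runs_asg_seq; [okx; rewrite E2; repeat split; auto; lia | sx].
  apply runs_sto_seq; [okx; repeat split; auto; lia | sx].
  apply runs_asg_seq; [okx; auto | sx].
  set (s1 := setr _ 9 0).
  assert (HL1 : loaded X s1) by exact HL.
  assert (HR1 : forall j, j < n -> ar s1 7 j = r j) by exact HR.
  assert (R20 : rg s1 20 = 0) by reflexivity. assert (R21 : rg s1 21 = 0) by reflexivity.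
  assert (R22 : rg s1 22 = 0) by reflexivity. assert (R23 : rg s1 23 = 0) by reflexivity.
  assert (R24 : rg s1 24 = H) by (unfold s1; sx; rewrite E4; unfold H; lia).
  assert (R25 : rg s1 25 = D + 1) by (unfold s1; sx; rewrite E2; lia).
  assert (A8 : ar s1 8 0 = 0) by reflexivity.
  assert (R9 : rg s1 9 = 0) by reflexivity. clearbody s1. clear HL HR E1 E2 E4 E5 s.
  apply runs_seq with (T1 := n * (40 * W * W + 3)) (T2 := 0); [lia |].
  apply runs_for with (lo := 0) (hi := n) (T1 := 40 * W * W + 2)
    (I := fun i s => rg s 20 = sumf r i /\ rg s 22 <= i * heaviest X /\ rg s 21 <= rg s 22 /\
       rg s 22 <= rg s 21 + 2 * H /\ rg s 23 <= N * N /\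
       window_sound D p w d i (rg s 21) (rg s 22) (ar s 8) /\
       window_complete n W p w d r i (rg s 21) (rg s 22) (ar s 8) /\
       (forall Y, good W p w d r i Y -> tot w Y i = rg s 23)); auto; try lia.
  { rewrite R20, R21, R22, R23. do 5 (split; [cbn; lia |]).
    split; [exact (start_sound n D W p w d r W_pos HF _ A8) |]. split; [exact (start_complete n W p w d r W_pos HF _ A8) | reflexivity]. }
  { intros s2 F. keep_loaded F. split; [exact I | apply F]. }
  { intros i s2 Hi F R9' (I20 & I22 & I21 & IH2 & I23 & IS & IC & IT).
    assert (K7 : forall j, j < n -> ar s2 7 j = r j) by (intros; rewrite (proj2 F 7 eq_refl); auto).
    assert (K24 : rg s2 24 = H) by (rewrite (proj1 F 24 eq_refl); auto).
    assert (K25 : rg s2 25 = D + 1) by (rewrite (proj1 F 25 eq_refl); auto).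
    keep_loaded F. destruct (proj2 F i ltac:(lia)) as (Ep & Ew & Ed).
    pose proof (value_le _ _ fw i ltac:(lia)) as Bw.
    assert (Bn : i * heaviest X + heaviest X <= n * heaviest X).
    { replace (i * heaviest X + heaviest X) with (S i * heaviest X) by lia.
      apply Nat.mul_le_mono_r. lia. }
    assert (Bk : sumf r (S i) <= D).
    { assert (Hi' : i < n) by lia.
      pose proof (prefix_fits n W p w d r W_pos HK HF (S i) ltac:(lia)) as Q.
      rewrite Nat.sub_succ, Nat.sub_0_r in Q. specialize (d_leD i Hi'). lia. }
    cbn [sumf] in Bk.
    do 3 (apply runs_asg_seq; [okx; rewrite R9'; repeat split; auto; lia | sx]).
    rewrite R9', Ep, Ew, Ed.
    apply runs_asg_seq; [okx; rewrite R9', I20, K7 by lia; repeat split; auto; lia | sx].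
    rewrite R9', I20, K7 by lia.
    set (lo := rg s2 21) in *. set (hi := rg s2 22) in *.
    set (s3 := setr _ 20 _).
    assert (L3 : loaded X s3) by exact F.
    assert (Q9 : rg s3 9 = i) by exact R9'.
    assert (Q10 : rg s3 10 = p i) by reflexivity. assert (Q11 : rg s3 11 = w i) by reflexivity.
    assert (Q12 : rg s3 12 = d i) by reflexivity.
    assert (Q20 : rg s3 20 = sumf r (S i)) by reflexivity.
    assert (Q21 : rg s3 21 = lo) by reflexivity. assert (Q22 : rg s3 22 = hi) by reflexivity.
    assert (Q24 : rg s3 24 = H) by exact K24. assert (Q25 : rg s3 25 = D + 1) by exact K25.
    assert (QA : ar s3 8 = ar s2 8) by reflexivity.
    clearbody s3 lo hi.
    apply runs_seq with (T1 := hi + w i + 1 - lo) (T2 := hi + w i - lo); [lia |].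
    eapply runs_weaken; [apply (relax_correct s3 i lo hi); auto; try lia | lia |].
    { intros x Hx. rewrite QA. apply IS. auto. }
    intros s4 G4 HA4 _. carry G4. keep_loaded G4.
    apply runs_seq with (T1 := hi + w i - lo) (T2 := 0); [lia |].
    eapply runs_weaken; [apply (scan_correct s4 lo hi (sumf r (S i)) (w i)); auto; lia | lia |].
    intros s5 G5 (P22 & P23 & Pk & Pm) _.
    assert (P9 : rg s5 9 = i) by (rewrite (proj1 G5 9 eq_refl); auto).
    assert (P20 : rg s5 20 = sumf r (S i)) by (rewrite (proj1 G5 20 eq_refl); auto).
    assert (P21 : rg s5 21 = lo) by (rewrite (proj1 G5 21 eq_refl); auto).
    assert (P24 : rg s5 24 = H) by (rewrite (proj1 G5 24 eq_refl); auto).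
    assert (PA : forall x, lo <= x <= hi + w i -> ar s5 8 x = step_window D p w d i lo hi (ar s2 8) x).
    { intros x Hx. rewrite (proj2 G5 8 eq_refl), HA4, QA; auto. }
    assert (PB : forall x, ar s4 8 x = ar s5 8 x) by (intros; rewrite (proj2 G5 8 eq_refl); auto).
    clear G5. set (g := rg s5 23) in *.
    assert (Hi' : i < n) by lia.
    assert (NS : window_sound D p w d (S i) lo (hi + w i) (ar s5 8)).
    { destruct (step_sound n D W p w d r W_pos d_leD d_mon HF i lo hi _ Hi' IS) as [A1 A2].
      split; intros x Hx; rewrite PA by auto; [apply A1 | apply A2]; auto. }
    assert (NC : window_complete n W p w d r (S i) lo (hi + w i) (ar s5 8)).
    { intros m Y Hm HY.
      destruct (step_complete n D W p w d r W_pos HK HF i lo hi _ Hi' IC m Y Hm HY) as (A1 & A2).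
      split; auto. rewrite PA; auto. }
    assert (NT : forall Y, good W p w d r (S i) Y -> tot w Y (S i) = g).
    { apply (top_weight n D W p w d r W_pos d_leD HK HF (S i) lo (hi + w i) (ar s5 8)); auto; try lia.
      - rewrite <- PB. exact Pk.
      - intros x Hx. rewrite <- PB. auto. }
    set (lo' := max lo (g - H)). set (hi' := min (hi + w i) (g + H)).
    apply runs_asg_seq; [okx; rewrite P21, P24; fold g; repeat split; auto; lia | sx].
    rewrite P21, P24. fold g. replace (lo + (g - H - lo)) with lo' by (unfold lo'; lia).
    apply runs_asg; [okx; rewrite P24; fold g; repeat split; auto; lia | sx].
    rewrite P22, P24. fold g. replace (hi + w i - (hi + w i - (g + H))) with hi' by (unfold hi'; lia).
    repeat split; auto; try (unfold lo', hi'; lia).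
    - apply (cut_sound n D W p w d r W_pos HF (S i) lo (hi + w i) _ lo' hi'); auto; unfold lo', hi'; lia.
    - apply (cut_sound n D W p w d r W_pos HF (S i) lo (hi + w i) _ lo' hi'); auto; unfold lo', hi'; lia.
    - apply (cut_complete n W p w d r W_pos w_leW HK HF (S i) lo (hi + w i) _ g lo' hi' NC NT eq_refl eq_refl m Y); auto.
    - apply (cut_complete n W p w d r W_pos w_leW HK HF (S i) lo (hi + w i) _ g lo' hi' NC NT eq_refl eq_refl m Y); auto.
    - apply (cut_complete n W p w d r W_pos w_leW HK HF (S i) lo (hi + w i) _ g lo' hi' NC NT eq_refl eq_refl m Y); auto. }
  intros s2 F _ (I20 & I22 & I21 & IH2 & I23 & IS & IC & IT) F'. clear F'.
  keep_loaded F. destruct (proj1 F) as (G1 & G2 & G4 & G5).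
  apply runs_asg; [okx; auto | sx]. rewrite G5.
  destruct (good_exists n W p w d r W_pos HF n) as (Y & HY).
  rewrite <- (IT Y HY). f_equal.
  apply (good_best n D W p w d r); auto. lia.
Qed.

End WindowProgram.

(** * Convolution with the prefix sums of a run *)

Lemma best_cap p w d c n t : (forall j, j < n -> d j <= c) -> best p w d n t = best p w d n (min t c).
Proof.
  revert t. induction n; intros t H; [reflexivity |]. cbn [best].
  rewrite (IHn t) by (intros; apply H; lia).
  replace (min (min t c) (d n)) with (min t (d n)) by (specialize (H n ltac:(lia)); lia). reflexivity.
Qed.

Definition is_conv (g S : nat -> nat) (c q t v : nat) : Prop :=
  (forall k, k <= c -> k * q <= t -> g (t - k * q) + S k <= v) /\
  exists k, k <= c /\ k * q <= t /\ g (t - k * q) + S k = v.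

Lemma best_run p w d i c q e :
  (forall j, j < i -> d j <= e) ->
  (forall j, j < c -> p (i + j) = q /\ d (i + j) = e) ->
  (forall j k, j < k < c -> w (i + k) <= w (i + j)) ->
  forall t, t <= e ->
  is_conv (best p w d i) (sumf (fun j => w (i + j))) c q t (best p w d (i + c) t).
Proof.
  intros Hd. induction c; intros Hpd Hw t Ht.
  - rewrite Nat.add_0_r. split.
    + intros k Hk _. replace k with 0 by lia. cbn. rewrite Nat.sub_0_r. lia.
    + exists 0. cbn. rewrite Nat.sub_0_r. lia.
  - rewrite Nat.add_succ_r. cbn [best]. destruct (Hpd c ltac:(lia)) as [-> ->].
    rewrite (Nat.min_l t e) by auto.
    assert (IH : forall t, t <= e -> is_conv (best p w d i) (sumf (fun j => w (i + j))) c q t (best p w d (i + c) t))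
      by (apply IHc; intros; first [apply Hpd; lia | apply Hw; lia]).
    set (V := max _ _).
    assert (U : forall k, k <= S c -> k * q <= t -> best p w d i (t - k * q) + sumf (fun j => w (i + j)) k <= V).
    { intros k Hk Hkt. destruct (Nat.eq_dec k (S c)) as [-> | Hne].
      - destruct (Nat.leb_spec q t); [| lia].
        destruct (IH (t - q) ltac:(lia)) as [Hup _]. specialize (Hup c (le_n _) ltac:(lia)).
        cbn [sumf]. replace (t - q - c * q) with (t - S c * q) in Hup by lia. unfold V. lia.
      - destruct (IH t Ht) as [Hup _]. specialize (Hup k ltac:(lia) Hkt). unfold V. lia. }
    split; auto.
    destruct (Nat.max_spec (best p w d (i + c) t)
      (if q <=? t then best p w d (i + c) (t - q) + w (i + c) else 0)) as [[Hlt E] | [Hle E]];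
      fold V in E.
    + destruct (Nat.leb_spec q t); [| lia].
      destruct (IH (t - q) ltac:(lia)) as [_ (k & Hk & Hkt & Ek)].
      exists (S k). split; [lia |]. split; [lia |]. apply Nat.le_antisymm; [apply U; lia |].
      rewrite E, <- Ek. replace (t - S k * q) with (t - q - k * q) by lia. cbn [sumf].
      destruct (Nat.eq_dec k c) as [-> | Hne]; [lia |]. specialize (Hw k c ltac:(lia)). lia.
    + destruct (IH t Ht) as [_ (k & Hk & Hkt & Ek)]. exists k. rewrite E, Ek. lia.
Qed.

Lemma best_free_run p w d i c :
  (forall j k, j <= k < i + c -> d j <= d k) -> (forall j, j < c -> p (i + j) = 0) ->
  forall t, best p w d (i + c) t = best p w d i t + sumf (fun j => w (i + j)) c.
Proof.
  induction c; intros Hd Hp t.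
  - rewrite Nat.add_0_r. cbn. lia.
  - rewrite Nat.add_succ_r. cbn [best sumf]. rewrite (Hp c) by lia. cbn [Nat.leb].
    rewrite Nat.sub_0_r, <- best_cap by (intros; apply Hd; lia).
    rewrite IHc by (intros; first [apply Hd; lia | apply Hp; lia]). lia.
Qed.

Lemma best_late_run p w d i c : (forall j, j < c -> d (i + j) < p (i + j)) ->
  forall t, best p w d (i + c) t = best p w d i t.
Proof.
  induction c; intros H t; [now rewrite Nat.add_0_r |].
  rewrite Nat.add_succ_r. cbn [best]. specialize (H c ltac:(lia)) as Hc.
  destruct (Nat.leb_spec (p (i + c)) (min t (d (i + c)))); [lia |].
  rewrite Nat.max_0_r. apply IHc. intros. apply H. lia.
Qed.

(** * Monotone maximisers from concavity *)

Section Concave.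

Variable v : nat -> nat.
Hypothesis v_decr : forall j k, j <= k -> v k <= v j.

Lemma sumf_concave a b h : a <= b -> sumf v (b + h) + sumf v a <= sumf v (a + h) + sumf v b.
Proof.
  intros Hab. induction h; [rewrite !Nat.add_0_r; lia |].
  rewrite !Nat.add_succ_r. cbn [sumf]. specialize (v_decr (a + h) (b + h) ltac:(lia)). lia.
Qed.

Variable g : nat -> nat.

(** Row [K] and column [x] of the convolution on one residue class: [x] indexes the old table, and
    [K - x] is the number of jobs taken from the run. *)
Definition value (K x : nat) : nat := g x + sumf v (K - x).

Definition solved (K o y : nat) : Prop :=
  o <= K /\ value K o = y /\ forall x, x <= K -> value K x <= y.

(** A Monge inequality: the terms in [g] cancel, and what remains is the concavity of the prefix
    sums. *)
Lemma value_monge K K' x' x : x' <= x -> x <= K -> K <= K' ->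
  value K x + value K' x' <= value K' x + value K x'.
Proof.
  intros. unfold value.
  pose proof (sumf_concave (K - x) (K - x') (K' - K) ltac:(lia)) as Q.
  replace (K - x' + (K' - K)) with (K' - x') in Q by lia.
  replace (K - x + (K' - K)) with (K' - x) in Q by lia. lia.
Qed.

(** By the Monge inequality, in row [K] a column left of [o1] is no better than [o1], and one right
    of [o2] no better than [o2]. [K2 <= K] encodes that no solved row follows. *)
Lemma solved_between K K1 K2 o1 o2 y1 y2 : K1 < K -> solved K1 o1 y1 ->
  (K < K2 -> solved K2 o2 y2 /\ o1 <= o2) -> forall x, x <= K ->
  exists x', o1 <= x' <= K /\ (K < K2 -> x' <= o2) /\ value K x <= value K x'.
Proof.
  intros H1 (O1 & E1 & M1) H2 x Hx.
  destruct (le_lt_dec o1 x) as [Hlo | Hlo].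
  - destruct (le_lt_dec K2 K) as [HK | HK].
    + exists x. repeat split; auto; lia.
    + destruct (H2 HK) as [(O2 & E2 & M2) Ho]. destruct (le_lt_dec x o2) as [Hhi | Hhi].
      * exists x. repeat split; auto.
      * exists o2. repeat split; auto; try lia.
        pose proof (value_monge K K2 o2 x ltac:(lia) Hx ltac:(lia)). specialize (M2 x ltac:(lia)). lia.
  - exists o1. split; [lia |]. split; [intros HK; apply H2, HK |].
    pose proof (value_monge K1 K x o1 ltac:(lia) O1 ltac:(lia)). specialize (M1 x ltac:(lia)). lia.
Qed.

End Concave.

(* Extending [w] by zeros past [c] removes the side condition [k <= c] from the convolution. *)
Lemma solved_conv g w c q r K o y :
  (forall t t', t <= t' -> g t <= g t') -> 0 < q ->
  solved (fun j => if j <? c then w j else 0) (fun x => g (r + x * q)) K o y -> r < q ->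
  is_conv g (sumf w) c q (r + K * q) y.
Proof.
  intros Hg Hq (Ho & Ey & Hm) Hr. set (v := fun j => if j <? c then w j else 0) in *.
  assert (Ext : forall a, sumf v a = sumf w (min a c)).
  { induction a; [reflexivity |]. cbn [sumf]. rewrite IHa. unfold v.
    destruct (Nat.ltb_spec a c).
    - replace (min (S a) c) with (S a) by lia. replace (min a c) with a by lia. reflexivity.
    - replace (min (S a) c) with (min a c) by lia. lia. }
  assert (Idx : forall k, k * q <= r + K * q -> k <= K).
  { intros k Hk. destruct (le_lt_dec k K); auto. exfalso. nia. }
  unfold value in *. split.
  - intros k Hk Hkt. specialize (Idx k Hkt). specialize (Hm (K - k) ltac:(lia)).
    replace (K - (K - k)) with k in Hm by lia. rewrite Ext, Nat.min_l in Hm by auto.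
    replace (r + K * q - k * q) with (r + (K - k) * q) by nia. lia.
  - exists (min (K - o) c). split; [lia |].
    assert (Hk : min (K - o) c <= K) by lia.
    assert (Hkq : min (K - o) c * q <= K * q) by (apply Nat.mul_le_mono_r; lia).
    split; [lia |]. apply Nat.le_antisymm.
    + specialize (Hm (K - min (K - o) c) ltac:(lia)).
      replace (K - (K - min (K - o) c)) with (min (K - o) c) in Hm by lia.
      rewrite Ext in Hm. replace (min (min (K - o) c) c) with (min (K - o) c) in Hm by lia.
      replace (r + K * q - min (K - o) c * q) with (r + (K - min (K - o) c) * q) by nia. lia.
    + rewrite <- Ey, Ext. apply Nat.add_le_mono_r, Hg.
      replace (r + K * q - min (K - o) c * q) with (r + (K - min (K - o) c) * q) by nia.
      apply Nat.add_le_mono_l, Nat.mul_le_mono_r. lia.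
Qed.

Lemma is_conv_unique g S c q t v v' : is_conv g S c q t v -> is_conv g S c q t v' -> v = v'.
Proof.
  intros [U (k & H1 & H2 & E)] [U' (k' & H1' & H2' & E')].
  specialize (U k' H1' H2'). specialize (U' k H1 H2). lia.
Qed.

(** * Programs for the table over runs *)

Open Scope prog_scope.

Definition search : cmd :=
  20 ::= #0;; 21 ::= !18;;
  WHILE !18 < !19 + #1 DO
    23 ::= !16 - !18;;
    23 ::= !23 - (!23 - !13);;
    22 ::= 10@[!18] + 9@[!23];;
    IF !22 < !20 THEN Skip ELSE 20 ::= !22;; 21 ::= !18 FI;;
    18 ::= !18 + #1
  OD.

(** The rows [t], [3 * t], [5 * t] and so on lie halfway between solved rows. Array 11 stores
    maximising columns; the upper end of a search is also capped by the row itself, which has no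
    columns beyond its own index. *)
Definition level : cmd :=
  16 ::= !17;;
  WHILE !16 < !15 + #1 DO
    18 ::= 11@[!16 - !17];;
    19 ::= !16;;
    IF !15 < !16 + !17 THEN Skip ELSE
      23 ::= 11@[!16 + !17];; 19 ::= !23 - (!23 - !19)
    FI;;
    search;;
    11@@[!16] ::= !21;;
    6@@[!14 + !16 * !10] ::= !20;;
    16 ::= !16 + !17 + !17
  OD.

(** Array 10 keeps the old values of the class, since array 6 is overwritten row by row while later
    rows still refer to them. *)
Definition residue : cmd :=
  15 ::= (!12 - !14) / !10;;
  16 ::= #0;;
  FOR 16 UPTO !15 + #1 DO 10@@[!16] ::= 6@[!14 + !16 * !10] OD;;
  11@@[#0] ::= #0;;
  17 ::= !30;;
  WHILE #0 < !17 DO level;; 17 ::= !17 / #2 OD.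

Definition convolve : cmd :=
  14 ::= #0;;
  FOR 14 UPTO !10 DO residue OD;;
  16 ::= !12 + #1;;
  FOR 16 UPTO !2 + #1 DO 6@@[!16] ::= 6@[!12] OD.

(** Products serve as conjunctions and evaluate all factors. Past the last job the comparisons read
    cells outside the job data, and the factor 0 masks them. *)
Definition gather : cmd :=
  13 ::= #0;; 9@@[#0] ::= #0;;
  WHILE (!9 + !13 < !1) * ((3@[!9 + !13] == !10) * (5@[!9 + !13] == !12)) DO
    9@@[!13 + #1] ::= 9@[!13] + 4@[!9 + !13];;
    13 ::= !13 + #1
  OD.

(** Jobs of time 0 always fit; register 3 collects their weight as a common offset of all entries,
    which spares a pass over the table. Register 30 becomes a power of two above the deadline, the
    first stride. *)
Definition by_runs : cmd :=
  9 ::= #0;;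
  FOR 9 UPTO !2 + #1 DO 6@@[!9] ::= #0 OD;;
  30 ::= #1;;
  WHILE !30 < !2 + #1 DO 30 ::= !30 + !30 OD;;
  3 ::= #0;; 9 ::= #0;;
  WHILE !9 < !1 DO
    10 ::= 3@[!9];; 12 ::= 5@[!9];;
    gather;;
    IF #0 < !10 THEN
      IF !12 < !10 THEN Skip ELSE convolve FI
    ELSE 3 ::= !3 + 9@[!13] FI;;
    9 ::= !9 + !13
  OD;;
  0 ::= !5 - (!3 + 6@[!2]).

Close Scope prog_scope.

Lemma sumf_cut w c a : sumf (fun j => if j <? c then w j else 0) a = sumf w (min a c).
Proof.
  induction a; [reflexivity |]. cbn [sumf]. rewrite IHa. destruct (Nat.ltb_spec a c).
  - replace (min (S a) c) with (S a) by lia. replace (min a c) with a by lia. reflexivity.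
  - replace (min (S a) c) with (min a c) by lia. lia.
Qed.

(** * Correctness of the convolution programs *)

Section Convolve.

Variables (X : instance) (B : nat).
Hypothesis fw : fits_word X B.
Local Notation n := (size X).
Local Notation N := (bound X).
Local Notation D := (deadline X).

Variables (g v : nat -> nat) (c q e b0 : nat).
Hypothesis g_mono : forall t t', t <= t' -> g t <= g t'.
Hypothesis g_le : forall t, g t <= N * N.
Hypothesis v_decr : forall j k, j < k < c -> v k <= v j.
Hypothesis c_le : c <= n.
Hypothesis v_le : sumf v c <= N * N.
Hypothesis q_pos : 0 < q.
Hypothesis q_le : q <= e.
Hypothesis e_le : e <= D.
Hypothesis b0_gt : D < 2 ^ b0.
Hypothesis b0_le : 2 ^ b0 <= 2 * N.

Let v' j := if j <? c then v j else 0.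

Lemma v'_decr j k : j <= k -> v' k <= v' j.
Proof.
  intros H. unfold v'. destruct (Nat.ltb_spec k c); [| lia].
  destruct (Nat.ltb_spec j c); [| lia].
  destruct (Nat.eq_dec j k) as [-> | Hne]; auto. apply v_decr. lia.
Qed.

Lemma search_correct s K lo hi f : rg s 16 = K -> rg s 18 = lo -> rg s 19 = hi -> rg s 13 = c ->
  lo <= hi -> hi <= K -> K <= D ->
  (forall x, x <= K -> ar s 10 x = f x) -> (forall x, f x <= N * N) ->
  (forall k, k <= c -> ar s 9 k = sumf v k) ->
  runs B search s (hi + 1 - lo) (fun s' => lo <= rg s' 21 <= hi /\
    rg s' 20 = value v' f K (rg s' 21) /\ forall x, lo <= x <= hi -> value v' f K x <= rg s' 20).
Proof.
  intros R16 R18 R19 R13 Hlo Hhi HK H10 Hf H9. pose proof (word_facts X B fw) as HB.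
  unfold search. apply runs_asg_seq; [exact I | sx]. apply runs_asg_seq; [exact I | sx]. rewrite R18.
  apply runs_while with (I := fun m s' => lo <= rg s' 18 <= hi + 1 /\ m = hi + 1 - rg s' 18 /\
    ((rg s' 18 = lo /\ rg s' 20 = 0 /\ rg s' 21 = lo) \/
     (lo <= rg s' 21 < rg s' 18 /\ rg s' 20 = value v' f K (rg s' 21) /\
      forall x, lo <= x < rg s' 18 -> value v' f K x <= rg s' 20))).
  { sx. rewrite R18. repeat split; auto; lia. }
  intros m s1 F (Hx & -> & HI).
  assert (K16 : rg s1 16 = K) by (rewrite (proj1 F 16 eq_refl); auto).
  assert (K19 : rg s1 19 = hi) by (rewrite (proj1 F 19 eq_refl); auto).
  assert (K13 : rg s1 13 = c) by (rewrite (proj1 F 13 eq_refl); auto).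
  assert (A10 : forall x, x <= K -> ar s1 10 x = f x)
    by (intros; rewrite (proj2 F 10 eq_refl); sx; auto).
  assert (A9 : forall k, k <= c -> ar s1 9 k = sumf v k)
    by (intros; rewrite (proj2 F 9 eq_refl); sx; auto).
  clear F. split; [okx; rewrite K19; repeat split; auto; lia |]. sx. rewrite K19.
  remember (rg s1 18) as x eqn:Ex. symmetry in Ex.
  destruct (Nat.ltb_spec x (hi + 1)) as [Hlt | Hge]; (split; [intros Hq | intros Hq]); try lia.
  2: { destruct HI as [(? & _) | (H1 & H2 & H3)]; [lia |].
       repeat split; auto; try lia. intros y Hy. apply H3. lia. }
  exists 0. clear Hq.
  apply runs_asg_seq; [okx; auto | sx]. rewrite K16, Ex.
  apply runs_asg_seq; [okx; auto | sx]. rewrite K13.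
  replace (K - x - (K - x - c)) with (min (K - x) c) by lia.
  assert (Ev : ar s1 10 x + ar s1 9 (min (K - x) c) = value v' f K x).
  { rewrite A10, A9 by lia. unfold value, v'. now rewrite sumf_cut. }
  assert (Bv : value v' f K x <= N * N + N * N).
  { unfold value, v'. rewrite sumf_cut. pose proof (Hf x).
    pose proof (sumf_mono v (min (K - x) c) c ltac:(lia)). lia. }
  apply runs_asg_seq; [okx; rewrite Ex; repeat split; auto; try lia; rewrite Ev; lia | sx].
  rewrite Ex, Ev.
  apply runs_if_seq; [okx; auto | |]; sx; intros Hb.
  - apply runs_skip_seq. apply runs_asg; [okx; rewrite Ex; repeat split; auto; lia | sx]. rewrite Ex.
    exists (hi + 1 - (x + 1)). split; [lia |]. split; [lia |]. split; [lia |]. right.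
    destruct (Nat.ltb_spec (value v' f K x) (rg s1 20)) as [Hl |]; [| lia].
    destruct HI as [(? & ? & ?) | (H1 & H2 & H3)]; [lia |].
    repeat split; auto; try lia. intros y Hy. destruct (Nat.eq_dec y x) as [-> |]; [lia | apply H3; lia].
  - destruct (Nat.ltb_spec (value v' f K x) (rg s1 20)) as [| Hl]; [lia |].
    apply runs_seq_assoc. apply runs_asg_seq; [exact I | sx]. apply runs_asg_seq; [exact I | sx].
    apply runs_asg; [okx; rewrite Ex; repeat split; auto; lia | sx]. rewrite Ex.
    exists (hi + 1 - (x + 1)). split; [lia |]. split; [lia |]. split; [lia |]. right.
    repeat split; auto; try lia. intros y Hy. destruct (Nat.eq_dec y x) as [-> |]; auto.
    destruct HI as [(? & ? & ?) | (H1 & H2 & H3)]; [lia |]. specialize (H3 y ltac:(lia)). lia.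
Qed.

Section Residue.

Variables (r m : nat).
Hypothesis r_lt : r < q.
Hypothesis m_eq : m = (e - r) / q.

Let f x := g (r + x * q).

Lemma m_spec K : K <= m <-> r + K * q <= e.
Proof.
  assert (E : e - r = q * m + (e - r) mod q) by (rewrite m_eq; apply Nat.div_mod; lia).
  pose proof (Nat.mod_upper_bound (e - r) q ltac:(lia)). split; intros; nia.
Qed.

(* The rows that are solved while the level of stride [t] has reached row [k]. *)
Definition grid (t k K : nat) : Prop := exists u, K = t * u /\ (Nat.Even u \/ K < k).

Definition solved_grid (t k : nat) (s : st) : Prop :=
  (forall K, K <= m -> grid t k K -> solved v' f K (ar s 11 K) (ar s 6 (r + K * q))) /\
  (forall K K', K <= K' -> K' <= m -> grid t k K -> grid t k K' -> ar s 11 K <= ar s 11 K').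

Definition conv_state (s : st) : Prop :=
  (rg s 10 = q /\ rg s 13 = c /\ rg s 14 = r /\ rg s 15 = m) /\
  (forall x, x <= m -> ar s 10 x = f x) /\ (forall k, k <= c -> ar s 9 k = sumf v k).

Lemma conv_state_frame cc s s' : frame cc s s' ->
  wrr cc 10 || wrr cc 13 || wrr cc 14 || wrr cc 15 || wra cc 10 || wra cc 9 = false ->
  conv_state s -> conv_state s'.
Proof.
  rewrite !orb_false_iff. intros [F1 F2] H [HR [H1 H2]]. split; [| split].
  - rewrite !F1 by tauto. exact HR.
  - intros. rewrite F2 by tauto. auto.
  - intros. rewrite F2 by tauto. auto.
Qed.

(** Each search starts no earlier than where the preceding one ended, so the searched ranges overlap
    in at most one column and add up to at most [m] plus one per row. The invariant keeps as credit
    the columns still ahead plus three per remaining row index. *)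
Lemma level_correct s t : conv_state s -> rg s 17 = t -> 0 < t <= 2 * N ->
  solved_grid t 0 s ->
  runs B level s (4 * m + 3) (fun s' => solved_grid t (S m) s' /\
    forall x, (forall K, K <= m -> x <> r + K * q) -> ar s' 6 x = ar s 6 x).
Proof.
  intros HC R17 Ht HG. pose proof (word_facts X B fw) as HB.
  assert (Hmq : r + m * q <= e) by (apply m_spec; auto).
  assert (Hm : m <= m * q) by nia.
  unfold level. apply runs_asg_seq; [exact I | sx]. rewrite R17.
  apply runs_while with (I := fun cr s' => exists a, rg s' 16 = t * (2 * a + 1) /\
    t * (2 * a + 1) <= m + 2 * t /\
    solved_grid t (rg s' 16) s' /\
    (forall x, (forall K, K <= m -> x <> r + K * q) -> ar s' 6 x = ar s 6 x) /\
    (rg s' 16 <= m -> m - ar s' 11 (rg s' 16 - t) + 3 * (m + 1 - rg s' 16) <= cr)).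
  { sx. exists 0. split; [lia |]. split; [lia |]. split; [| split; [auto | lia]].
    destruct HG as [G1 G2].
    assert (Q : forall K, grid t t K -> grid t 0 K).
    { intros K (u & -> & [Hu | Hu]); exists u; split; auto. left. exists 0. nia. }
    split; [intros K HK HK' | intros K K' HKK HK' Ha Hb]; [apply (G1 K HK) | apply (G2 K K')]; auto. }
  intros cr s1 F (a & R16 & Ha & [G1 G2] & Hout & Hcr).
  assert (HC1 : conv_state s1) by (eapply conv_state_frame; [exact F | reflexivity | exact HC]).
  assert (K17 : rg s1 17 = t) by (rewrite (proj1 F 17 eq_refl); auto).
  clear F. destruct HC1 as [(K10 & K13 & K14 & K15) [A10 A9]].
  split; [okx; rewrite K15; repeat split; auto; lia |]. sx. rewrite K15.
  remember (rg s1 16) as k eqn:Ek. symmetry in Ek.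
  destruct (Nat.ltb_spec k (m + 1)) as [Hlt | Hge]; (split; [intros Hq | intros Hq]); try lia.
  2: { split; [split |]; auto.
       - intros K HK (u & Eu & Hu). apply G1; auto. exists u. split; auto. right. lia.
       - intros K K' HK HK' (u & Eu & Hu) (u' & Eu' & Hu'). apply G2; auto.
         + exists u. split; auto. right. lia.
         + exists u'. split; auto. right. lia. }
  clear Hq. specialize (Hcr ltac:(lia)).
  assert (Glo : grid t k (k - t)).
  { exists (2 * a). split; [nia |]. left. now exists a. }
  assert (Ghi : grid t k (k + t)).
  { exists (2 * a + 2). split; [nia |]. left. exists (a + 1). lia. }
  assert (Htk : t <= k) by nia.
  destruct (G1 (k - t) ltac:(lia) Glo) as (Olo & Vlo & Mlo).
  set (lo := ar s1 11 (k - t)) in *.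
  set (hi := if m <? k + t then k else min (ar s1 11 (k + t)) k).
  assert (Hlohi : lo <= hi /\ hi <= k).
  { unfold hi. destruct (Nat.ltb_spec m (k + t)); [lia |].
    pose proof (G2 (k - t) (k + t) ltac:(lia) ltac:(lia) Glo Ghi). fold lo in H0. lia. }
  exists (hi + 1 - lo).
  apply runs_asg_seq; [okx; rewrite Ek, K17; repeat split; auto; lia | sx]. rewrite Ek, K17. fold lo.
  apply runs_asg_seq; [exact I | sx]. rewrite Ek.
  apply runs_seq with (T1 := 0) (T2 := hi + 1 - lo); [lia |].
  eapply runs_weaken with (T := 0) (R := fun s2 => rg s2 19 = hi); [| lia |].
  { apply runs_if; [okx; rewrite Ek, K17; repeat split; auto; lia | |]; sx;
      rewrite K15, Ek, K17; intros Hb; unfold hi; destruct (Nat.ltb_spec m (k + t)); try lia.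
    - apply runs_skip. reflexivity.
    - apply runs_asg_seq; [okx; rewrite Ek, K17; repeat split; auto; lia | sx].
      rewrite Ek, K17. apply runs_asg; [okx; auto | sx]. lia. }
  intros s2 F2 R19 _.
  assert (P16 : rg s2 16 = k) by (rewrite (proj1 F2 16 eq_refl); auto).
  assert (P17 : rg s2 17 = t) by (rewrite (proj1 F2 17 eq_refl); auto).
  assert (P18 : rg s2 18 = lo) by (rewrite (proj1 F2 18 eq_refl); auto).
  assert (P13 : rg s2 13 = c) by (rewrite (proj1 F2 13 eq_refl); auto).
  assert (P10 : rg s2 10 = q) by (rewrite (proj1 F2 10 eq_refl); auto).
  assert (P14 : rg s2 14 = r) by (rewrite (proj1 F2 14 eq_refl); auto).
  assert (PA : forall kk, ar s2 kk = ar s1 kk \/ True) by auto.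
  assert (P11 : forall x, ar s2 11 x = ar s1 11 x) by (intros; now rewrite (proj2 F2 11 eq_refl)).
  assert (P6 : forall x, ar s2 6 x = ar s1 6 x) by (intros; now rewrite (proj2 F2 6 eq_refl)).
  assert (PX : forall x, x <= m -> ar s2 10 x = f x)
    by (intros; rewrite (proj2 F2 10 eq_refl); sx; auto).
  assert (P9 : forall kk, kk <= c -> ar s2 9 kk = sumf v kk)
    by (intros; rewrite (proj2 F2 9 eq_refl); sx; auto).
  clear F2 PA A10 A9.
  apply runs_seq with (T1 := hi + 1 - lo) (T2 := 0); [lia |].
  eapply runs_weaken; [apply (search_correct s2 k lo hi f); auto; try lia | lia |].
  { intros x Hx. apply PX. lia. }
  { intros x. apply g_le. }
  intros s3 F3 (Q21 & Q20 & Qm) _.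
  assert (S16 : rg s3 16 = k) by (rewrite (proj1 F3 16 eq_refl); auto).
  assert (S17 : rg s3 17 = t) by (rewrite (proj1 F3 17 eq_refl); auto).
  assert (S10 : rg s3 10 = q) by (rewrite (proj1 F3 10 eq_refl); auto).
  assert (S14 : rg s3 14 = r) by (rewrite (proj1 F3 14 eq_refl); auto).
  assert (S11 : forall x, ar s3 11 x = ar s1 11 x) by (intros; now rewrite (proj2 F3 11 eq_refl)).
  assert (S6 : forall x, ar s3 6 x = ar s1 6 x) by (intros; now rewrite (proj2 F3 6 eq_refl)).
  clear F3 P11 P6 PX P9.
  assert (Hkq : r + k * q <= e) by (apply m_spec; lia).
  set (o := rg s3 21) in *. set (yv := rg s3 20) in *.
  assert (Snew : solved v' f k o yv).
  { split; [lia |]. split; [auto |]. intros x Hx.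
    (* [K2 = k] stands for the absence of a solved row above [k]. *)
    set (K2 := if m <? k + t then k else k + t).
    destruct (solved_between v' v'_decr f k (k - t) K2 lo (ar s1 11 K2)
      (ar s1 6 (r + (k - t) * q)) (ar s1 6 (r + K2 * q))) with (x := x)
      as (x' & Hx1 & Hx2 & Hx3); auto; try lia.
    - repeat split; auto.
    - unfold K2. destruct (Nat.ltb_spec m (k + t)) as [|Hm']; [lia |]. intros _.
      split; [apply (G1 (k + t) Hm' Ghi) | apply (G2 (k - t) (k + t)); auto; lia].
    - etransitivity; [exact Hx3 |]. apply Qm. split; [lia |]. unfold hi, K2 in *.
      destruct (Nat.ltb_spec m (k + t)); [lia |]. specialize (Hx2 ltac:(lia)). lia. }
  apply runs_sto_seq; [okx; rewrite S16; repeat split; auto; lia | sx]. rewrite S16. fold o.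
  apply runs_sto_seq; [okx; rewrite S14, S16, S10; repeat split; auto; lia | sx].
  rewrite S14, S16, S10. fold yv.
  apply runs_asg; [okx; rewrite S16, S17; repeat split; auto; lia | sx]. rewrite S16, S17.
  exists (cr - (hi + 2 - lo)).
  assert (Hcr1 : hi + 2 - lo <= cr) by lia.
  split; [lia |]. exists (S a).
  split; [lia |]. split; [lia |].
  assert (Hne : forall K, K <> k -> r + K * q <> r + k * q).
  { intros K HK E. apply HK. apply (Nat.mul_cancel_r K k q); lia. }
  assert (Gin : forall K, K <= m -> grid t (k + t + t) K -> K = k \/ K <> k /\ grid t k K).
  { intros K HK (u & Eu & Hu). destruct (Nat.eq_dec K k) as [-> | Hk]; auto. right. split; auto.
    exists u. split; auto. destruct Hu as [Hu | Hu]; auto.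
    destruct (le_lt_dec u (2 * a)) as [Hu1 | Hu1].
    - right. assert (t * u <= t * (2 * a)) by (apply Nat.mul_le_mono_l; lia). lia.
    - left. exists (a + 1).
      assert (u < 2 * a + 3) by (apply (Nat.mul_lt_mono_pos_l t); lia).
      assert (u <> 2 * a + 1) by (intros ->; lia). lia. }
  split; [split |].
  - intros K HK HG1. sx. rewrite S11, S6. destruct (Gin K HK HG1) as [-> | (Hk & HG2)].
    + now rewrite !Nat.eqb_refl.
    + destruct (Nat.eqb_spec K k); [lia |].
      destruct (Nat.eqb_spec (r + K * q) (r + k * q)) as [E | _]; [exfalso; exact (Hne K Hk E) |].
      apply G1; auto.
  - assert (Glo' : forall K, K < k -> grid t k K -> K <= k - t).
    { intros K HK (u & Eu & _).
      assert (u < 2 * a + 1) by (apply (Nat.mul_lt_mono_pos_l t); lia).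
      assert (t * u <= t * (2 * a)) by (apply Nat.mul_le_mono_l; lia). lia. }
    assert (Ghi' : forall K, k < K -> grid t k K -> k + t <= K).
    { intros K HK (u & Eu & _).
      assert (2 * a + 1 < u) by (apply (Nat.mul_lt_mono_pos_l t); lia).
      assert (t * (2 * a + 2) <= t * u) by (apply Nat.mul_le_mono_l; lia). lia. }
    intros K K' HKK HK' HG1 HG2. sx. rewrite !S11.
    destruct (Gin K ltac:(lia) HG1) as [-> | (Hk & HG1')], (Gin K' HK' HG2) as [-> | (Hk' & HG2')].
    + lia.
    + rewrite Nat.eqb_refl. destruct (Nat.eqb_spec K' k); [lia |].
      specialize (Ghi' K' ltac:(lia) HG2'). pose proof (G2 (k + t) K' Ghi' HK' Ghi HG2').
      unfold hi in *. destruct (Nat.ltb_spec m (k + t)); lia.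
    + rewrite Nat.eqb_refl. destruct (Nat.eqb_spec K k); [lia |].
      specialize (Glo' K ltac:(lia) HG1'). pose proof (G2 K (k - t) Glo' ltac:(lia) HG1' Glo).
      fold lo in H. lia.
    + destruct (Nat.eqb_spec K k); [lia |]. destruct (Nat.eqb_spec K' k); [lia |]. apply G2; auto.
  - split.
    + intros x Hx. sx. destruct (Nat.eqb_spec x (r + k * q)) as [E | _].
      * exfalso. apply (Hx k); auto. lia.
      * rewrite S6. apply Hout. auto.
    + intros Hk'. replace (k + t + t - t) with (k + t) by lia. sx. rewrite S11.
      destruct (Nat.eqb_spec (k + t) k); [lia |].
      assert (hi <= ar s1 11 (k + t)) by (unfold hi; destruct (Nat.ltb_spec m (k + t)); lia). lia.
Qed.

Lemma residue_correct s : rg s 10 = q -> rg s 12 = e -> rg s 13 = c -> rg s 14 = r -> rg s 30 = 2 ^ b0 ->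
  (forall k, k <= c -> ar s 9 k = sumf v k) -> (forall K, K <= m -> ar s 6 (r + K * q) = f K) ->
  runs B residue s ((b0 + 2) * (4 * m + 4)) (fun s' =>
    (forall K, K <= m -> exists o, solved v' f K o (ar s' 6 (r + K * q))) /\
    forall x, (forall K, K <= m -> x <> r + K * q) -> ar s' 6 x = ar s 6 x).
Proof.
  intros R10 R12 R13 R14 R30 A9 A6. pose proof (word_facts X B fw) as HB.
  assert (Hmq : r + m * q <= e) by (apply m_spec; auto).
  assert (Hm : m <= m * q) by nia.
  unfold residue. apply runs_asg_seq; [okx; auto | sx]. rewrite R10, R12, R14, <- m_eq.
  apply runs_asg_seq; [exact I | sx].
  set (s1 := setr _ 16 0).
  assert (C1 : rg s1 10 = q /\ rg s1 13 = c /\ rg s1 14 = r /\ rg s1 15 = m /\ rg s1 30 = 2 ^ b0) by auto.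
  assert (H6 : ar s1 6 = ar s 6) by reflexivity. assert (H9 : ar s1 9 = ar s 9) by reflexivity.
  assert (H16 : rg s1 16 = 0) by reflexivity. clearbody s1.
  destruct C1 as (Q10 & Q13 & Q14 & Q15 & Q30).
  apply runs_seq with (T1 := m + 1) (T2 := (b0 + 1) * (4 * m + 4)); [lia |].
  apply runs_for with (lo := 0) (hi := m + 1) (T1 := 0)
    (I := fun i s => forall x, x < i -> ar s 10 x = f x); auto; try lia.
  { intros s2 F. okx. rewrite (proj1 F 15 eq_refl), Q15. repeat split; auto; lia. }
  { intros k s2 Hk F E16 HI.
    assert (K14 : rg s2 14 = r) by (rewrite (proj1 F 14 eq_refl); auto).
    assert (K10 : rg s2 10 = q) by (rewrite (proj1 F 10 eq_refl); auto).
    assert (K6 : ar s2 6 (r + k * q) = f k) by (rewrite (proj2 F 6 eq_refl), H6; apply A6; lia).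
    clear F. assert (k * q <= m * q) by (apply Nat.mul_le_mono_r; lia).
    apply runs_sto; [okx; rewrite E16, K14, K10; repeat split; auto; lia | sx].
    rewrite E16, K14, K10, K6. split; auto. intros x Hx.
    destruct (Nat.eqb_spec x k) as [-> |]; auto. apply HI. lia. }
  intros s2 F2 _ HX F2'. clear F2'.
  apply runs_sto_seq; [okx; repeat split; auto; lia | sx].
  apply runs_asg_seq; [exact I | sx].
  set (s3 := setr _ 17 _).
  assert (P10 : rg s3 10 = q) by (unfold s3; sx; rewrite (proj1 F2 10 eq_refl); auto).
  assert (P13 : rg s3 13 = c) by (unfold s3; sx; rewrite (proj1 F2 13 eq_refl); auto).
  assert (P14 : rg s3 14 = r) by (unfold s3; sx; rewrite (proj1 F2 14 eq_refl); auto).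
  assert (P15 : rg s3 15 = m) by (unfold s3; sx; rewrite (proj1 F2 15 eq_refl); auto).
  assert (P17 : rg s3 17 = 2 ^ b0) by (unfold s3; sx; rewrite (proj1 F2 30 eq_refl); auto).
  assert (PX : forall x, x <= m -> ar s3 10 x = f x) by (intros; apply HX; lia).
  assert (P9 : forall k, k <= c -> ar s3 9 k = sumf v k).
  { intros k Hk. unfold s3. sx. rewrite (proj2 F2 9 eq_refl), H9. auto. }
  assert (P6 : forall x, ar s3 6 x = ar s 6 x).
  { intros x. unfold s3. sx. rewrite (proj2 F2 6 eq_refl), H6. auto. }
  assert (P11 : ar s3 11 0 = 0) by reflexivity.
  clearbody s3. clear F2 HX Q10 Q13 Q14 Q15 Q30 H6 H9 H16 s1 s2.
  assert (C3 : conv_state s3) by (split; [auto | split; auto]).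
  (* Rows of stride [2 ^ b] are solved, and the next stride is [2 ^ b / 2], which is 0 once [b = 0].
     Initially [b = b0 + 1], and row 0 is the only multiple of [2 ^ b] up to [m]. *)
  apply runs_while with (I := fun cr s' => conv_state s' /\
    (forall x, (forall K, K <= m -> x <> r + K * q) -> ar s' 6 x = ar s 6 x) /\
    exists b, b <= b0 + 1 /\ rg s' 17 = 2 ^ b / 2 /\ solved_grid (2 ^ b) (S m) s' /\ b * (4 * m + 4) <= cr).
  { split; [exact C3 |]. split; [auto |]. exists (b0 + 1). split; [lia |].
    rewrite Nat.add_1_r. cbn [Nat.pow]. rewrite P17, Nat.mul_comm, Nat.div_mul by lia.
    split; auto. split; [| lia].
    assert (Z : forall K, K <= m -> grid (2 ^ b0 * 2) (S m) K -> K = 0).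
    { intros K HK (u & Eu & _). destruct u; [lia | nia]. }
    assert (E0 : ar s3 6 (r + 0 * q) = f 0) by (rewrite P6; apply A6; lia).
    split.
    - intros K HK HG. rewrite (Z K HK HG), P11. split; auto. split.
      + unfold value. rewrite E0. cbn. lia.
      + intros x Hx. replace x with 0 by lia. unfold value. rewrite E0. cbn. lia.
    - intros K K' HKK HK' HG HG'. rewrite (Z K), (Z K'); auto. lia. }
  intros cr s4 F4 (C4 & Hout & b & Hb & K17 & HG & Hcr).
  split; [okx; auto |]. sx. rewrite K17. clear F4.
  destruct b as [| b].
  - change (2 ^ 0 / 2) with 0. split; [| intros Hq; now contradiction Hq].
    intros _. split; auto. destruct HG as [G1 _].
    intros K HK. eexists. apply G1; auto. exists K. split; [cbn; lia | right; lia].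
  - assert (E2 : 2 ^ S b / 2 = 2 ^ b).
    { cbn [Nat.pow]. rewrite Nat.mul_comm. apply Nat.div_mul. lia. }
    rewrite E2 in *. pose proof (Nat.pow_nonzero 2 b ltac:(lia)) as Hp.
    split; [intros Hq; destruct (Nat.ltb_spec 0 (2 ^ b)); lia |]. intros _.
    exists (4 * m + 3). apply runs_seq with (T1 := 4 * m + 3) (T2 := 0); [lia |].
    eapply runs_weaken; [apply (level_correct s4 (2 ^ b)); auto | lia |].
    { split; [lia |]. transitivity (2 ^ b0); auto. apply Nat.pow_le_mono_r; lia. }
    { assert (Q : forall K, K <= m -> grid (2 ^ b) 0 K -> grid (2 ^ S b) (S m) K).
      { intros K HK (u & Eu & [[u' Hu] | Hu]); [| lia]. exists u'. split; [rewrite Eu, Hu, Nat.pow_succ_r'; lia | right; lia]. }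
      destruct HG as [G1 G2]. split.
      - intros K HK HK'. apply G1; auto.
      - intros K K' HKK HK' Ha Hb'. apply G2; auto. apply Q; auto. lia. }
    intros s5 F5 (HG5 & Hout5) _.
    assert (C5 : conv_state s5) by (eapply conv_state_frame; [exact F5 | reflexivity | exact C4]).
    assert (L17 : rg s5 17 = 2 ^ b) by (rewrite (proj1 F5 17 eq_refl); auto). clear F5.
    apply runs_asg; [okx; auto | sx]. rewrite L17.
    exists (b * (4 * m + 4)). split; [lia |]. split; [exact C5 |]. split.
    { intros x Hx. sx. rewrite Hout5; auto. }
    exists b. split; [lia |]. split; [reflexivity |]. split; [exact HG5 | lia].
Qed.

End Residue.

Lemma convolve_correct s : rg s 2 = D -> rg s 10 = q -> rg s 12 = e -> rg s 13 = c -> rg s 30 = 2 ^ b0 ->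
  (forall k, k <= c -> ar s 9 k = sumf v k) -> (forall t, t <= D -> ar s 6 t = g t) ->
  runs B convolve s ((b0 + 3) * (8 * D)) (fun s' =>
    (forall t, t <= e -> is_conv g (sumf v) c q t (ar s' 6 t)) /\
    forall t, e < t <= D -> ar s' 6 t = ar s' 6 e).
Proof.
  intros R2 R10 R12 R13 R30 A9 A6. pose proof (word_facts X B fw) as HB.
  assert (Hdiv : q * (e / q) <= e) by (apply Nat.Div0.mul_div_le).
  unfold convolve. apply runs_asg_seq; [exact I | sx].
  set (T1 := (b0 + 2) * (4 * (e / q) + 4)).
  assert (HT : q * S T1 + (D - e) <= (b0 + 3) * (8 * D)).
  (* The [q] residue classes have at most [e + q] rows in total, and [q <= e <= D]. *)
  { assert (q * (4 * (e / q) + 4) <= 8 * D) by lia.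
    assert (q * T1 <= (b0 + 2) * (8 * D)).
    { unfold T1. rewrite Nat.mul_comm, <- Nat.mul_assoc, (Nat.mul_comm _ q). now apply Nat.mul_le_mono_l. }
    rewrite Nat.mul_succ_r. lia. }
  set (s1 := setr s 14 0).
  assert (Q2 : rg s1 2 = D) by exact R2. assert (Q10 : rg s1 10 = q) by exact R10.
  assert (Q12 : rg s1 12 = e) by exact R12. assert (Q13 : rg s1 13 = c) by exact R13.
  assert (Q30 : rg s1 30 = 2 ^ b0) by exact R30.
  assert (B9 : forall k, k <= c -> ar s1 9 k = sumf v k) by exact A9.
  assert (B6 : forall t, t <= D -> ar s1 6 t = g t) by exact A6.
  assert (Q14 : rg s1 14 = 0) by reflexivity. clearbody s1. clear R2 R10 R12 R13 R30 A9 A6 s.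
  apply runs_seq with (T1 := q * S T1) (T2 := D - e); [exact HT |].
  apply runs_for with (lo := 0) (hi := q) (T1 := T1)
    (I := fun i s => forall t, t <= e ->
       if t mod q <? i then is_conv g (sumf v) c q t (ar s 6 t) else ar s 6 t = g t); auto; try lia.
  { intros t Ht. destruct (Nat.ltb_spec (t mod q) 0); [lia |]. apply B6. lia. }
  { intros s2 F. split; [exact I |]. rewrite <- Q10. exact (proj1 F 10 eq_refl). }
  { intros r s2 Hr F E14 HI. set (m := (e - r) / q).
    assert (Hm : m <= e / q) by (apply Nat.Div0.div_le_mono; lia).
    assert (Spec : forall K, K <= m <-> r + K * q <= e) by (intros; apply m_spec; auto; lia).
    eapply runs_weaken; [apply (residue_correct r m) | |]; auto; try lia.
    - rewrite (proj1 F 10 eq_refl). auto.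
    - rewrite (proj1 F 12 eq_refl). auto.
    - rewrite (proj1 F 13 eq_refl). auto.
    - rewrite (proj1 F 30 eq_refl). auto.
    - intros k Hk. rewrite (proj2 F 9 eq_refl). auto.
    - intros K HK. specialize (HI (r + K * q) ltac:(apply Spec; auto)).
      rewrite Nat.Div0.mod_add, Nat.mod_small in HI by lia.
      destruct (Nat.ltb_spec r r); [lia | auto].
    - unfold T1. apply Nat.mul_le_mono_l. lia.
    - intros s3 F3 (HK & Hout). split; [rewrite (proj1 F3 14 eq_refl); auto |].
      intros t Ht. sx.
      assert (Dt : t = t mod q + t / q * q).
      { pose proof (Nat.div_mod t q ltac:(lia)). lia. }
      destruct (Nat.eq_dec (t mod q) r) as [Er | Hne].
      + destruct (Nat.ltb_spec (t mod q) (S r)); [| lia].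
        rewrite Er in Dt. destruct (HK (t / q)) as (o & Ho); [apply Spec; lia |].
        rewrite <- Dt in Ho.
        pose proof (solved_conv g v c q r (t / q) o _ g_mono q_pos Ho ltac:(lia)) as Hc.
        now rewrite <- Dt in Hc.
      + rewrite Hout.
        * specialize (HI t Ht). destruct (Nat.ltb_spec (t mod q) (S r)), (Nat.ltb_spec (t mod q) r); auto; lia.
        * intros K _ E. apply Hne. rewrite E, Nat.Div0.mod_add. apply Nat.mod_small. lia. }
  intros s2 F2 _ HI F2'. clear F2'.
  apply runs_asg_seq; [okx; rewrite (proj1 F2 12 eq_refl), Q12; repeat split; auto; lia | sx].
  assert (P2 : rg s2 2 = D) by (rewrite (proj1 F2 2 eq_refl); auto).
  assert (P12 : rg s2 12 = e) by (rewrite (proj1 F2 12 eq_refl); auto).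
  rewrite P12. clear F2.
  apply runs_for with (lo := e + 1) (hi := D + 1) (T1 := 0)
    (I := fun i s => (forall t, t <= e -> ar s 6 t = ar s2 6 t) /\
       forall t, e < t < i -> ar s 6 t = ar s2 6 e); auto; try lia.
  { split; auto. intros; lia. }
  { intros s3 F. okx. rewrite (proj1 F 2 eq_refl). sx. rewrite P2. repeat split; auto; lia. }
  { intros k s3 Hk F E16 [H1 H2].
    assert (K12 : rg s3 12 = e) by (rewrite (proj1 F 12 eq_refl); auto). clear F.
    apply runs_sto; [okx; rewrite E16, K12; repeat split; auto; lia | sx].
    rewrite E16, K12. split; auto. split.
    - intros t Ht. destruct (Nat.eqb_spec t k); [lia | auto].
    - intros t Ht. destruct (Nat.eqb_spec t k) as [-> |]; [apply H1; auto | apply H2; lia]. }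
  intros s3 F _ [H1 H2]. split.
  - intros t Ht. rewrite H1 by auto. specialize (HI t Ht).
    pose proof (Nat.mod_upper_bound t q ltac:(lia)). destruct (Nat.ltb_spec (t mod q) q); [auto | lia].
  - intros t Ht. rewrite H2, H1 by lia. reflexivity.
Qed.

End Convolve.

(** * The table after each run *)

Section Runs.

Variables (X : instance) (B : nat).
Hypothesis fw : fits_word X B.
Local Notation n := (size X).
Local Notation N := (bound X).
Local Notation D := (deadline X).
Local Notation p := (time_of X).
Local Notation w := (value_of X).
Local Notation d := (due_of X).

Hypothesis lex : forall i j, i < j < n ->
  d i < d j \/ d i = d j /\ (p i < p j \/ p i = p j /\ w j <= w i).

Definition same (i j : nat) : Prop := p j = p i /\ d j = d i.

Lemma values_bound i c : i + c <= n -> sumf (fun j => w (i + j)) c <= c * heaviest X.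
Proof.
  induction c; intros H; [cbn; lia |]. cbn [sumf].
  pose proof (value_le _ _ fw (i + c) ltac:(lia)). specialize (IHc ltac:(lia)). lia.
Qed.

Definition run_of (i c : nat) : Prop :=
  1 <= c /\ i + c <= n /\ (forall j, j < c -> same i (i + j)) /\ (i + c < n -> ~ same i (i + c)).

Lemma run_exists i : i < n -> exists c, run_of i c.
Proof.
  intros Hi.
  assert (G : forall k, i + S k <= n -> (forall j, j < S k -> same i (i + j)) \/ exists c, run_of i c).
  { induction k; intros Hk.
    - left. intros j Hj. replace (i + j) with i by lia. now split.
    - destruct IHk as [H | H]; [lia | | auto].
      destruct (Nat.eq_dec (p (i + S k)) (p i)) as [Ep | Ep], (Nat.eq_dec (d (i + S k)) (d i)) as [Ed | Ed].
      1: { left. intros j Hj. destruct (Nat.eq_dec j (S k)) as [-> |]; [now split | apply H; lia]. }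
      all: right; exists (S k); repeat split; auto; try lia; try apply H; auto; intros _ [? ?]; auto. }
  destruct (G (n - i - 1) ltac:(lia)) as [H | H]; auto.
  exists (n - i). replace (S (n - i - 1)) with (n - i) in H by lia. repeat split; auto; try lia; now apply H.
Qed.

Lemma gather_correct s i c : loaded X s -> i < n -> run_of i c ->
  rg s 9 = i -> rg s 10 = p i -> rg s 12 = d i ->
  runs B gather s c (fun s' => rg s' 13 = c /\
    forall k, k <= c -> ar s' 9 k = sumf (fun j => w (i + j)) k).
Proof.
  intros HL Hi (Hc1 & Hcn & Hs & Hns) R9 R10 R12. pose proof (word_facts X B fw) as HB.
  unfold gather. apply runs_asg_seq; [exact I | sx].
  apply runs_sto_seq; [okx; repeat split; auto; lia | sx].
  set (s1 := seta _ _ _ _).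
  assert (HL1 : loaded X s1) by exact HL.
  assert (Q9 : rg s1 9 = i) by exact R9. assert (Q10 : rg s1 10 = p i) by exact R10.
  assert (Q12 : rg s1 12 = d i) by exact R12. assert (Q13 : rg s1 13 = 0) by reflexivity.
  assert (A9 : ar s1 9 0 = 0) by reflexivity. clearbody s1. clear HL R9 R10 R12 s.
  apply runs_while with (I := fun cr s' => rg s' 13 <= c /\ cr = c - rg s' 13 /\
    forall k, k <= rg s' 13 -> ar s' 9 k = sumf (fun j => w (i + j)) k).
  { rewrite Q13. repeat split; auto; try lia. intros k Hk. replace k with 0 by lia. auto. }
  intros cr s2 F (Hk & -> & HA).
  assert (K9 : rg s2 9 = i) by (rewrite (proj1 F 9 eq_refl); auto).
  assert (K10 : rg s2 10 = p i) by (rewrite (proj1 F 10 eq_refl); auto).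
  assert (K12 : rg s2 12 = d i) by (rewrite (proj1 F 12 eq_refl); auto).
  keep_loaded F. destruct F as [(E1 & _) GA].
  remember (rg s2 13) as k eqn:Ek. symmetry in Ek.
  split.
  { okx. rewrite K9, Ek. repeat split; auto; try lia;
      repeat match goal with |- context [if ?b then _ else _] => destruct b end; lia. }
  sx. rewrite K9, Ek, E1, K10, K12.
  destruct (Nat.eq_dec k c) as [-> | Hne].
  - assert (Z : (if i + c <? n then 1 else 0) *
      ((if ar s2 3 (i + c) =? p i then 1 else 0) * (if ar s2 5 (i + c) =? d i then 1 else 0)) = 0).
    { destruct (Nat.ltb_spec (i + c) n) as [Hl | Hl]; [| reflexivity].
      destruct (GA (i + c) Hl) as (-> & _ & ->). specialize (Hns Hl). unfold same in Hns.
      destruct (Nat.eqb_spec (p (i + c)) (p i)), (Nat.eqb_spec (d (i + c)) (d i)); auto. exfalso. auto. }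
    rewrite Z. split; [| intros; lia]. intros _. split; auto.
  - destruct (GA (i + k) ltac:(lia)) as (-> & Ew & ->). destruct (Hs k ltac:(lia)) as (-> & ->).
    rewrite !Nat.eqb_refl. destruct (Nat.ltb_spec (i + k) n) as [Hl | Hl]; [| lia].
    cbn [Nat.mul Nat.add]. split; [intros; lia |]. intros _. exists 0.
    pose proof (values_bound i k ltac:(lia)) as Bv.
    pose proof (value_le _ _ fw (i + k) Hl) as Bw.
    assert (k * heaviest X <= n * heaviest X) by (apply Nat.mul_le_mono_r; lia).
    apply runs_sto_seq; [okx; rewrite K9, Ek, Ew, HA by auto; repeat split; auto; lia | sx].
    rewrite K9, Ek, Ew, (HA k) by auto.
    apply runs_asg; [okx; rewrite Ek; repeat split; auto; lia | sx]. rewrite Ek, Nat.add_1_r.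
    exists (c - S k). repeat split; auto; try lia.
    intros j Hj. destruct (Nat.eqb_spec j (S k)) as [-> |]; [reflexivity | apply HA; lia].
Qed.

Variables (groups logb : nat).
Hypothesis log_le : N <= 2 ^ logb.
Hypothesis groups_max : forall V, NoDup V ->
  (forall x, In x V -> exists j, j < n /\ x = (p j, d j) /\ 1 <= p j) -> length V <= groups.

(** A constant offset passes through the maximum, so the weight of the jobs of time 0 can stay
    outside the table. *)
Lemma is_conv_shift f f' S c q t u z : (forall y, y <= t -> f y = z + f' y) ->
  is_conv f S c q t u -> forall u', is_conv f' S c q t u' -> u = z + u'.
Proof.
  intros Hz H u' [U (k & Hk & Hkt & E)]. apply (is_conv_unique f S c q t); auto. split.
  - intros k' Hk' Hkt'. specialize (U k' Hk' Hkt'). rewrite Hz by lia. lia.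
  - exists k. rewrite Hz by lia. lia.
Qed.

(** Convolutions are charged to distinct pairs of positive processing time and due date; [V] lists
    those already met. In sorted order a pair does not recur after its run, so every run of positive
    time extends [V], and [groups] bounds their number. *)
Lemma by_runs_correct s : loaded X s ->
  runs B by_runs s (D + 1 + logb + 2 * n + groups * ((logb + 3) * (8 * D)))
    (fun s' => rg s' 0 = gross X - best p w d n D).
Proof.
  intros HL. pose proof (word_facts X B fw) as HB.
  pose proof (due_le _ _ fw) as d_leD. pose proof (due_mono _ _ fw) as d_mon.
  unfold by_runs. apply runs_asg_seq; [exact I | sx].
  assert (HL1 : loaded X (setr s 9 0)) by exact HL.
  assert (K9 : rg (setr s 9 0) 9 = 0) by reflexivity.
  set (s1 := setr s 9 0) in *. clearbody s1. clear HL s.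
  apply runs_seq with (T1 := D + 1) (T2 := logb + 2 * n + groups * ((logb + 3) * (8 * D))); [lia |].
  apply runs_for with (lo := 0) (hi := D + 1) (T1 := 0)
    (I := fun i s => forall t, t < i -> ar s 6 t = 0); auto; try lia.
  { intros s2 F. keep_loaded F. destruct F as [(? & E & _) _].
    okx. rewrite E. repeat split; auto; lia. }
  { intros k s2 Hk F E9 HA. apply runs_sto; [okx; rewrite E9; repeat split; auto; lia | sx].
    rewrite E9. split; auto. intros t Ht. destruct (Nat.eqb_spec t k); auto. apply HA. lia. }
  intros s2 F _ HA F'. clear F'. keep_loaded F.
  apply runs_asg_seq; [exact I | sx].
  assert (HL2 : loaded X (setr s2 30 1)) by exact F.
  assert (A6 : forall t, t < D + 1 -> ar (setr s2 30 1) 6 t = 0) by exact HA.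
  assert (K30 : rg (setr s2 30 1) 30 = 1) by reflexivity.
  set (s3 := setr s2 30 1) in *. clearbody s3. clear F HA s2 HL1 K9 s1.
  apply runs_seq with (T1 := logb) (T2 := 2 * n + groups * ((logb + 3) * (8 * D))); [lia |].
  apply runs_while with (I := fun cr s' => exists a, rg s' 30 = 2 ^ a /\ 2 ^ a <= 2 * N /\
    a <= logb /\ cr = logb - a).
  { exists 0. rewrite K30. cbn. lia. }
  intros cr s4 F (a & E30 & Ha & Hal & ->). assert (F' := F). keep_loaded F.
  destruct (proj1 F) as (G1 & G2 & G4 & G5).
  split; [okx; rewrite G2; repeat split; auto; lia |]. sx. rewrite G2, E30.
  destruct (Nat.ltb_spec (2 ^ a) (D + 1)) as [Hlt | Hge]; (split; [intros Hq | intros Hq]); try lia.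
  { clear Hq F'. exists 0. assert (a < logb).
    { destruct (le_lt_dec logb a) as [Hl |]; auto. pose proof (Nat.pow_le_mono_r 2 logb a ltac:(lia) Hl). lia. }
    apply runs_asg; [okx; rewrite E30; repeat split; auto; lia | sx]. rewrite E30.
    exists (logb - S a). split; [lia |]. exists (S a). cbn [Nat.pow]. lia. }
  clear Hq. intros F4.
  assert (B6 : forall t, t < D + 1 -> ar s4 6 t = 0)
    by (intros; rewrite (proj2 F' 6 eq_refl); auto).
  clear F' F4 A6 HL2 K30 s3.
  do 2 (apply runs_asg_seq; [exact I | sx]).
  set (s5 := setr _ 9 0).
  assert (HL5 : loaded X s5) by exact F.
  assert (Q3 : rg s5 3 = 0) by reflexivity. assert (Q9 : rg s5 9 = 0) by reflexivity.
  assert (Q30 : rg s5 30 = 2 ^ a) by exact E30.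
  assert (C6 : forall t, t < D + 1 -> ar s5 6 t = 0) by exact B6.
  clearbody s5. clear B6 F G1 G2 G4 G5 E30 s4.
  set (TC := (logb + 3) * (8 * D)).
  apply runs_seq with (T1 := 2 * n + groups * TC) (T2 := 0); [lia |].
  apply runs_while with (I := fun cr s' => rg s' 9 <= n /\
    (rg s' 9 < n -> forall j, j < rg s' 9 -> ~ same j (rg s' 9)) /\
    (forall t, t <= D -> best p w d (rg s' 9) t = rg s' 3 + ar s' 6 t) /\
    exists V, NoDup V /\
      (forall x, In x V -> exists j, j < rg s' 9 /\ x = (p j, d j) /\ 1 <= p j) /\
      2 * (n - rg s' 9) + (groups - length V) * TC <= cr).
  { rewrite Q9, Q3. split; [lia |]. split; [intros; lia |]. split.
    - intros t Ht. rewrite C6 by lia. reflexivity.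
    - exists []. split; [constructor |]. split; [intros x []|]. cbn [length]. rewrite !Nat.sub_0_r. lia. }
  intros cr s6 F (Hin & Hb & HG & V & NV & HV & Hcr).
  assert (P30 : rg s6 30 = 2 ^ a) by (rewrite (proj1 F 30 eq_refl); auto).
  keep_loaded F. destruct (proj1 F) as (G1 & G2 & G4 & G5).
  remember (rg s6 9) as i eqn:P9. symmetry in P9.
  split; [okx; auto |]. sx. rewrite G1, P9.
  destruct (Nat.ltb_spec i n) as [Hi | Hi]; (split; [intros Hq | intros Hq]); try lia.
  2: { intros _. replace i with n in HG by lia.
       pose proof (opt_bound X B fw n D (le_n _)) as Bo. specialize (HG D (le_n _)).
       assert (n * heaviest X <= N * N) by lia.
       apply runs_asg; [okx; rewrite G2; repeat split; auto; lia | sx].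
       rewrite G2, G5, HG. reflexivity. }
  clear Hq. destruct (run_exists i Hi) as (c & Hrun). assert (Hrun' := Hrun).
  destruct Hrun as (Hc1 & Hcn & Hs & Hns).
  destruct (proj2 F i Hi) as (Ep & Ew & Ed).
  (* In lexicographic order everything between two equal pairs is equal to them, so a later
     recurrence would contradict the maximality of the run. *)
  assert (Hnext : i + c < n -> forall j, j < i + c -> ~ same j (i + c)).
  { intros Hl j Hj [Sp Sd]. specialize (Hns Hl). apply Hns.
    destruct (le_lt_dec i j) as [Hij | Hij].
    - destruct (Hs (j - i) ltac:(lia)) as [Tp Td]. replace (i + (j - i)) with j in * by lia.
      split; lia.
    - pose proof (lex j i ltac:(lia)). pose proof (lex i (i + c) ltac:(lia)). unfold same. lia. }
  assert (Bc : forall k, k <= c -> sumf (fun j => w (i + j)) k <= N * N).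
  { intros k Hk. pose proof (values_bound i k ltac:(lia)).
    assert (k * heaviest X <= n * heaviest X) by (apply Nat.mul_le_mono_r; lia). lia. }
  set (gs := sumf (fun j => w (i + j))) in *.
  set (spend := if (1 <=? p i) && (p i <=? d i) then TC else 0).
  exists (c + spend).
  apply runs_asg_seq; [okx; rewrite P9; repeat split; auto; lia | sx]. rewrite P9, Ep.
  apply runs_asg_seq; [okx; rewrite P9; repeat split; auto; lia | sx]. rewrite P9, Ed.
  set (s7 := setr _ 12 _).
  assert (L7 : loaded X s7) by exact F.
  assert (U9 : rg s7 9 = i) by exact P9. assert (U10 : rg s7 10 = p i) by reflexivity.
  assert (U12 : rg s7 12 = d i) by reflexivity. assert (U30 : rg s7 30 = 2 ^ a) by exact P30.
  assert (U3 : rg s7 3 = rg s6 3) by reflexivity. assert (U6 : forall t, ar s7 6 t = ar s6 6 t) by reflexivity.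
  clearbody s7. clear F G1 G2 G4 G5 P30 Ep Ew Ed.
  apply runs_seq with (T1 := c) (T2 := spend); [lia |].
  eapply runs_weaken; [apply (gather_correct s7 i c); auto | lia |].
  intros s8 F8 (V13 & V9a) _.
  assert (V9 : rg s8 9 = i) by (rewrite (proj1 F8 9 eq_refl); auto).
  assert (V10 : rg s8 10 = p i) by (rewrite (proj1 F8 10 eq_refl); auto).
  assert (V12 : rg s8 12 = d i) by (rewrite (proj1 F8 12 eq_refl); auto).
  assert (V30 : rg s8 30 = 2 ^ a) by (rewrite (proj1 F8 30 eq_refl); auto).
  assert (V3 : rg s8 3 = rg s6 3) by (rewrite (proj1 F8 3 eq_refl); auto).
  assert (V6 : forall t, ar s8 6 t = ar s6 6 t) by (intros; rewrite (proj2 F8 6 eq_refl); auto).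
  keep_loaded F8. clear L7 U9 U10 U12 U30 U3 U6 s7.
  assert (HZ : forall t, t <= D -> rg s6 3 + ar s6 6 t <= N * N).
  { intros t Ht. rewrite <- HG by auto. pose proof (opt_bound X B fw i t Hin). lia. }
  assert (Next : forall s9, rg s9 9 = i -> rg s9 13 = c ->
    (forall t, t <= D -> best p w d (i + c) t = rg s9 3 + ar s9 6 t) ->
    runs B (Asg 9 (Bin AAdd (Var 9) (Var 13))) s9 0 (fun s' => exists n', S (n' + (c + spend)) <= cr /\
      rg s' 9 <= n /\
      (rg s' 9 < n -> forall j, j < rg s' 9 -> ~ same j (rg s' 9)) /\
      (forall t, t <= D -> best p w d (rg s' 9) t = rg s' 3 + ar s' 6 t) /\
      exists V, NoDup V /\
        (forall x, In x V -> exists j, j < rg s' 9 /\ x = (p j, d j) /\ 1 <= p j) /\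
        2 * (n - rg s' 9) + (groups - length V) * TC <= n')).
  { intros s9 R9 R13 R6.
    apply runs_asg; [okx; rewrite R9, R13; repeat split; auto; lia | sx]. rewrite R9, R13.
    exists (cr - S (c + spend)).
    assert (Hnew : exists V', NoDup V' /\
        (forall x, In x V' -> exists j, j < i + c /\ x = (p j, d j) /\ 1 <= p j) /\
        (groups - length V') * TC + spend <= (groups - length V) * TC).
    { unfold spend. destruct (Nat.leb_spec 1 (p i)) as [Hp1 | Hp1]; cbn [andb].
      - exists ((p i, d i) :: V).
        assert (NV' : NoDup ((p i, d i) :: V)).
        { constructor; auto. intros Hx. destruct (HV _ Hx) as (j & Hj & E & _). injection E as E1 E2.
          apply (Hb Hi j Hj). split; auto. }
        assert (HV' : forall x, In x ((p i, d i) :: V) -> exists j, j < i + c /\ x = (p j, d j) /\ 1 <= p j).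
        { intros x [<- | Hx]; [exists i; repeat split; auto; lia |].
          destruct (HV x Hx) as (j & Hj & E). exists j. split; auto. lia. }
        split; auto. split; auto.
        assert (Hlen : S (length V) <= groups).
        { apply (groups_max _ NV'). intros x Hx. destruct (HV' x Hx) as (j & Hj & E).
          exists j. split; auto. lia. }
        cbn [length]. replace (groups - length V) with (S (groups - S (length V))) by lia.
        destruct (p i <=? d i); lia.
      - exists V. split; auto. split; [| lia]. intros x Hx. destruct (HV x Hx) as (j & Hj & E).
        exists j. split; auto. lia. }
    destruct Hnew as (V' & NV' & HV' & Hle).
    assert (Hfit : S (c + spend) + (2 * (n - (i + c)) + (groups - length V') * TC) <= cr) by lia.
    assert (Hfit' : S (c + spend) <= cr) by (eapply Nat.le_trans; [apply Nat.le_add_r | exact Hfit]).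
    split; [lia |]. split; [lia |]. split; [exact Hnext |]. split; [exact R6 |].
    exists V'. split; auto. split; auto. lia. }
  assert (Hrp : forall j, j < c -> p (i + j) = p i /\ d (i + j) = d i) by (intros j Hj; apply Hs; auto).
  apply runs_seq with (T1 := spend) (T2 := 0); [lia |].
  pose proof (time_lt _ _ fw i Hi) as Bp. pose proof (d_leD i Hi) as Bd.
  eapply runs_weaken with (T := spend) (R := fun s9 => rg s9 9 = i /\ rg s9 13 = c /\
    forall t, t <= D -> best p w d (i + c) t = rg s9 3 + ar s9 6 t); [| lia |].
  2: { intros s9 _ (H1 & H2 & H3) _. apply Next; auto. }
  clear Next Hnext HV NV Hcr V.
  apply runs_if; [okx; auto | |]; sx; rewrite V10; intros Hq.
  - destruct (Nat.ltb_spec 0 (p i)) as [Hp |]; [| lia]. clear Hq.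
    apply runs_if; [okx; auto | |]; sx; rewrite V10, V12; intros Hq.
    + destruct (Nat.ltb_spec (d i) (p i)) as [Hlate |]; [| lia].
      apply runs_skip. repeat split; auto. intros t Ht.
      rewrite best_late_run, V3, V6 by (intros j Hj; destruct (Hrp j Hj); lia). auto.
    + destruct (Nat.ltb_spec (d i) (p i)) as [| Hpd]; [lia |].
      (* What array 6 holds: the table without the offset in register 3. *)
      set (g := fun t => best p w d i t - rg s6 3).
      assert (Hsp : spend = TC).
      { unfold spend. destruct (Nat.leb_spec 1 (p i)); [| lia]. destruct (Nat.leb_spec (p i) (d i)); [auto | lia]. }
      assert (Ha2 : a <= logb) by auto.
      eapply runs_weaken;
        [apply (convolve_correct X B fw g (fun j => w (i + j)) c (p i) (d i) a) | |]; auto; try lia.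
      * intros t t' Htt. unfold g. pose proof (best_mono p w d i t t' Htt). lia.
      * intros t. unfold g. pose proof (opt_bound X B fw i t Hin). lia.
      * intros j k Hjk. destruct (Hrp j ltac:(lia)) as [Tp Td]. destruct (Hrp k ltac:(lia)) as [Tp' Td'].
        pose proof (lex (i + j) (i + k) ltac:(lia)). lia.
      * apply F8.
      * intros t Ht. unfold g. rewrite V6, HG by auto. lia.
      * rewrite Hsp. unfold TC. apply Nat.mul_le_mono_r. lia.
      * intros s9 F9 (Hconv & Hflat).
        assert (W3 : rg s9 3 = rg s6 3) by (rewrite (proj1 F9 3 eq_refl); auto).
        assert (Low : forall t, t <= d i -> best p w d (i + c) t = rg s6 3 + ar s9 6 t).
        { intros t Ht.
          apply (is_conv_shift (best p w d i) g gs c (p i) t); auto.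
          - intros y Hy. unfold g. rewrite HG by lia. lia.
          - apply best_run with (e := d i); auto.
            + intros j Hj. apply d_mon. lia.
            + intros j k Hjk. destruct (Hrp j ltac:(lia)) as [Tp Td]. destruct (Hrp k ltac:(lia)) as [Tp' Td'].
              pose proof (lex (i + j) (i + k) ltac:(lia)). lia. }
        split; [rewrite (proj1 F9 9 eq_refl); auto |]. split; [rewrite (proj1 F9 13 eq_refl); auto |].
        intros t Ht. rewrite W3. destruct (le_lt_dec t (d i)) as [Hd | Hd]; auto.
        rewrite Hflat by lia. rewrite <- Low by lia.
        rewrite (best_cap p w d (d i)); [f_equal; lia |].
        intros j Hj. destruct (le_lt_dec i j).
        -- destruct (Hrp (j - i) ltac:(lia)) as [_ Td]. replace (i + (j - i)) with j in Td by lia. lia.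
        -- apply d_mon. lia.
  - destruct (Nat.ltb_spec 0 (p i)) as [| Hp]; [lia |].
    specialize (HZ 0 ltac:(lia)) as HZ0. specialize (Bc c (le_n _)) as Bcc.
    apply runs_asg; [okx; rewrite V3, V13, V9a by auto; fold gs; repeat split; auto; lia | sx].
    rewrite V3, V13, V9a by auto. fold gs. repeat split; auto. intros t Ht.
    rewrite best_free_run.
    + fold gs. rewrite HG, V6 by auto. lia.
    + intros j k Hjk. apply d_mon. lia.
    + intros j Hj. destruct (Hrp j Hj). lia.
Qed.

End Runs.

(** * Assembly *)

(** If all processing times are 0, every job is early and the answer is 0. This case is separate
    because the bound then contains no [dmax], while initialising the table costs [dmax + 1]. *)
Definition solve_by_runs : cmd :=
  (front;; IF #0 < !3 THEN by_runs ELSE 0 ::= #0 FI)%prog.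

(** In the second branch [dmax <= n + min dmax (wmax ^ 2)], so the table over time costs at most
    about n times that; in the first, the minimum is [wmax ^ 2], the order of the window width. *)
Definition solve_by_weight : cmd :=
  (front;; IF !1 + !4 * !4 < !2 THEN greedy;; window ELSE lawler_moore FI)%prog.

Lemma dnum_pos (J : list job) : J <> [] -> 1 <= dnum J.
Proof.
  intros HJ. unfold dnum. destruct J as [| j J']; [congruence |].
  assert (H : In (due j) (nodup Nat.eq_dec (map due (j :: J')))) by (apply nodup_In; now left).
  destruct (nodup Nat.eq_dec (map due (j :: J'))); [destruct H | simpl; lia].
Qed.

Lemma log_pos (J : list job) : 1 <= logN J /\ inputN J <= 2 ^ logN J.
Proof.
  unfold logN. split; [lia |]. rewrite Nat.add_1_r. apply Nat.lt_le_incl, Nat.log2_spec.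
  unfold inputN. lia.
Qed.

(** If [n <= D], the factor [n] is traded for [D]; otherwise the minimum is at most [n]. *)
Lemma min_le_square n D W : n * min D (W ^ 2) <= n ^ 2 + D * W ^ 2.
Proof.
  rewrite !Nat.pow_2_r. destruct (le_lt_dec n D) as [H | H].
  - assert (n * min D (W * W) <= D * (W * W)) by (apply Nat.mul_le_mono; lia). lia.
  - assert (n * min D (W * W) <= n * n) by (apply Nat.mul_le_mono; lia). lia.
Qed.

(** With [m] the minimum, [n * m] is at most [n * n] or at most [m * m]. Of the four factors in the
    square of [m * m], three are bounded by [D] and one by [W * W], which for positive [W] is at
    most [W ^ 3]. *)
Lemma min_le_sqrt k n D W : 1 <= k ->
  n * min D (W ^ 2) <= n ^ 2 + k * Nat.sqrt_up ((D * W) ^ 3).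
Proof.
  intros Hk. rewrite !Nat.pow_2_r. set (m := min D (W * W)).
  destruct (le_lt_dec m n) as [H | H].
  - assert (n * m <= n * n) by (apply Nat.mul_le_mono_l; auto). lia.
  - assert (H1 : n * m <= m * m) by (apply Nat.mul_le_mono_r; lia).
    assert (HW : 1 <= W) by (destruct W; [unfold m in H; lia | lia]).
    assert (H2 : m * m * (m * m) <= (D * W) ^ 3).
    { assert (m <= D /\ m <= W * W) as [Ha Hb] by (unfold m; lia).
      replace ((D * W) ^ 3) with (D * D * (D * (W * W * W))) by (cbn; ring).
      apply Nat.mul_le_mono; [now apply Nat.mul_le_mono |].
      apply Nat.mul_le_mono; auto. nia. }
    assert (H3 : m * m <= Nat.sqrt_up ((D * W) ^ 3)).
    { rewrite <- (Nat.sqrt_square (m * m)).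
      etransitivity; [apply Nat.sqrt_le_mono; exact H2 |]. apply Nat.le_sqrt_sqrt_up. }
    nia.
Qed.

Section Assembly.

Variables (J : list job) (B : nat).
Local Notation n := (length J).
Local Notation N := (inputN J).
Local Notation D := (dmax J).
Local Notation W := (wmax J).
Local Notation L := (logN J).
Hypothesis J_ne : J <> [].
Hypothesis big : N ^ 16 <= B.

Definition instance_of (K : list job) : instance :=
  Instance n N D W (total J) (pj K) (wj K) (dj K).

Lemma perm_bounds K j : Permutation J K -> pj K j <= pmax J /\ wj K j <= wmax J /\ dj K j <= dmax J.
Proof.
  intros HP.
  assert (E : forall f, list_max (map f K) = list_max (map f J)).
  { intros f. apply Nat.le_antisymm; apply list_max_le, Forall_forall; intros x Hx;
      apply in_map_iff in Hx as (a & <- & Ha); apply list_max_ge, in_map;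
      eapply Permutation_in; try exact Ha; [now symmetry | auto]. }
  pose proof (fields_bound K j) as H. unfold pmax, wmax, dmax in *. now rewrite !E in H.
Qed.

Lemma due_sorted K : sorted_jobs J K -> forall i j, i <= j < n -> dj K i <= dj K j.
Proof.
  intros [_ H] i j Hij. destruct (Nat.eq_dec i j) as [-> |]; auto. specialize (H i j ltac:(lia)). lia.
Qed.

Lemma instance_fits K : sorted_jobs J K -> fits_word (instance_of K) B.
Proof.
  intros HS. pose proof (B_lin J B big) as HB. pose proof (n_pos J B J_ne big).
  assert (HN : N = n + D + pmax J + W + 2) by reflexivity.
  constructor; cbn; try lia.
  - intros j _. pose proof (perm_bounds K j (proj1 HS)). lia.
  - intros j _. apply (perm_bounds K j (proj1 HS)).
  - intros j _. apply (perm_bounds K j (proj1 HS)).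
  - now apply due_sorted.
Qed.

Lemma best_is_opt K : sorted_jobs J K -> is_opt_value J (total J - best (pj K) (wj K) (dj K) n D).
Proof.
  intros HS. assert (E : n = length K) by (apply Permutation_length, HS).
  pose proof (due_sorted K HS) as Hd. rewrite E in *.
  apply opt_of_early_opt with (L := K); auto; [apply HS |].
  apply early_opt_best; auto. intros j _. apply (perm_bounds K j (proj1 HS)).
Qed.

Lemma groups_bound K : sorted_jobs J K -> forall V, NoDup V ->
  (forall x, In x V -> exists j, j < n /\ x = (pj K j, dj K j) /\ 1 <= pj K j) ->
  length V <= dnum J * pmax J.
Proof.
  intros HS V NV HV.
  apply NoDup_incl_length with (l' := list_prod (seq 1 (pmax J)) (nodup Nat.eq_dec (map due J))) in NV.
  { rewrite length_prod, length_seq in NV. unfold dnum. lia. }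
  intros x Hx. destruct (HV x Hx) as (j & Hj & -> & Hp). apply in_prod.
  - apply in_seq. pose proof (perm_bounds K j (proj1 HS)). lia.
  - apply nodup_In. unfold dj. apply in_map. eapply Permutation_in; [symmetry; apply HS |].
    apply nth_In. rewrite <- (Permutation_length (proj1 HS)). exact Hj.
Qed.

Lemma solve_by_runs_correct s : rg s 1 = n -> input J s ->
  runs B solve_by_runs s (100 * (dnum J * n + dnum J * D * pmax J + 1) * L)
    (fun s' => is_opt_value J (rg s' 0)).
Proof.
  intros R1 HI. pose proof (log_pos J) as [HL HN]. pose proof (dnum_pos J J_ne) as Hd. pose proof (n_pos J B J_ne big) as Hn.
  remember (dnum J * n + dnum J * D * pmax J + 1) as F eqn:EF.
  assert (HnF : n <= F) by nia.
  unfold solve_by_runs.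
  apply runs_seq with (T1 := 3 * n + 3 * L * (3 * n + 1)) (T2 := 70 * F * L).
  { assert (n * L <= F * L) by (apply Nat.mul_le_mono_r; auto).
    assert (n <= n * L) by nia. assert (L <= F * L) by nia. lia. }
  eapply runs_weaken; [apply (front_correct J); auto | lia |].
  intros s1 _ (R1' & R2 & R3 & R4 & R5 & K & HS & HA) _.
  pose proof (instance_fits K HS) as fw.
  apply runs_if; [okx; auto | |]; sx; rewrite R3; intros Hq.
  - destruct (Nat.ltb_spec 0 (pmax J)) as [Hp |]; [| lia].
    eapply runs_weaken;
      [apply (by_runs_correct (instance_of K) B fw) with (groups := dnum J * pmax J) (logb := L) | |].
    + exact (proj2 HS).
    + exact HN.
    + exact (groups_bound K HS).
    + split; auto.
    + cbn [size deadline instance_of].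
      assert (HD : D * 1 <= D * (dnum J * pmax J)) by (apply Nat.mul_le_mono_l; nia).
      assert (HDF : D + 1 <= F) by lia.
      assert (E : dnum J * pmax J * ((L + 3) * (8 * D)) = 8 * (L + 3) * (dnum J * D * pmax J)) by ring.
      rewrite E.
      assert (8 * (L + 3) * (dnum J * D * pmax J) <= 8 * (L + 3) * F) by (apply Nat.mul_le_mono_l; lia).
      assert (F <= F * L) by nia. nia.
    + intros s2 _ E. rewrite E. exact (best_is_opt K HS).
  - destruct (Nat.ltb_spec 0 (pmax J)) as [| Hp]; [lia |].
    apply runs_asg; [exact I | sx].
    pose proof (best_is_opt K HS) as Ho.
    replace n with (0 + n) in Ho by lia. rewrite best_free_run in Ho.
    + assert (E : total J = sumf (wj K) n).
      { unfold total. rewrite (list_sum_perm _ _ (Permutation_map weight (proj1 HS))).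
        rewrite (list_sum_nth weight job0), <- (Permutation_length (proj1 HS)). reflexivity. }
      cbn [best] in Ho. rewrite E in Ho.
      replace (sumf (wj K) n - (0 + sumf (fun j => wj K (0 + j)) n)) with 0 in Ho; auto.
      change (sumf (fun j => wj K (0 + j)) n) with (sumf (wj K) n). lia.
    + exact (due_sorted K HS).
    + intros j _. pose proof (perm_bounds K (0 + j) (proj1 HS)). lia.
Qed.

Lemma solve_by_weight_correct s : rg s 1 = n -> input J s ->
  runs B solve_by_weight s (1000 * (n ^ 2 + n * min D (W ^ 2) + 1) * L)
    (fun s' => is_opt_value J (rg s' 0)).
Proof.
  intros R1 HI. pose proof (log_pos J) as [HL HN]. pose proof (n_pos J B J_ne big) as Hn.
  rewrite !Nat.pow_2_r.
  remember (n * n + n * min D (W * W) + 1) as F eqn:EF.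
  assert (HnF : n <= n * n) by nia.
  assert (HFL : F <= F * L) by nia.
  unfold solve_by_weight.
  apply runs_seq with (T1 := 3 * n + 3 * L * (3 * n + 1)) (T2 := 900 * F * L).
  { assert (n * L <= F * L) by (apply Nat.mul_le_mono_r; lia).
    assert (L <= F * L) by nia. lia. }
  eapply runs_weaken; [apply (front_correct J); auto | lia |].
  intros s1 _ (R1' & R2 & R3 & R4 & R5 & K & HS & HA) _.
  pose proof (instance_fits K HS) as fw.
  assert (HLd : loaded (instance_of K) s1) by (split; auto).
  assert (HNN : N = n + D + pmax J + W + 2) by reflexivity.
  pose proof (B_lin J B big) as HB.
  assert (HWW : W * W <= N * N) by (apply Nat.mul_le_mono; lia).
  apply runs_if; [okx; rewrite R1', R4; repeat split; auto; lia | |]; sx; rewrite R1', R2, R4; intros Hq.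
  - destruct (Nat.ltb_spec (n + W * W) D) as [Hlt |]; [| lia].
    rewrite Nat.min_r in EF by lia.
    apply runs_seq with (T1 := (n + 2) * (3 * n + 2)) (T2 := n * (40 * S W * S W + 3)).
    { assert (n * (40 * S W * S W + 3) <= 80 * (n * (W * W)) + 83 * (n * n)).
      { assert (S W * S W <= 2 * (W * W) + 2) by nia. nia. }
      assert ((n + 2) * (3 * n + 2) <= 20 * (n * n)) by nia.
      lia. }
    eapply runs_weaken; [apply (greedy_correct (instance_of K) B fw); auto | reflexivity |].
    intros s2 F2 (r & Hr & HK & Hst & Hsum) _.
    keep_loaded F2.
    eapply runs_weaken; [apply (window_correct (instance_of K) B fw s2 r); auto | reflexivity |].
    intros s3 _ E. rewrite E. exact (best_is_opt K HS).
  - destruct (Nat.ltb_spec (n + W * W) D) as [| Hge]; [lia |].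
    eapply runs_weaken; [apply (lawler_moore_correct (instance_of K) B fw); auto | |].
    + cbn [size deadline instance_of].
      assert (D <= n + min D (W * W)) by lia.
      assert (n * D <= n * (n + min D (W * W))) by (apply Nat.mul_le_mono_l; auto).
      assert (D <= n * D) by nia. lia.
    + intros s2 _ E. rewrite E. exact (best_is_opt K HS).
Qed.

End Assembly.

Theorem theorem7 :
  solvable_in (fun J => dnum J * n_of J + dnum J * dmax J * pmax J) /\
  solvable_in (fun J => n_of J ^ 2 + dmax J * wmax J ^ 2) /\
  solvable_in (fun J => n_of J ^ 2 + dnum J * Nat.sqrt_up ((dmax J * wmax J) ^ 3)).
Proof.
  assert (len_sq : forall J : list job, length J <= length J ^ 2) by (intros J; cbn; nia).
  split; [| split].
  - apply solvable_of_cmd with (c := solve_by_runs) (C := 100) (k := 1); [reflexivity | |].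
    + intros J HJ. unfold n_of. pose proof (dnum_pos J HJ). nia.
    + intros J B s HJ HB R1 HI. rewrite Nat.pow_1_r. now apply solve_by_runs_correct.
  - apply solvable_of_cmd with (c := solve_by_weight) (C := 2000) (k := 1); [reflexivity | |].
    + intros J _. unfold n_of. specialize (len_sq J). lia.
    + intros J B s HJ HB R1 HI. rewrite Nat.pow_1_r.
      eapply runs_weaken; [now apply (solve_by_weight_correct J B) | | intros s' _ H; exact H].
      pose proof (min_le_square (length J) (dmax J) (wmax J)). unfold n_of. apply Nat.mul_le_mono_r. lia.
  - apply solvable_of_cmd with (c := solve_by_weight) (C := 2000) (k := 1); [reflexivity | |].
    + intros J _. unfold n_of. specialize (len_sq J). lia.
    + intros J B s HJ HB R1 HI. rewrite Nat.pow_1_r.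
      eapply runs_weaken; [now apply (solve_by_weight_correct J B) | | intros s' _ H; exact H].
      pose proof (min_le_sqrt (dnum J) (length J) (dmax J) (wmax J) (dnum_pos J HJ)). unfold n_of. apply Nat.mul_le_mono_r. lia.
Qed.
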